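(* Let $0\le\alpha<2$ and $\beta,\mu\in\mathbb R$ with $(1-\alpha-\beta)^2\ge 4\mu$. Consider the boundary control system $$u_{tt}-(x^\alpha u_x)_x-\beta x^{\alpha-1}u_x-\frac{\mu}{x^{2-\alpha}}u=0\ \text{ in }(0,1)\times(0,T),\qquad (B_\nu u)(t)=f(t),\ u(1,t)=0\ \text{ for } t\in(0,T),$$ $$u(x,0)=u_0(x),\qquad u_t(x,0)=u_1(x)\ \text{ for } x\in(0,1).$$ This system is exactly controllable in any time $$T>\frac{4}{2-\alpha}.$$ More precisely, for every $U_0=(u_0,u_1)$ and $U_T$ in $X=\mathcal H^{\nu+1/2}\times\mathcal H^{\nu-1/2}$ there exists a control $f\in L^2((0,T);\mathbb C)$ such that the corresponding weak solution of the controlled system satisfies $(u(T),u_t(T))=U_T$.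
   Context: Parameters: $\kappa_\alpha=\frac{2-\alpha}{2}$, $\Delta=(1-\alpha-\beta)^2-4\mu\ge 0$, $\nu=\frac{\sqrt\Delta}{2\kappa_\alpha}$, $\sigma=\frac{1-\alpha-\beta}{2}$. Boundary control operator at the endpoint $x=0$: $(B_\nu u)(t)=\lim_{x\to0^+}\frac{u(x,t)}{x^\sigma\log(1/x)}$ if $\nu=0$, and $(B_\nu u)(t)=\lim_{x\to0^+}x^{-\sigma+\sqrt\Delta/2}u(x,t)$ if $\nu>0$. Spectral data: $J_\nu$ is the Bessel function of the first kind and $0<j_{\nu,1}<j_{\nu,2}<\dots$ are its positive zeros. For $k\ge1$ put $$\Phi_k(x)=\frac{(2\kappa_\alpha)^{1/2}}{|J_\nu'(j_{\nu,k})|}x^\sigma J_\nu(j_{\nu,k}x^{\kappa_\alpha}),\qquad \lambda_k=\kappa_\alpha^2 j_{\nu,k}^2 .$$ $(\Phi_k)_{k\ge1}$ is an orthonormal basis of the complex Hilbert space $L^2_\beta(0,1)=L^2((0,1);x^\beta dx)$, and $-(x^\alpha \Phi_k')'-\beta x^{\alpha-1}\Phi_k'-\mu x^{\alpha-2}\Phi_k=\lambda_k\Phi_k$. Fractional spaces: for $s\in\mathbb R$, $\mathcal H^s$ is the Hilbert space of series (formal if $s<0$) $u=\sum_{k\ge1}a_k\Phi_k$, $a_k\in\mathbb C$, with $\|u\|_{\mathcal H^s}^2=\sum_k\lambda_k^s|a_k|^2<\infty$ and inner product $\langle\sum a_k\Phi_k,\sum c_k\Phi_k\rangle_{\mathcal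 H^s}=\sum_k\lambda_k^s a_k\overline{c_k}$. Thus $\mathcal H^0=L^2_\beta(0,1)$, and for $s>0$ the space $\mathcal H^{-s}$ is the dual of $\mathcal H^{s}$ with respect to the pivot space $L^2_\beta(0,1)$. The operator $\mathcal A:\mathcal H^{s+2}\to\mathcal H^s$ acts by $\mathcal A\sum a_k\Phi_k=\sum\lambda_k a_k\Phi_k$; it is the self-adjoint realization of $u\mapsto-(x^\alpha u_x)_x-\beta x^{\alpha-1}u_x-\mu x^{\alpha-2}u$ diagonalized by the $\Phi_k$. State spaces: $X=\mathcal H^{\nu+1/2}\times\mathcal H^{\nu-1/2}$, $X_1=\mathcal H^{\nu+3/2}\times\mathcal H^{\nu+1/2}$ and $X_{-1}=\mathcal H^{\nu-1/2}\times\mathcal H^{\nu-3/2}$, with the product Hilbert norms; $X_{-1}$ is the dual of $X_1$ with respect to the pivot space $X$. The operator $\mathbf A(w_0,w_1)=(w_1,-\mathcal A w_0)$ with domain $X_1$ is skew-adjoint on $X$, so $\mathbf A^*=-\mathbf A$, and it generates a unitary group $\mathbb T(t)$ on $X$. Observation operator: $\mathbb B_\nu^*:X_1\to\mathbb C$ is the bounded linear functional $\mathbb B_\nu^*(w_0,w_1)=\lim_{x\to0^+}x^{-\sigma}w_0(x)$ if $\nu=0$, and $\mathbb B_\nu^*(w_0,w_1)=\sqrt\Delta\,\lim_{x\to0^+}x^{-\sigma-\sqrt\Delta/2}w_0(x)$ if $\nu>0$. The control operator $\mathbb B_\nu:\mathbb C\to X_{-1}$ is defined by transposition: $\langle\mathbb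 B_\nu f,W\rangle_{X_{-1},X_1}=f\,\overline{\mathbb B_\nu^*W}$ for $f\in\mathbb C$, $W\in X_1$. Weak solution: given $U_0=(u_0,u_1)\in X$ and $f\in L^2(0,T)$, one says that $U(t)=(u(t),u_t(t))$, where $u_t$ is the time derivative of $u$, is a weak solution of the system if $U\in C([0,T];X)$ and, for every $W=(w_0,w_1)\in X_1$ and every $0\le t\le T$, $$\langle U(t)-U_0,W\rangle_X=\int_0^t\langle U(\tau),\mathbf A^*W\rangle_X\,d\tau+\int_0^t f(\tau)\,\overline{\mathbb B_\nu^*W}\,d\tau ,$$ equivalently, $$\langle u(t)-u_0,w_0\rangle_{\mathcal H^{\nu+1/2}}+\langle u_t(t)-u_1,w_1\rangle_{\mathcal H^{\nu-1/2}}=\int_0^t\Big(-\langle u(\tau),w_1\rangle_{\mathcal H^{\nu+1/2}}+\langle u_t(\tau),\mathcal A w_0\rangle_{\mathcal H^{\nu-1/2}}\Big)d\tau+\int_0^t f(\tau)\,\overline{\mathbb B_\nu^*(w_0,w_1)}\,d\tau .$$ The solution corresponding to $U_0\in X$ and $f\in L^2((0,T);\mathbb C)$ is the unique solution $U(t)=\mathbb T(t)U_0+\int_0^t\mathbb T(t-s)\mathbb B_\nu f(s)\,ds$ of $\dot U=\mathbf A U+\mathbb B_\nu f$, $U(0)=U_0$, in $X_{-1}$; its first component $u$ is asserted to satisfy $u\in C^0([0,T];\mathcal H^{\nu+1/2})\cap C^1([0,T];\mathcal H^{\nu-1/2})\cap H^2(0,T;\mathcal H^{\nu-3/2})$. Exact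 controllability in time $T$ means that the map $\Phi_T f=\int_0^T\mathbb T(T-s)\mathbb B_\nu f(s)\,ds$ from $L^2(0,T)$ to $X$ has range equal to $X$.
   Formalization: At intermediate times u_t denotes the second component of the mild solution, not the time derivative of u (the literal reading forces f=0); it is the derivative of u at t=0 and t=T, and the C^1 and H^2 regularity of u is not claimed. *)

(* Defs.v *)
From HB Require Import structures.
From mathcomp Require Import all_boot all_order all_algebra.
From mathcomp Require Import complex.
From mathcomp Require Import all_classical all_reals all_analysis.
From mathcomp Require Import ring.

Set Implicit Arguments.
Unset Strict Implicit.
Unset Printing Implicit Defensive.

Import Order.TTheory GRing.Theory Num.Theory.
Import numFieldNormedType.Exports.

Local Open Scope classical_set_scope.
Local Open Scope ring_scope.
Local Open Scope complex_scope.

Local Notation Re := (@complex.Re _).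
Local Notation Im := (@complex.Im _).

Section ComplexAnalysis.
Context {R : realType}.
Local Notation leb := (@lebesgue_measure R).

Definition sqrmod (z : R[i]) : R := Re z ^+ 2 + Im z ^+ 2.

(* Sums, limits and integrals of complex-valued functions are taken on the
   real and imaginary parts. *)
Definition csum (u : nat -> R[i]) : R[i] :=
  limn (series (Re \o u)) +i* limn (series (Im \o u)).

Definition clim0 (F : R -> R[i]) : R[i] :=
  lim (Re (F x) @[x --> 0^'+]) +i* lim (Im (F x) @[x --> 0^'+]).

Definition cintegral (D : set R) (F : R -> R[i]) : R[i] :=
  (\int[leb]_(t in D) Re (F t)) +i* (\int[leb]_(t in D) Im (F t)).

(* Representatives of the classes in L^2((0,T); C). *)
Definition L2 (T : R) : set (R -> R[i]) :=
  [set f : R -> R[i] | [/\ measurable_fun `]0, T[ (Re \o f),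
               measurable_fun `]0, T[ (Im \o f) &
               (\int[leb]_(t in `]0%R, T[) (sqrmod (f t))%:E < +oo)%E]].

End ComplexAnalysis.

Section Bessel.
Context {R : realType}.

(* Euler's Gamma function, for s > 0. *)
Definition Gamma (s : R) : R :=
  \int[@lebesgue_measure R]_(t in `]0, +oo[) (t `^ (s - 1) * expR (- t)).

(* J_r(z), for r >= 0 and z > 0. *)
Definition besselJ (r z : R) : R :=
  limn (series (fun m : nat =>
    (-1) ^+ m / (m`!%:R * Gamma (m%:R + r + 1)) * (z / 2) `^ (2 * m%:R + r))).

(* [bessel_zero r k] is the zero j_{r,k+1}: all sequences indexed by k >= 1
   are shifted to start at 0.  The positive zeros of J_r form a discrete closed
   subset of ]0, +oo[, bounded away from 0, so that the infima are attained. *)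
Fixpoint bessel_zero (r : R) (k : nat) : R :=
  if k is k'.+1 then inf [set z | bessel_zero r k' < z /\ besselJ r z = 0]
  else inf [set z | 0 < z /\ besselJ r z = 0].

End Bessel.

(* A (formal) series \sum_k a_k Phi_k is represented by its coefficient
   sequence a; [lam] is the sequence of eigenvalues. *)
Section SpectralSpaces.
Context {R : realType} (lam : nat -> R).
Local Notation coefs := (nat -> R[i]).
Local Notation state := ((nat -> R[i]) * (nat -> R[i]))%type.

Definition sqnormH (s : R) (a : coefs) : \bar R :=
  (\sum_(k <oo) (lam k `^ s * sqrmod (a k))%:E)%E.

Definition Hspace (s : R) : set coefs := [set a | (sqnormH s a < +oo)%E].

Definition innerH (s : R) (a c : coefs) : R[i] :=
  csum (fun k => (lam k `^ s)%:C * a k * conjc (c k)).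

Definition opA (a : coefs) : coefs := fun k => (lam k)%:C * a k.

Definition wave_op (W : state) : state := (W.2, - opA W.1).

(* The group generated by [wave_op], written on each mode; the lemmas of the
   next section show that it is one.  It acts on all formal series, hence both
   on X and on X_{-1}. *)
Definition wave_group (t : R) (W : state) : state :=
  (fun k => let w := Num.sqrt (lam k) in
     (cos (w * t))%:C * W.1 k + (sin (w * t) / w)%:C * W.2 k,
   fun k => let w := Num.sqrt (lam k) in
     - (w * sin (w * t))%:C * W.1 k + (cos (w * t))%:C * W.2 k).

End SpectralSpaces.

Section WaveGroup.
Context {R : realType} (lam : nat -> R) (lam_gt0 : forall k, 0 < lam k).

Lemma wave_group0 W : wave_group lam 0 W = W.
Proof.
case: W => a b; congr pair; apply/funext => k /=; rewrite mulr0 cos0 sin0.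
  by rewrite mul0r mul1r mul0r addr0.
by rewrite mulr0 oppr0 mul0r mul1r add0r.
Qed.

Lemma wave_groupD s t W :
  wave_group lam (s + t) W = wave_group lam s (wave_group lam t W).
Proof.
have w0 k : Num.sqrt (lam k) != 0 by rewrite gt_eqF// sqrtr_gt0.
congr pair; apply/funext => k /=; have := w0 k; set w := Num.sqrt _ => {}w0;
  case: (W.1 k) (W.2 k) => [x y] [x' y'];
  rewrite mulrDr cosD sinD /real_complex_def /=; simpc;
  congr (_ +i* _); by field.
Qed.

Lemma wave_group_isometry s t W :
  (sqnormH lam (s + 1) (wave_group lam t W).1
     + sqnormH lam s (wave_group lam t W).2
   = sqnormH lam (s + 1) W.1 + sqnormH lam s W.2)%E.
Proof.
have ge0 r a k : (0 <= (lam k `^ r * sqrmod (a k))%:E)%E.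
  by rewrite lee_fin mulr_ge0 ?powR_ge0// addr_ge0// sqr_ge0.
rewrite /sqnormH -!nneseriesD//; apply: eq_eseriesr => k _.
rewrite -!EFinD /=; congr EFin.
have l0 := lam_gt0 k; rewrite powRD; last by rewrite (gt_eqF l0) implybT.
rewrite powRr1 ?ltW//; set w := Num.sqrt _.
have w0 : w != 0 by rewrite gt_eqF// sqrtr_gt0.
have lw : lam k = w ^+ 2 by rewrite sqr_sqrtr// ltW.
rewrite -!mulrA -!mulrDr lw; congr (_ * _).
have := cos2Dsin2 (w * t).
case: (W.1 k) (W.2 k) => [x y] [x' y'] E.
rewrite /sqrmod /real_complex_def /=; simpc => /=.
transitivity ((cos (w * t) ^+ 2 + sin (w * t) ^+ 2) *
  (w ^+ 2 * (x ^+ 2 + y ^+ 2) + (x' ^+ 2 + y' ^+ 2))); first by field.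
by rewrite E mul1r.
Qed.

Let is_derive_mode (w p q t : R) :
  is_derive t (1 : R) (fun s : R => cos (w * s) * p + sin (w * s) * q)
    (- (w * sin (w * t)) * p + w * cos (w * t) * q).
Proof.
have dl : is_derive t (1 : R) ( *%R w) w.
  by apply: is_derive_eq; rewrite /GRing.scale /= mulr1.
have dc : is_derive t (1 : R) (fun s => cos (w * s)) (- sin (w * t) * w).
  by apply: is_derive1_comp.
have ds : is_derive t (1 : R) (fun s => sin (w * s)) (cos (w * t) * w).
  by apply: is_derive1_comp.
have -> : (fun s : R => cos (w * s) * p + sin (w * s) * q)
        = (p *: (fun s => cos (w * s))) + (q *: (fun s => sin (w * s))).
  by apply/funext => s /=; rewrite mulrC [X in _ + X]mulrC.
by apply: is_derive_eq; rewrite /GRing.scale /=; ring.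
Qed.

Lemma is_derive_wave_group W k (t : R) :
  let U s := wave_group lam s W in
  let V := wave_op lam (U t) in
  [/\ is_derive t (1 : R) (fun s => Re ((U s).1 k)) (Re (V.1 k)),
      is_derive t (1 : R) (fun s => Im ((U s).1 k)) (Im (V.1 k)),
      is_derive t (1 : R) (fun s => Re ((U s).2 k)) (Re (V.2 k)) &
      is_derive t (1 : R) (fun s => Im ((U s).2 k)) (Im (V.2 k))].
Proof.
have w0 : Num.sqrt (lam k) != 0 by rewrite gt_eqF// sqrtr_gt0.
have lw : lam k = Num.sqrt (lam k) ^+ 2 by rewrite sqr_sqrtr// ltW.
have opE (f : nat -> R[i]) : (- opA lam f) k = - ((lam k)%:C * f k) by [].
rewrite /= opE /=; move: (Num.sqrt _) w0 lw => w w0 ->.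
case: (W.1 k) (W.2 k) => [x y] [x' y'] /=.
split; [ have := is_derive_mode w x (x' / w) t
       | have := is_derive_mode w y (y' / w) t
       | have := is_derive_mode w x' (- (w * x)) t
       | have := is_derive_mode w y' (- (w * y)) t ].
all: set f := (fun _ => _); set df := (X in is_derive _ _ _ X) => d.
all: set g := (fun _ => _); set dg := (X in is_derive _ _ _ X).
all: have -> : g = f by apply/funext => s; rewrite /f /g; field; rewrite ?w0.
all: suff -> : dg = df by [].
all: by rewrite /df /dg; field.
Qed.

End WaveGroup.

Section Problem.
Context {R : realType} (alpha beta mu : R).
Local Notation coefs := (nat -> R[i]).
Local Notation state := ((nat -> R[i]) * (nat -> R[i]))%type.

Definition kappa : R := (2 - alpha) / 2.
Definition Delta : R := (1 - alpha - beta) ^+ 2 - 4 * mu.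
Definition nu : R := Num.sqrt Delta / (2 * kappa).
Definition sigma : R := (1 - alpha - beta) / 2.

Definition Phi (k : nat) (x : R) : R :=
  Num.sqrt (2 * kappa) / `| derive1 (besselJ nu) (bessel_zero nu k) |
  * x `^ sigma * besselJ nu (bessel_zero nu k * x `^ kappa).

Definition lambda (k : nat) : R := kappa ^+ 2 * bessel_zero nu k ^+ 2.

Definition X : set state :=
  Hspace lambda (nu + 1/2) `*` Hspace lambda (nu - 1/2).
Definition X1 : set state :=
  Hspace lambda (nu + 3/2) `*` Hspace lambda (nu + 1/2).
Definition Xm1 : set state :=
  Hspace lambda (nu - 1/2) `*` Hspace lambda (nu - 3/2).

Definition sqnormX (U : state) : \bar R :=
  (sqnormH lambda (nu + 1/2) U.1 + sqnormH lambda (nu - 1/2) U.2)%E.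

(* The inner product of X; since X is the pivot space, also the duality
   pairing between Xm1 and X1. *)
Definition innerX (U W : state) : R[i] :=
  innerH lambda (nu + 1/2) U.1 W.1 + innerH lambda (nu - 1/2) U.2 W.2.

(* The value at x of the function \sum_k a_k Phi_k. *)
Definition value (a : coefs) (x : R) : R[i] :=
  csum (fun k => a k * (Phi k x)%:C).

(* The observation operator B_nu^*. *)
Definition observe (W : state) : R[i] :=
  if nu == 0 then clim0 (fun x => (x `^ (- sigma))%:C * value W.1 x)
  else (Num.sqrt Delta)%:C *
    clim0 (fun x => (x `^ (- sigma - Num.sqrt Delta / 2))%:C * value W.1 x).

(* The control operator B_nu, defined by transposition. *)
Definition control (c : R[i]) : state :=
  xget 0 [set V | Xm1 V /\ forall W, X1 W -> innerX V W = c * conjc (observe W)].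

(* \int_0^t T(t - s) B_nu f(s) ds.  The integral in the Hilbert space X_{-1}
   is computed coefficientwise. *)
Definition input_map (t : R) (f : R -> R[i]) : state :=
  let F s := wave_group lambda (t - s) (control (f s)) in
  (fun k => cintegral `[0, t] (fun s => (F s).1 k),
   fun k => cintegral `[0, t] (fun s => (F s).2 k)).

Definition exactly_controllable (T : R) : Prop := input_map T @` L2 T = X.

Definition mild_solution (U0 : state) (f : R -> R[i]) (t : R) : state :=
  wave_group lambda t U0 + input_map t f.

(* [- wave_op] is the adjoint of the skew-adjoint operator [wave_op].  The
   component (U t).2 is the one denoted u_t: the identity below, tested with
   W = (Phi_k, 0), says that (U t).1 has the distributional derivative
   (U t).2 + (control (f t)).1 with respect to t, and (control (f t)).1 is not 0
   when f t is not 0. *)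
Definition weak_solution (T : R) (U0 : state) (f : R -> R[i]) (U : R -> state)
    : Prop :=
  [/\ forall t, t \in `[0, T] -> X (U t),
      forall t, t \in `[0, T] ->
        sqnormX (U s - U t) @[s --> within `[0, T] (nbhs t)] --> 0%E &
      forall W, X1 W -> forall t, t \in `[0, T] ->
        innerX (U t - U0) W =
          cintegral `[0, t] (fun s => innerX (U s) (- wave_op lambda W))
          + cintegral `[0, t] (fun s => f s * conjc (observe W))].

(* The derivative of u in H^(nu - 1/2) at t, relative to [0, T]. *)
Definition has_time_derivative (T : R) (u : R -> coefs) (t : R) (v : coefs)
    : Prop :=
  sqnormH lambda (nu - 1/2)
      (fun k => (u s k - u t k) / (s - t)%:C - v k)
    @[s --> within `[0, T] t^'] --> 0%E.

End Problem.

(* Main.v *)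
Require Import Defs.
From mathcomp Require Import all_boot all_order all_algebra.
From mathcomp Require Import complex.
From mathcomp Require Import all_classical all_reals all_analysis.
From mathcomp Require Import measurable_realfun.
From mathcomp Require Import ring lra zify.

Set Implicit Arguments.
Unset Strict Implicit.
Unset Printing Implicit Defensive.

Import Order.TTheory GRing.Theory Num.Theory.
Import numFieldNormedType.Exports.

Local Open Scope classical_set_scope.
Local Open Scope ring_scope.

(** In the basis Phi_k the system is a sequence of uncoupled oscillators.  The
    k-th one has the frequency omega_k = sqrt (lambda_k) = kappa j_(nu,k) and
    is forced by [ctrl_coef k * f].  This is what transposition gives: near 0,
    Phi_k x = Phi_lead k * x^(sigma + kappa nu) * (P_nu 0 + o(1)), so that the
    observation of a series is the sum of its coefficients weighted by
    [obs_coef k] ([observe_series]), and dividing by the weight of H^(nu + 1/2)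
    gives the control operator ([controlE]).

    Conjugating with the wave group, the state reached at time t from 0 is
    wave_group t applied to the sequence of the numbers
      ctrl_coef k * int_0^t f(r) cos (omega_k r) dr,
      omega_k * ctrl_coef k * int_0^t f(r) sin (omega_k r) dr
    ([duhamel_formula]).  The product lambda_k^(nu + 1/2) ctrl_coef(k)^2 lies
    between two positive constants ([ctrl_coef_bounds]): up to constants it is
    the inverse of j_k J_nu'(j_k)^2, and the energy w^2 + w'^2 of
    w(z) = sqrt(z) J_nu(z), which solves w'' = - (1 - (nu^2 - 1/4) / z^2) w, is
    bounded above and below.  Hence the norm of X is equivalent to the l^2
    norm of the moments of f.  That solutions stay in X and are continuous in time is
    Bessel's inequality for the family cos (omega_k t), sin (omega_k t); exact
    controllability says that every l^2 sequence is a sequence of moments of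
    some square-integrable f on [0, T].

    This moment problem is solved in three stages.  Sturm comparison of w with
    sin shows that consecutive zeros of J_nu are separated, with gaps tending
    to pi ([bessel_zero_gap], [bessel_zero_gap_pi]); so omega_k has
    asymptotic gap kappa pi, and 2 pi / (kappa pi) = 4 / (2 - alpha) is the
    critical length.  If all the gaps exceed 2 pi / (b - a), Ingham's cosine
    window makes the Gram matrix of the family diagonally dominant, and
    iterating the approximate solution that it provides gives an exact one
    ([well_spaced_interpolating]).  If this holds for the large frequencies
    only, the finitely many small ones are first replaced by well-spaced ones,
    which are then exchanged one by one for the true frequencies
    ([interpolating_replace]); the correction is the solution of
    Q'' + y^2 Q = f with vanishing Cauchy data at both ends, for which the
    moments at every frequency w are divided by y^2 - w^2.

    The control is taken with support in [d, T - d], since T - 2 d can still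
    exceed the critical length.  Near the end points the solution is therefore
    a free wave, and its first component has the prescribed time derivatives
    there.  The weak formulation is checked mode by mode and summed by
    dominated convergence ([trajectory_weak]); tested with single modes, it
    determines every coordinate of a solution ([weak_solution_unique]). *)

(** * Derivatives and integrals *)

Section Derivation_toolkit.
Context {R : realType}.
Implicit Types (f g : R -> R).

Lemma isd_add f g (x a b : R) : is_derive x 1 f a -> is_derive x 1 g b ->
  is_derive x 1 (fun t => f t + g t) (a + b).
Proof. by move=> h h'; exact: (is_deriveD h h'). Qed.

Lemma isd_opp f (x a : R) : is_derive x 1 f a ->
  is_derive x 1 (fun t => - f t) (- a).
Proof. by move=> h; exact: (is_deriveN h). Qed.

Lemma isd_sub f g (x a b : R) : is_derive x 1 f a -> is_derive x 1 g b ->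
  is_derive x 1 (fun t => f t - g t) (a - b).
Proof. by move=> h h'; exact: (is_deriveB h h'). Qed.

Lemma isd_mul f g (x a b : R) : is_derive x 1 f a -> is_derive x 1 g b ->
  is_derive x 1 (fun t => f t * g t) (a * g x + f x * b).
Proof.
move=> h h'; apply: (is_derive_eq (is_deriveM h h')).
by rewrite /GRing.scale /= addrC (mulrC a).
Qed.

Lemma isd_scale f (c x a : R) : is_derive x 1 f a ->
  is_derive x 1 (fun t => c * f t) (c * a).
Proof. by move=> h; exact: (is_deriveZ c h). Qed.

Lemma isd_id (x : R) : is_derive x 1 (fun t : R => t) 1.
Proof. exact: is_derive_id. Qed.

Lemma isd_cst (c x : R) : is_derive x 1 (fun _ : R => c) 0.
Proof. exact: is_derive_cst. Qed.

Lemma isd_comp f g (x a b : R) : is_derive (g x) 1 f a -> is_derive x 1 g b ->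
  is_derive x 1 (fun t => f (g t)) (a * b).
Proof. by move=> h h'; exact: is_derive1_comp. Qed.

Lemma isd_affine (c d x : R) : is_derive x 1 (fun t : R => c * (t - d)) c.
Proof.
apply: (is_derive_eq (isd_scale c (isd_sub (isd_id x) (isd_cst d x)))).
by rewrite subr0 mulr1.
Qed.

Lemma isd_continuous f (x a : R) : is_derive x 1 f a -> {for x, continuous f}.
Proof.
move=> h; apply/differentiable_continuous/derivable1_diffP.
exact: (@ex_derive _ _ _ _ _ _ _ h).
Qed.

Lemma isd_derivable f (x a : R) : is_derive x 1 f a -> derivable f x 1.
Proof. by move=> h; exact: (@ex_derive _ _ _ _ _ _ _ h). Qed.

Lemma isd_derive1 f (x a : R) : is_derive x 1 f a -> derive1 f x = a.
Proof. by move=> h; rewrite derive1E (@derive_val _ _ _ _ _ _ _ h). Qed.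

Lemma isd_ndecr f f' (a b : R) : a <= b ->
  (forall x, a <= x <= b -> is_derive x 1 f (f' x)) ->
  (forall x, a <= x <= b -> 0 <= f' x) -> f a <= f b.
Proof.
rewrite le_eqVlt => /predU1P[-> //|ab] df f0.
have cf : {within `[a, b], continuous f}.
  apply: derivable_within_continuous => x; rewrite in_itv/= => xab.
  exact: isd_derivable (df x xab).
have df' x : x \in `]a, b[%R -> is_derive x 1 f (f' x).
  by rewrite in_itv/= => /andP[ax xb]; apply: df; rewrite !ltW.
have [c] := MVT ab df' cf; rewrite in_itv/= => /andP[ac cb] e.
by rewrite -subr_ge0 e mulr_ge0 ?subr_ge0 ?(ltW ab)// f0// !ltW.
Qed.

Lemma isd_nincr f f' (a b : R) : a <= b ->
  (forall x, a <= x <= b -> is_derive x 1 f (f' x)) ->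
  (forall x, a <= x <= b -> f' x <= 0) -> f b <= f a.
Proof.
move=> ab df f0; rewrite -lerN2.
apply: (@isd_ndecr (fun x => - f x) (fun x => - f' x)) => // x xab.
  exact: isd_opp (df x xab).
by rewrite oppr_ge0 f0.
Qed.

Lemma continuous_sumn (F : nat -> R -> R) (N : nat) : (forall k, continuous (F k)) ->
  continuous (fun t => \sum_(0 <= k < N) F k t).
Proof.
move=> cF; elim: N => [|N ih] t.
  rewrite (_ : (fun _ => _) = fun=> 0); first exact: cvg_cst.
  by apply/funext => u; rewrite big_geq.
rewrite (_ : (fun _ => _) = fun t => \sum_(0 <= k < N) F k t + F N t).
  by apply: cvgD; [exact: ih|exact: cF].
by apply/funext => u; rewrite big_nat_recr.
Qed.

End Derivation_toolkit.

Section Integration_toolkit.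
Context {R : realType}.
Local Notation leb := (@lebesgue_measure R).
Local Notation integ D f := (leb.-integrable D (EFin \o f)).
Implicit Types (D : set (measurableTypeR R)) (f g : R -> R).

Lemma integ_scale D (mD : measurable D) (c : R) f :
  integ D f -> integ D (fun t => c * f t).
Proof. by move=> h; exact: (integrableZl mD c h). Qed.

Lemma integ_add D (mD : measurable D) f g :
  integ D f -> integ D g -> integ D (fun t => f t + g t).
Proof. by move=> h h'; exact: (integrableD mD h h'). Qed.

Lemma integ_sub D (mD : measurable D) f g :
  integ D f -> integ D g -> integ D (fun t => f t - g t).
Proof. by move=> h h'; exact: (integrableB mD h h'). Qed.

Lemma integ_sum D (mD : measurable D) (I : Type) (s : seq I) (F : I -> R -> R) :
  (forall i, integ D (F i)) -> integ D (fun t => \sum_(i <- s) F i t).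
Proof.
move=> h; elim: s => [|i s ih].
  rewrite (_ : (fun _ => _) = fun=> 0); last by apply/funext => t; rewrite big_nil.
  exact: integrable0.
rewrite (_ : (fun _ => _) = fun t => F i t + \sum_(j <- s) F j t).
  exact: integ_add.
by apply/funext => t; rewrite big_cons.
Qed.

Lemma Rintegral_sum D (mD : measurable D) (I : Type) (s : seq I) (F : I -> R -> R) :
  (forall i, integ D (F i)) ->
  \int[leb]_(t in D) (\sum_(i <- s) F i t) = \sum_(i <- s) \int[leb]_(t in D) F i t.
Proof.
move=> h; elim: s => [|i s ih].
  rewrite big_nil (_ : (fun _ => _) = fun=> 0); last by apply/funext => t; rewrite big_nil.
  by rewrite Rintegral_cst// mul0r.
rewrite big_cons -ih -RintegralD//; last exact: integ_sum.
by apply: eq_Rintegral => t _; rewrite big_cons.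
Qed.

(** Linearity, with the pointwise identity as a side condition: the integrand
    need not be rewritten under its binder. *)
Lemma Rintegral_lincomb D (mD : measurable D) (c d : R) f g h :
  integ D g -> integ D h -> (forall t, f t = c * g t + d * h t) ->
  \int[leb]_(t in D) f t = c * \int[leb]_(t in D) g t + d * \int[leb]_(t in D) h t.
Proof.
move=> ig ih fE; transitivity (\int[leb]_(t in D) (c * g t + d * h t)).
  by apply: eq_Rintegral => t _.
by rewrite RintegralD ?RintegralZl//; exact: integ_scale.
Qed.

Lemma integ_continuous (a b : R) f : continuous f -> integ `[a, b] f.
Proof.
move=> cf; apply: continuous_compact_integrable; first exact: segment_compact.
exact: continuous_subspaceT.
Qed.

Lemma integ_dominated D (mD : measurable D) f g : measurable_fun D f ->
  integ D g -> (forall t, D t -> `|f t| <= g t) -> integ D f.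
Proof.
move=> mf ig fg; apply: (le_integrable mD _ _ ig); first exact/measurable_EFinP.
by move=> t Dt; rewrite lee_fin (le_trans (fg t Dt))// ler_norm.
Qed.

Lemma integ_measurable D f : integ D f -> measurable_fun D f.
Proof. by move=> /measurable_int/measurable_EFinP. Qed.

Lemma integ_mul_bounded D (mD : measurable D) f g (K : R) : measurable_fun D f ->
  integ D g -> (forall t, D t -> `|f t| <= K) -> integ D (fun t => f t * g t).
Proof.
move=> mf ig fK; apply: (@integ_dominated _ mD _ (fun t => K * `|g t|)).
- by apply: measurable_funM => //; exact: integ_measurable.
- by apply: integ_scale => //; exact: (integrable_norm ig).
- by move=> t Dt; rewrite normrM ler_wpM2r// fK.
Qed.

Lemma Rintegral_itv1 (t : R) f : \int[leb]_(x in `[t, t]) f x = 0.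
Proof. by rewrite set_itv1 Rintegral_set1. Qed.

(** The form of the fundamental theorem used throughout: an explicit
    antiderivative on the whole line. *)
Lemma Rintegral_antiderivative (a b : R) (F f : R -> R) : a <= b ->
  (forall t, is_derive t (1 : R) F (f t)) -> continuous f ->
  \int[leb]_(t in `[a, b]) f t = F b - F a.
Proof.
rewrite le_eqVlt => /predU1P[<- _ _|ab dF cf].
  by rewrite Rintegral_itv1 subrr.
have cF : continuous F.
  by move=> x; exact: isd_continuous (dF x).
rewrite /Rintegral (continuous_FTC2 (F := F))//.
- exact: continuous_subspaceT.
- split=> [x _||].
  + exact: isd_derivable (dF x).
  + by apply: cvg_at_right_filter; exact: cF.
  + by apply: cvg_at_left_filter; exact: cF.
- by move=> x _; exact: isd_derive1 (dF x).
Qed.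

Lemma Rintegral_itv_cst (a b c : R) : a <= b ->
  \int[leb]_(t in `[a, b]) c = c * (b - a).
Proof.
move=> ab; rewrite (Rintegral_antiderivative ab (isd_affine c a)).
  by rewrite subrr mulr0 subr0.
by move=> x; exact: cvg_cst.
Qed.

End Integration_toolkit.

(** * The Gamma function *)

Section Gamma_function.
Context {R : realType}.
Local Notation leb := (@lebesgue_measure R).

(** Half of the exponential absorbs the power; this gives the integrable
    majorant of the Gamma integrand. *)
Lemma powR_mul_expRN_le (p : R) : 0 <= p -> exists2 K : R, 0 <= K &
  forall t, 0 <= t -> t `^ p * expR (- t) <= K * expR (- (t / 2)).
Proof.
move=> p0; pose c := 2 * p + 1; have c0 : 0 < c by rewrite /c; lra.
exists (expR (p * ln c)); first exact: expR_ge0.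
move=> t; rewrite le_eqVlt => /predU1P[<-|t0].
  rewrite mul0r oppr0 expR0 !mulr1 (@le_trans _ _ 1)//.
    by have [->|pn0] := eqVneq p 0; rewrite ?powRr0// powR0.
  by rewrite -[leLHS]expR0 ler_expR mulr_ge0// ln_ge0// /c; lra.
 rewrite /powR gt_eqF// -!expRD ler_expR.
have : ln (t / c) <= t / c.
  have -> : t / c = 1 + (t / c - 1) by lra.
  apply: (le_trans (le_ln1Dx _)); last lra.
  by rewrite ltrBrDr addNr divr_gt0.
rewrite ln_div ?posrE// => h.
have h2 : p * (ln t - ln c) <= p * (t / c) by exact: ler_wpM2l.
have h3 : p * (t / c) <= t / 2.
  rewrite mulrCA ler_wpM2l ?(ltW t0)// ler_pdivrMr// /c; lra.
lra.
Qed.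

Let dexp (c t : R) : is_derive t 1 (fun t : R => expR (- (t * c))) (- c * expR (- (t * c))).
Proof.
have h : is_derive t (1 : R) (fun t : R => - (t * c)) (- c).
  apply: (is_derive_eq (isd_opp (isd_mul (isd_id t) (isd_cst c t)))).
  by rewrite mulr0 addr0 mul1r.
by apply: (is_derive_eq (isd_comp (is_derive_expR _) h)); rewrite mulrC.
Qed.

Let dexp1 (t : R) : is_derive t 1 (fun t : R => expR (- t)) (- expR (- t)).
Proof.
have := dexp 1 t; rewrite mulr1 mulN1r; congr (is_derive _ _ _ _).
by apply/funext => u; rewrite mulr1.
Qed.

Let cvg_exp : (fun t : R => expR (- (t / 2))) x @[x --> +oo] --> (0 : R).
Proof.
have h : (fun t : R => t / 2) x @[x --> +oo] --> +oo by apply: gt0_cvgMly; rewrite ?invr_gt0//; exact: cvg_id.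
exact: (cvg_comp _ _ h (@cvgr_expR R)).
Qed.

Let int_exp : (\int[leb]_(x in `[0%R, +oo[) (expR (- (x / 2)))%:E = 2%:E)%E.
Proof.
have c0 (x : R) : {for x, continuous (fun t : R => expR (- (t / 2)))}.
  exact: isd_continuous (dexp 2^-1 x).
rewrite (@ge0_continuous_FTC2y _ _ (fun t => - 2 * expR (- (t / 2))) 0 0).
- by rewrite -EFinB; congr EFin; rewrite mul0r oppr0 expR0; lra.
- by move=> x _; exact: expR_ge0.
- by apply: continuous_subspaceT => x; exact: c0.
- rewrite -[X in _ --> X](mulr0 (- 2)); apply: cvgMr; exact: cvg_exp.
- by move=> x _; exact: isd_derivable (isd_scale (- 2) (dexp 2^-1 x)).
- apply: cvg_at_right_filter; apply: cvgMr; exact: c0.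
- move=> x _; rewrite (isd_derive1 (isd_scale (- 2) (dexp 2^-1 x))); lra.
Qed.

Let exp_integrable : leb.-integrable `]0, +oo[ (EFin \o (fun t : R => expR (- (t / 2)))).
Proof.
apply: (@integrableS _ _ _ leb `[(0 : R), +oo[%classic) => //; first by apply: subset_itvr; rewrite bnd_simp.
have m : measurable_fun `[(0:R), +oo[ (fun t : R => expR (- (t / 2))).
  apply: measurableT_comp => //; apply: measurable_funTS.
  by apply: measurableT_comp => //; exact: measurable_funM.
apply/integrableP; split; first exact/measurable_EFinP.
under eq_integral do rewrite gee0_abs ?lee_fin ?expR_ge0//.
by rewrite int_exp ltry.
Qed.

Lemma Gamma_integrable (s : R) : 1 <= s ->
  leb.-integrable `]0, +oo[ (EFin \o (fun t : R => t `^ (s - 1) * expR (- t))).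
Proof.
move=> s1; have [|K K0 hK] := @powR_mul_expRN_le (s - 1); first by rewrite subr_ge0.
have mD : measurable (`]0, +oo[%classic : set (measurableTypeR R)) by exact: measurable_itv.
apply: (integ_dominated mD _ (integ_scale mD K exp_integrable)).
  apply: measurable_funTS; apply: measurable_funM.
    exact: measurable_powR.
  by apply: measurableT_comp => //.
move=> t /=; rewrite in_itv /= andbT => /ltW t0.
by rewrite ger0_norm ?hK// mulr_ge0 ?powR_ge0 ?expR_ge0.
Qed.

Let int_exp' : \int[leb]_(x in `]0, +oo[) expR (- (x / 2)) = 2.
Proof. by rewrite Rintegral_itv_obnd_cbnd// /Rintegral int_exp. Qed.

Let powR_cvg_at_right0 (p : R) : 0 <= p -> x `^ p @[x --> (0 : R)^'+] --> (0 : R) `^ p.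
Proof.
rewrite le_eqVlt => /predU1P[<-|p0].
  by under eq_fun do rewrite powRr0; rewrite powRr0; exact: cvg_cst.
by rewrite powR0 ?gt_eqF//; exact: powR_cvg0.
Qed.

Let dpow (p t : R) : 0 < t -> is_derive t 1 (fun t : R => - (t `^ p * expR (- t)))
  (t `^ p * expR (- t) - p * t `^ (p - 1) * expR (- t)).
Proof.
move=> t0; have h1 := is_derive1_powR p t0.
have h2 := dexp1 t.
by apply: (is_derive_eq (isd_opp (isd_mul h1 h2))); lra.
Qed.

(** Integration by parts on [0, +oo[. *)
Lemma GammaS (s : R) : 1 <= s -> Gamma (s + 1) = s * Gamma s.
Proof.
move=> s1; have s0 : 0 < s by lra.
have [|K K0 hK] := @powR_mul_expRN_le (s - 1); first by rewrite subr_ge0.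
(* the derivative of - t^s exp (- t) changes sign; adding a multiple of
   exp (- t / 2) makes it nonnegative *)
pose f (t : R) := t `^ s * expR (- t) - s * t `^ (s - 1) * expR (- t)
                  + s * K * expR (- (t / 2)).
pose F (t : R) := - (t `^ s * expR (- t)) - 2 * s * K * expR (- (t / 2)).
have dF (t : R) : 0 < t -> is_derive t (1 : R) F (f t).
  move=> t0; have h1 := dpow s t0; have h2 := dexp 2^-1 t.
  apply: (is_derive_eq (isd_sub (dpow s t0) (isd_scale (2 * s * K) (dexp 2^-1 t)))).
  by rewrite /f; lra.
have ct (c x : R) : {for x, continuous (fun t : R => expR (- (t * c)))}.
  exact: isd_continuous (dexp c x).
have ct1 (x : R) : {for x, continuous (fun t : R => expR (- t))}.
  exact: isd_continuous (dexp1 x).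
have cp (x p : R) : 0 < x -> {for x, continuous (fun t : R => t `^ p)}.
  by move=> x0; exact: isd_continuous (is_derive1_powR p x0).
have E : (\int[leb]_(x in `[0, +oo[) f x = 2 * s * K).
  rewrite (@Rintegral_ge0_continuous_FTC2y _ _ F 0 0).
  - rewrite /F powR0 ?gt_eqF// mul0r oppr0 add0r mul0r oppr0 expR0; lra.
  - move=> x x0; rewrite /f.
    have := hK x x0; rewrite -(ler_pM2l s0).
    have : 0 <= x `^ s * expR (- x) by rewrite mulr_ge0 ?powR_ge0 ?expR_ge0.
    lra.
  - apply/continuous_within_itvcyP; split.
      move=> x; rewrite in_itv/= andbT => x0.
      apply: cvgD; [apply: cvgB; [apply: cvgM|apply: cvgM; [apply: cvgMr|]]|apply: cvgMr] => //; by [exact: cp|exact: ct1|exact: ct].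
    apply: cvgD; [apply: cvgB; [apply: cvgM|apply: cvgM; [apply: cvgMr|]]|apply: cvgMr] => //.
    + by apply: powR_cvg_at_right0; lra.
    + by apply: cvg_at_right_filter; exact: ct1.
    + by apply: powR_cvg_at_right0; lra.
    + by apply: cvg_at_right_filter; exact: ct1.
    + by apply: cvg_at_right_filter; exact: ct.
  - have -> : (0 : R) = 0 - 2 * s * K * 0 by rewrite mulr0 subr0.
    apply: cvgB; last by apply: cvgMr; exact: cvg_exp.
    rewrite -oppr0; apply: cvgN.
    have [|K' K'0 hK'] := @powR_mul_expRN_le s; first exact: ltW.
    apply: (@squeeze_cvgr _ _ _ _ (fun=> 0) (fun x => K' * expR (- (x / 2)))).
    + near=> x; rewrite hK' ?andbT ?mulr_ge0 ?powR_ge0 ?expR_ge0//.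
    + exact: cvg_cst.
    + by rewrite -[X in _ --> X](mulr0 K'); apply: cvgMr; exact: cvg_exp.
  - by move=> x x0; exact: isd_derivable (dF x x0).
  - apply: cvgB; last by apply: cvgMr; apply: cvg_at_right_filter; exact: ct.
    apply: cvgN; apply: cvgM; first by apply: powR_cvg_at_right0; lra.
    by apply: cvg_at_right_filter; exact: ct1.
  - move=> x; rewrite in_itv/= andbT => x0.
    exact: isd_derive1 (dF x x0).
have ix : leb.-integrable `]0, +oo[ (EFin \o (fun t : R => t `^ s * expR (- t))).
  by have := @Gamma_integrable (s + 1); rewrite addrK; apply; lra.
have ig := Gamma_integrable s1.
have mD : measurable (`]0, +oo[%classic : set (measurableTypeR R)) by exact: measurable_itv.
have ig' : leb.-integrable `]0, +oo[ (EFin \o (fun t : R => s * (t `^ (s - 1) * expR (- t)))).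
  exact: integ_scale.
have ie : leb.-integrable `]0, +oo[ (EFin \o (fun t : R => s * K * expR (- (t / 2)))).
  exact: integ_scale.
have ixg : leb.-integrable `]0, +oo[ (EFin \o (fun t : R =>
    t `^ s * expR (- t) - s * (t `^ (s - 1) * expR (- t)))).
  exact: integ_sub.
have fE : f = fun t => (t `^ s * expR (- t) - s * (t `^ (s - 1) * expR (- t)))
                  + s * K * expR (- (t / 2)) by apply/funext => t; rewrite /f mulrA.
have := E; rewrite -Rintegral_itv_obnd_cbnd fE; last first.
  exact: integ_add.
rewrite RintegralD// RintegralB// !RintegralZl// int_exp'.
rewrite /Gamma addrK; lra.
Unshelve. all: by end_near. Qed.

Lemma Gamma_gt0 (s : R) : 1 <= s -> 0 < Gamma s.
Proof.
move=> s1; have ig := Gamma_integrable s1.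
have s12 : (`[1, 2]%classic : set (measurableTypeR R)) `<=` `]0, +oo[%classic.
  by apply: subset_itv; rewrite bnd_simp.
have i12 : leb.-integrable `[1, 2] (EFin \o (fun t : R => t `^ (s - 1) * expR (- t))).
  exact: integrableS ig.
apply: (@lt_le_trans _ _ (expR (-2))); first exact: expR_gt0.
apply: (@le_trans _ _ (\int[leb]_(x in `[1, 2]) (x `^ (s - 1) * expR (- x)))).
  have -> : expR (-2) = \int[leb]_(x in `[1, 2]) expR (-2) :> R.
    rewrite Rintegral_itv_cst ?ler1n//; lra.
  apply: le_Rintegral => //.
    apply: continuous_compact_integrable; first exact: segment_compact.
    by apply: continuous_subspaceT => x; exact: cvg_cst.
  move=> x /=; rewrite in_itv/= => /andP[x1 x2].
  rewrite -[leLHS]mul1r ler_pM// ?ler_expR ?lerN2//.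
  rewrite -[leLHS](powRr0 x); apply: ler_powR => //; lra.
rewrite /Gamma /Rintegral fine_le//.
- exact: integrable_fin_num i12.
- exact: integrable_fin_num ig.
- apply: ge0_subset_integral => //.
    by apply/measurable_int; exact: ig.
  by move=> x /=; rewrite in_itv/= andbT => x0; rewrite lee_fin mulr_ge0 ?powR_ge0 ?expR_ge0.
Qed.
End Gamma_function.

(** * The power series of the Bessel functions *)

Section Bessel_series.
Context {R : realType}.
Implicit Types (r z y : R).
#[local] Opaque Gamma.

Definition bessel_coef r : nat -> R := fun m =>
  (-1) ^+ m / (m`!%:R * Gamma (m%:R + r + 1)).

(** J_r z = (z / 2)^r * besselP r (z^2 / 4): an entire function of y = z^2 / 4
    replaces the power of z, whose derivatives are singular at 0. *)
Definition besselP r y : R := limn (pseries (bessel_coef r) y).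

(** Up to a constant factor this is sqrt z * J_r z, for which Bessel's equation
    has no first-order term. *)
Definition besselW r z : R := z `^ (r + 1 / 2) * besselP r (z ^+ 2 / 4).

Definition besselW' r z : R := z `^ (r - 1 / 2) *
  ((r + 1 / 2) * besselP r (z ^+ 2 / 4) - z ^+ 2 / 2 * besselP (r + 1) (z ^+ 2 / 4)).

Let ge1 r (m : nat) : 0 <= r -> 1 <= m%:R + r + 1.
Proof. by move=> r0; have := ler0n R m; lra. Qed.

Let Gamma_shift r (m : nat) : 0 <= r ->
  Gamma (m%:R + (r + 1) + 1) = (m%:R + r + 1) * Gamma (m%:R + r + 1).
Proof. move=> r0; rewrite -(GammaS (ge1 m r0)).
by rewrite (_ : m%:R + (r + 1) = m%:R + r + 1)//; lra. Qed.

Let Gamma_ge r (m : nat) : 0 <= r -> Gamma (r + 1) <= Gamma (m%:R + r + 1).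
Proof.
move=> r0; elim: m => [|m ih]; first by rewrite add0r.
apply: (le_trans ih); rewrite (_ : m.+1%:R + r + 1 = m%:R + r + 1 + 1).
  by rewrite (GammaS (ge1 m r0)) ler_peMl ?(ge1 m r0)// ltW// (Gamma_gt0 (ge1 m r0)).
by rewrite -natr1; lra.
Qed.

Let is_cvg_besselP r y : 0 <= r -> cvgn (pseries (bessel_coef r) y).
Proof.
move=> r0; have g0 : 0 < Gamma (r + 1) by apply: Gamma_gt0; lra.
apply: normed_cvg.
apply: (@series_le_cvg _ _ (fun m => (Gamma (r + 1))^-1 * exp_coeff `|y| m)).
- by move=> n; exact: normr_ge0.
- by move=> n; rewrite mulr_ge0 ?invr_ge0 ?(ltW g0)// /exp_coeff /= mulr_ge0 ?invr_ge0// exprn_ge0.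
- move=> n; have gn := lt_le_trans g0 (Gamma_ge n r0).
  rewrite /bessel_coef /exp_coeff/= normrM normrX normrM normrX normrN1 expr1n mul1r normfV.
  have f0 : 0 < n`!%:R :> R by rewrite ltr0n fact_gt0.
  rewrite (ger0_norm (ltW (mulr_gt0 f0 gn))).
  have := Gamma_ge n r0; move: (Gamma _) (Gamma _) g0 gn => g G g0 G0 gG.
  rewrite invfM mulrAC.
  rewrite [_^-1 * `|y| ^+ n]mulrC [leLHS]mulrC ler_wpM2r ?mulr_ge0 ?exprn_ge0 ?invr_ge0//.
  by rewrite lef_pV2 ?posrE.
- exact: (@is_cvg_seriesZ _ (exp_coeff `|y|) _ (is_cvg_series_exp_coeff _)).
Qed.

Let pseries_diffs_bessel r : 0 <= r ->
  pseries_diffs (bessel_coef r) = - bessel_coef (r + 1).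
Proof.
move=> r0; apply/funext => m; rewrite /pseries_diffs /bessel_coef.
rewrite [RHS]/GRing.opp /= exprS mulN1r factS natrM.
rewrite (_ : m.+1%:R + r + 1 = m%:R + (r + 1) + 1); last by rewrite -natr1; lra.
have : m.+1%:R != 0 :> R by rewrite pnatr_eq0.
move: (m.+1%:R) (Gamma _) (m`!%:R) => a g f a0.
by rewrite !invfM mulNr mulrN; congr (- _); rewrite mulrCA !mulrA mulrAC mulfK// mulrAC.
Qed.

(** In these variables the identity (z^-r J_r)' = - z^-r J_(r+1) reads
    P_r' = - P_(r+1). *)
Lemma is_derive_besselP r y : 0 <= r ->
  is_derive y 1 (besselP r) (- besselP (r + 1) y).
Proof.
move=> r0; have r1 : 0 <= r + 1 by lra. have r2 : 0 <= r + 1 + 1 by lra.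
have := @pseries_snd_diffs R (bessel_coef r) (`|y| + 1) y.
rewrite !pseries_diffs_bessel// pseries_diffsN pseries_diffs_bessel// opprK => h.
have e x : pseries (- bessel_coef (r + 1)) x = - pseries (bessel_coef (r + 1)) x.
  rewrite /pseries; apply/funext => n; rewrite /series /= [RHS]/GRing.opp/= -sumrN.
  by apply: eq_bigr => i _; rewrite mulNr.
apply: (is_derive_eq (h _ _ _ _)).
- exact: is_cvg_besselP.
- by rewrite e; apply: is_cvgN; exact: is_cvg_besselP.
- exact: is_cvg_besselP.
- by rewrite [ltRHS]ger0_norm ?addr_ge0// ltrDl.
- by rewrite e limN//; exact: is_cvg_besselP.
Qed.

Let bessel_coef_rec0 r : 0 <= r ->
  bessel_coef r 0 = (r + 1) * bessel_coef (r + 1) 0.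
Proof.
move=> r0; rewrite /bessel_coef (Gamma_shift 0 r0) fact0.
have := Gamma_gt0 (ge1 0 r0); move: (Gamma _) => G G0.
have A0 : r + 1 != 0 by rewrite gt_eqF//; lra.
by rewrite expr0 add0r; field; rewrite A0 (gt_eqF G0).
Qed.

Let bessel_coef_rec r n : 0 <= r ->
  bessel_coef r n.+1 = (r + 1) * bessel_coef (r + 1) n.+1 - bessel_coef (r + 1 + 1) n.
Proof.
move=> r0; rewrite /bessel_coef (Gamma_shift n.+1 r0).
rewrite (_ : n%:R + (r + 1 + 1) + 1 = n.+1%:R + (r + 1) + 1); last by rewrite -natr1; lra.
rewrite (Gamma_shift n.+1 r0) factS natrM.
have := Gamma_gt0 (ge1 n.+1 r0); have := lt_le_trans ltr01 (ge1 n.+1 r0).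
have : 0 < n`!%:R :> R by rewrite ltr0n fact_gt0.
have : 0 < n.+1%:R :> R by rewrite ltr0n.
rewrite exprS; move: (Gamma _) (n`!%:R) => G f; rewrite -natr1 => n0 f0 A0 G0.
by field; rewrite !gt_eqF.
Qed.

Let pseries_rec (a b c : nat -> R) (k y : R) : a 0 = k * b 0 ->
  (forall n, a n.+1 = k * b n.+1 - c n) ->
  forall n, pseries a y n.+1 = k * pseries b y n.+1 - y * pseries c y n.
Proof.
move=> a0 aS; rewrite /pseries /series /=; elim=> [|n ih].
  by rewrite !big_nat1 big_geq// mulr0 subr0 !expr0 !mulr1.
rewrite big_nat_recr//= ih [in RHS]big_nat_recr//= [X in _ = _ - _ * X]big_nat_recr//=.
by rewrite aS exprS; ring.
Qed.

Let pseries_rec_lim (a b c : nat -> R) (k y : R) : a 0 = k * b 0 ->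
  (forall n, a n.+1 = k * b n.+1 - c n) ->
  cvgn (pseries a y) -> cvgn (pseries b y) -> cvgn (pseries c y) ->
  limn (pseries a y) = k * limn (pseries b y) - y * limn (pseries c y).
Proof.
move=> a0 aS ca cb cc; have E := pseries_rec y a0 aS.
have ca' : pseries a y n.+1 @[n --> \oo] --> limn (pseries a y).
  by rewrite (@cvg_shiftS _ (pseries a y)); exact: ca.
have cb' : pseries b y n.+1 @[n --> \oo] --> limn (pseries b y).
  by rewrite (@cvg_shiftS _ (pseries b y)); exact: cb.
apply: (cvg_unique _ ca') => //.
rewrite (_ : (fun n => _) = fun n => k * pseries b y n.+1 - y * pseries c y n).
  by apply: cvgB; apply: cvgMr.
by apply/funext => n; rewrite E.
Qed.

(** The three-term recurrence of the functions J_r, which together with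
    P_r' = - P_(r+1) amounts to Bessel's differential equation. *)
Lemma besselP_rec r y : 0 <= r ->
  besselP r y = (r + 1) * besselP (r + 1) y - y * besselP (r + 1 + 1) y.
Proof.
move=> r0; have r1 : 0 <= r + 1 by lra. have r2 : 0 <= r + 1 + 1 by lra.
rewrite /besselP; apply: pseries_rec_lim; [exact: bessel_coef_rec0| | exact: is_cvg_besselP..].
by move=> n; exact: bessel_coef_rec.
Qed.

Lemma besselP0_gt0 r : 0 <= r -> 0 < besselP r 0.
Proof.
move=> r0; have g0 : 0 < Gamma (r + 1) by apply: Gamma_gt0; lra.
have -> : besselP r 0 = (Gamma (r + 1))^-1; last by rewrite invr_gt0.
apply: (@cvg_lim R) => //; rewrite -cvg_shiftS /=.
have -> : (fun n : nat => pseries (bessel_coef r) 0 n.+1) = fun=> (Gamma (r + 1))^-1.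
  apply/funext => n; rewrite /pseries /series /= big_nat_recl// big1 ?addr0.
    by rewrite expr0 mulr1 /bessel_coef fact0 expr0 !mul1r add0r.
  by move=> i _; rewrite exprS mul0r mulr0.
exact: cvg_cst.
Qed.

(** The factor z ^ r separated from the power series in z ^ 2. *)
Lemma besselJE r z : 0 <= r -> 0 < z ->
  besselJ r z = (z / 2) `^ r * besselP r (z ^+ 2 / 4).
Proof.
move=> r0 z0; have z2 : 0 < z / 2 by rewrite divr_gt0.
rewrite /besselJ /besselP -[RHS]lim_seriesZ; last exact: is_cvg_besselP.
congr (limn (series _)); apply/funext => m /=.
rewrite -[LHS]/(bessel_coef r m * _) -[RHS]/(_ * (bessel_coef r m * _)) mulrCA.
congr (_ * _).
rewrite addrC powRD; last by rewrite (gt_eqF z2) implybT.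
have -> : 2 * m%:R = (2 * m)%:R :> R by rewrite natrM.
rewrite powR_mulrn ?(ltW z2)// exprM; congr (_ * _ ^+ _).
by rewrite expr_div_n -natrX.
Qed.

Lemma besselJ_besselW r z : 0 <= r -> 0 < z ->
  besselJ r z = 2 `^ (- r) * (z `^ (- (1 / 2)) * besselW r z).
Proof.
move=> r0 z0; rewrite besselJE// /besselW powRM ?invr_ge0 ?(ltW z0)//.
have -> : (2^-1 : R) `^ r = 2 `^ (- r) by rewrite -powR_inv1// -powRrM mulN1r.
have -> : z `^ r = z `^ (- (1 / 2)) * z `^ (r + 1 / 2).
  by rewrite -powRD ?(gt_eqF z0) ?implybT//; congr (_ `^ _); lra.
by ring.
Qed.

Let isd_sq4 z : is_derive z 1 (fun z : R => z ^+ 2 / 4) (z / 2).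
Proof.
have -> : (fun z : R => z ^+ 2 / 4) = fun z => z * (z * 4^-1).
  by apply/funext => u; rewrite expr2 mulrA.
apply: (is_derive_eq (isd_mul (isd_id z) (isd_mul (isd_id z) (isd_cst 4^-1 z)))); lra.
Qed.

Let isd_P r z : 0 <= r -> is_derive z 1 (fun z => besselP r (z ^+ 2 / 4))
  (- besselP (r + 1) (z ^+ 2 / 4) * (z / 2)).
Proof. by move=> r0; exact: isd_comp (is_derive_besselP _ r0) (isd_sq4 z). Qed.

Lemma is_derive_besselW r z : 0 <= r -> 0 < z ->
  is_derive z 1 (besselW r) (besselW' r z).
Proof.
move=> r0 z0.
apply: (is_derive_eq (isd_mul (is_derive1_powR (r + 1 / 2) z0) (isd_P z r0))).
rewrite /besselW' (_ : r + 1 / 2 = (r - 1 / 2) + 1); last lra.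
rewrite addrK (@powRD _ z _ 1) ?(gt_eqF z0) ?implybT// powRr1 ?(ltW z0)//.
by set p := z `^ _; set A := besselP r _; set B := besselP _ _; field.
Qed.

(** Bessel's equation in normal form, for sqrt(z) J_r(z). *)
Lemma is_derive_besselW' r z : 0 <= r -> 0 < z ->
  is_derive z 1 (besselW' r) (- (1 - (r ^+ 2 - 1 / 4) / z ^+ 2) * besselW r z).
Proof.
move=> r0 z0; have r1 : 0 <= r + 1 by lra.
have d1 := isd_scale (r + 1 / 2) (isd_P z r0).
have d2 := isd_mul (isd_scale 2 (isd_sq4 z)) (isd_P z r1).
have -> : besselW' r = fun z => z `^ (r - 1 / 2) *
  ((r + 1 / 2) * besselP r (z ^+ 2 / 4)
   - 2 * (z ^+ 2 / 4) * besselP (r + 1) (z ^+ 2 / 4)).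
  apply/funext => u; rewrite /besselW'; congr (_ * (_ - _ * _)); lra.
apply: (is_derive_eq (isd_mul (is_derive1_powR (r - 1 / 2) z0) (isd_sub d1 d2))).
rewrite /besselW; have := besselP_rec (z ^+ 2 / 4) r0.
rewrite (_ : r + 1 / 2 = (r - 1 / 2 - 1) + 1 + 1); last lra.
rewrite [in z `^ (r - 1 / 2)](_ : r - 1 / 2 = (r - 1 / 2 - 1) + 1); last lra.
rewrite !(@powRD _ z _ 1) ?(gt_eqF z0) ?implybT// !powRr1 ?(ltW z0)//.
set p := z `^ _; set A := besselP r _; set B := besselP (r + 1) _; set C := besselP _ _.
move=> ->; field; rewrite ?gt_eqF//.
Qed.

End Bessel_series.

(** * Sturm comparison for w'' = - (1 - c / z^2) w *)

Section Sturm.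
Context {R : realType}.

Definition normal_bessel (c : R) (w w' : R -> R) := forall z : R, 0 < z ->
  is_derive z (1 : R) w (w' z) /\
  is_derive z (1 : R) w' (- (1 - c / z ^+ 2) * w z).

(** Changing the sign of a solution lets the comparison arguments assume it
    positive. *)
Lemma normal_besselN c w w' : normal_bessel c w w' ->
  normal_bessel c (fun z => - w z) (fun z => - w' z).
Proof.
move=> h z z0; have [h1 h2] := h z z0; split; first exact: isd_opp.
by apply: (is_derive_eq (isd_opp h2)); rewrite mulrN.
Qed.

Section Energy.
Variables (c : R) (w w' : R -> R).
Hypothesis ode : normal_bessel c w w'.

Let E z := w z ^+ 2 + w' z ^+ 2.

Let isd_sqr (f : R -> R) (x a : R) : is_derive x (1 : R) f a ->
  is_derive x (1 : R) (fun t => f t ^+ 2) (2 * f x * a).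
Proof.
move=> h; have -> : (fun t => f t ^+ 2) = fun t => f t * f t.
  by apply/funext => t; rewrite expr2.
by apply: (is_derive_eq (isd_mul h h)); ring.
Qed.

Let dE (z : R) : 0 < z -> is_derive z (1 : R) E (2 * (c / z ^+ 2) * w z * w' z).
Proof.
move=> z0; have [h1 h2] := ode z0.
apply: (is_derive_eq (isd_add (isd_sqr h1) (isd_sqr h2))); lra.
Qed.

Let dpsi (s z : R) : 0 < z ->
  is_derive z (1 : R) (fun z => expR (s / z)) (- (s / z ^+ 2) * expR (s / z)).
Proof.
move=> z0; have z0' : z != 0 by rewrite gt_eqF.
have h : is_derive z (1 : R) (fun z : R => s / z) (- (s / z ^+ 2)).
  have hi : is_derive z (1 : R) (fun z : R => z^-1) (- z ^- 2).
    by apply: (is_derive_eq (is_deriveV z0' (is_derive_id z 1))); rewrite /GRing.scale /= mulr1.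
  by apply: (is_derive_eq (isd_scale s hi)); rewrite mulrN.
by apply: (is_derive_eq (isd_comp (is_derive_expR _) h)); rewrite mulrC.
Qed.

Let am_gm (z : R) : 0 < z -> `|2 * (c / z ^+ 2) * w z * w' z| <= `|c| / z ^+ 2 * E z.
Proof.
move=> z0; have z2 : 0 < z ^+ 2 by rewrite exprn_gt0.
rewrite (_ : 2 * (c / z ^+ 2) * w z * w' z = c / z ^+ 2 * (2 * (w z * w' z))); last by ring.
rewrite normrM [X in X * _]normrM normfV [`|z ^+ 2|]gtr0_norm//.
rewrite ler_wpM2l ?divr_ge0 ?(ltW z2)// ler_norml /E.
have := sqr_ge0 (w z + w' z); have := sqr_ge0 (w z - w' z); rewrite !expr2; nra.
Qed.

Let isd_energy (s z : R) : 0 < z -> is_derive z (1 : R) (fun z => E z * expR (s / z))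
  ((2 * (c / z ^+ 2) * w z * w' z - s / z ^+ 2 * E z) * expR (s / z)).
Proof.
by move=> z0; apply: (is_derive_eq (isd_mul (dE z0) (dpsi s z0))); ring.
Qed.

(** The derivative of E is 2 c w w' / z^2, hence at most |c| E / z^2, which is
    the derivative of - |c| / z times E. *)
Lemma energy_upper a b : 0 < a -> a <= b ->
  E b * expR (`|c| / b) <= E a * expR (`|c| / a).
Proof.
move=> a0 ab; apply: (isd_nincr (f := fun z => E z * expR (`|c| / z))
    (f' := fun z => (2 * (c / z ^+ 2) * w z * w' z - `|c| / z ^+ 2 * E z) * expR (`|c| / z)) ab).
  by move=> x /andP[ax _]; apply: isd_energy; exact: lt_le_trans ax.
move=> x /andP[ax _]; rewrite mulr_le0_ge0 ?expR_ge0//.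
have := am_gm (lt_le_trans a0 ax); rewrite ler_norml => /andP[_]; lra.
Qed.

Lemma energy_lower a b : 0 < a -> a <= b ->
  E a * expR (- `|c| / a) <= E b * expR (- `|c| / b).
Proof.
move=> a0 ab; apply: (isd_ndecr (f := fun z => E z * expR (- `|c| / z))
    (f' := fun z => (2 * (c / z ^+ 2) * w z * w' z - - `|c| / z ^+ 2 * E z) * expR (- `|c| / z)) ab).
  by move=> x /andP[ax _]; apply: isd_energy; exact: lt_le_trans ax.
move=> x /andP[ax _]; rewrite mulr_ge0 ?expR_ge0//.
have := am_gm (lt_le_trans a0 ax); rewrite ler_norml mulNr => /andP[+ _]; lra.
Qed.


Let Ege0 z : 0 <= E z.
Proof. by rewrite addr_ge0 ?sqr_ge0. Qed.

Lemma energy_gt0 a : 0 < a -> w a != 0 -> forall z, 0 < z -> 0 < w z ^+ 2 + w' z ^+ 2.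
Proof.
move=> a0 wa z z0; have Ea : 0 < E a.
  by rewrite ltr_pwDl ?sqr_ge0// lt_neqAle sqr_ge0 andbT eq_sym sqrf_eq0.
have [az|/ltW za] := leP a z.
  have := energy_lower a0 az; move/(lt_le_trans (mulr_gt0 Ea (expR_gt0 _))).
  by rewrite pmulr_lgt0 ?expR_gt0.
have := energy_upper z0 za; move/(lt_le_trans (mulr_gt0 Ea (expR_gt0 _))).
by rewrite pmulr_lgt0 ?expR_gt0.
Qed.

(** As exp (|c| / z) is bounded on [d, +oo[, the two monotone products bound
    the energy itself. *)
Lemma energy_bounds a d : 0 < a -> w a != 0 -> 0 < d ->
  exists m M, [/\ 0 < m, 0 < M &
    forall z, d <= z -> m <= w z ^+ 2 + w' z ^+ 2 <= M].
Proof.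
move=> a0 wa d0; have Ed := energy_gt0 a0 wa d0.
exists (E d * expR (- `|c| / d)), (E d * expR (`|c| / d)).
split; [by rewrite mulr_gt0 ?expR_gt0..|].
move=> z dz; have z0 := lt_le_trans d0 dz; apply/andP; split.
  apply: (le_trans (energy_lower d0 dz)); rewrite ler_piMr ?Ege0//.
  by rewrite -[leRHS]expR0 ler_expR mulNr oppr_le0 divr_ge0 ?(ltW z0).
apply: (le_trans _ (energy_upper d0 dz)); rewrite ler_peMr ?Ege0//.
by rewrite -[leLHS]expR0 ler_expR divr_ge0 ?(ltW z0).
Qed.

End Energy.

Let dsin (m a x : R) : is_derive x (1 : R) (fun z => sin (m * (z - a))) (m * cos (m * (x - a))).
Proof. by apply: (is_derive_eq (isd_comp (is_derive_sin _) (isd_affine m a x))); rewrite mulrC. Qed.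

Let dcos (m a x : R) : is_derive x (1 : R) (fun z => cos (m * (z - a))) (- m * sin (m * (x - a))).
Proof. by apply: (is_derive_eq (isd_comp (is_derive_cos _) (isd_affine m a x))); rewrite mulNr mulrC mulNr. Qed.

(** The Wronskian of w and of the comparison function sin (m (z - a)). *)
Let dwronskian (c : R) (w w' : R -> R) (m a x : R) : normal_bessel c w w' -> 0 < x ->
  is_derive x (1 : R)
    (fun z => w' z * sin (m * (z - a)) - w z * (m * cos (m * (z - a))))
    ((m ^+ 2 - (1 - c / x ^+ 2)) * (w x * sin (m * (x - a)))).
Proof.
move=> ode x0; have [h1 h2] := ode x x0.
apply: (is_derive_eq (isd_sub (isd_mul h2 (dsin m a x))
  (isd_mul h1 (isd_scale m (dcos m a x))))).
by ring.
Qed.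

(* If the arch of the sine were longer than ]a, b[, then w / sin (m (z - a))
   would be nondecreasing on ]a, b] and vanish at b. *)
Let sturm_gap_pos (c : R) (w w' : R -> R) (m a b : R) : normal_bessel c w w' ->
  0 < a -> a < b -> 0 < m -> (forall z, a <= z -> 1 - c / z ^+ 2 <= m ^+ 2) ->
  w a = 0 -> w b = 0 -> (forall z, a < z < b -> 0 < w z) -> pi <= m * (b - a).
Proof.
move=> ode a0 ab m0 hm wa wb wpos; rewrite leNgt; apply/negP => lt_pi.
pose v z := sin (m * (z - a)).
have v0 z : a < z <= b -> 0 < v z.
  move=> /andP[az zb]; apply: sin_gt0_pi; rewrite mulr_gt0 ?subr_gt0//=.
  by apply: le_lt_trans lt_pi; rewrite ler_pM2l// lerD2r.
have wge0 z : a <= z <= b -> 0 <= w z.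
  move=> /andP[az zb]; have [->|na] := eqVneq z a; first by rewrite wa.
  have [->|nb] := eqVneq z b; first by rewrite wb.
  by rewrite ltW// wpos// !lt_neqAle eq_sym na az nb zb.
pose D z := w' z * v z - w z * (m * cos (m * (z - a))).
have D0 z : a < z <= b -> 0 <= D z.
  move=> /andP[az zb]; have -> : 0 = D a by rewrite /D /v wa subrr mulr0 sin0 mulr0 mul0r subrr.
  apply: (isd_ndecr (f := D)
      (f' := fun x => (m ^+ 2 - (1 - c / x ^+ 2)) * (w x * sin (m * (x - a)))) (ltW az)) => x /andP[ax xz].
    by apply: dwronskian => //; exact: lt_le_trans ax.
  rewrite mulr_ge0 ?subr_ge0 ?hm// mulr_ge0 ?wge0 ?ax ?(le_trans xz)//.
  move: ax; rewrite le_eqVlt => /predU1P[<-|ax]; first by rewrite subrr mulr0 sin0.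
  by rewrite ltW// v0// ax (le_trans xz).
pose h := (a + b) / 2; have [ah hb] := midf_lt ab; rewrite -/h in ah hb.
suff : w h / v h <= w b / v b.
  by rewrite wb mul0r leNgt divr_gt0 ?v0 ?wpos ?ah ?(ltW hb).
apply: (isd_ndecr (f := fun z => w z / v z) (f' := fun z => D z / v z ^+ 2) (ltW hb)) => x /andP[hx xb].
  have x0 : 0 < x by apply: lt_trans a0 _; exact: lt_le_trans hx.
  have vx : v x != 0 by rewrite gt_eqF// v0// xb andbT (lt_le_trans ah).
  have dV : is_derive x (1 : R) (fun z => (v z)^-1) (- (v x) ^- 2 * (m * cos (m * (x - a)))).
    by apply: (is_derive_eq (is_deriveV vx (dsin m a x))); rewrite /GRing.scale /=.
  have [dw _] := ode x x0.
  by apply: (is_derive_eq (isd_mul dw dV)); rewrite /D; field.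
by rewrite divr_ge0 ?sqr_ge0// D0// xb andbT (lt_le_trans ah).
Qed.

Let ivt_sign (w : R -> R) (a b : R) : (forall z, a < z < b -> {for z, continuous w}) ->
  (forall z, a < z < b -> w z != 0) ->
  (forall z, a < z < b -> 0 < w z) \/ (forall z, a < z < b -> 0 < - w z).
Proof.
move=> cw w0; apply: contrapT => /not_orP[/existsNP[x /not_implyP[xab /negP]]].
rewrite -leNgt => wx /existsNP[y /not_implyP[yab /negP]]; rewrite -leNgt oppr_le0 => wy.
have ivt (u v : R) : u <= v -> a < u < b -> a < v < b -> Num.min (w u) (w v) <= 0 <= Num.max (w u) (w v) -> False.
  move=> uv /andP[au ub] /andP[av vb] s.
  have cuv : {within `[u, v], continuous w}.
    apply: continuous_in_subspaceT => z; rewrite inE/= in_itv/= => /andP[uz zv].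
    by apply: cw; rewrite (lt_le_trans au)//= (le_lt_trans zv).
  have [z] := IVT uv cuv s; rewrite in_itv/= => /andP[uz zv] wz.
  by have := w0 z; rewrite wz eqxx (lt_le_trans au uz) (le_lt_trans zv vb) => /(_ isT).
have [xy|/ltW yx] := leP x y.
  by apply: (ivt x y) => //; rewrite ge_min wx le_max wy orbT.
by apply: (ivt y x) => //; rewrite ge_min wx le_max wy orbT.
Qed.

Let ode_continuous c w w' (z : R) : normal_bessel c w w' -> 0 < z -> {for z, continuous w}.
Proof. by move=> ode z0; have [h _] := ode z z0; exact: isd_continuous h. Qed.

(** Where the frequency sqrt (1 - c / z^2) is at most m, an arch of w is at
    least as long as an arch of sin (m z). *)
Lemma sturm_gap (c : R) (w w' : R -> R) (m a b : R) : normal_bessel c w w' ->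
  0 < a -> a < b -> 0 < m -> (forall z, a <= z -> 1 - c / z ^+ 2 <= m ^+ 2) ->
  w a = 0 -> w b = 0 -> (forall z, a < z < b -> w z != 0) -> pi <= m * (b - a).
Proof.
move=> ode a0 ab m0 hm wa wb w0.
have cw z : a < z < b -> {for z, continuous w}.
  by move=> /andP[az _]; exact: ode_continuous ode (lt_trans a0 az).
have [p|n] := ivt_sign cw w0; first exact: (sturm_gap_pos ode).
by apply: (sturm_gap_pos (normal_besselN ode)); rewrite ?wa ?wb ?oppr0.
Qed.

Let sturm_zero_pos (c : R) (w w' : R -> R) (m a : R) : normal_bessel c w w' ->
  0 < a -> 0 < m -> (forall z, a <= z -> m ^+ 2 <= 1 - c / z ^+ 2) ->
  ~ (forall z, a <= z -> 0 < w z).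
Proof.
move=> ode a0 m0 hm wpos; pose b := a + pi / m.
have ab : a <= b by rewrite /b lerDl divr_ge0 ?pi_ge0// ltW.
pose D z := w' z * sin (m * (z - a)) - w z * (m * cos (m * (z - a))).
have : D b <= D a.
  apply: (isd_nincr (f := D)
    (f' := fun x => (m ^+ 2 - (1 - c / x ^+ 2)) * (w x * sin (m * (x - a)))) ab) => x /andP[ax xb].
    by apply: dwronskian => //; exact: lt_le_trans ax.
  rewrite mulr_le0_ge0 ?subr_le0 ?hm// mulr_ge0 ?(ltW (wpos _ _))//.
  apply: sin_ge0_pi; rewrite mulr_ge0 ?subr_ge0 ?(ltW m0)//=.
  by rewrite mulrC -ler_pdivlMr// lerBlDl.
have mb : m * (b - a) = pi by rewrite /b; field; rewrite gt_eqF.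
rewrite /D mb subrr mulr0 sinpi cospi sin0 cos0 !mulr0 !sub0r mulr1 !mulrN1 mulrN opprK.
have := mulr_gt0 (wpos a (lexx a)) m0; have := mulr_gt0 (wpos b ab) m0; lra.
Qed.

(** Far away the frequency is at least 1/2; a solution without sign change over
    an interval of length 2 pi would contradict the comparison with
    sin ((z - a) / 2). *)
Lemma sturm_zero (c : R) (w w' : R -> R) (A : R) : normal_bessel c w w' ->
  exists2 z, A < z & w z = 0.
Proof.
move=> ode; pose a := Num.max A 0 + 1 + 2 * `|c|.
have mA : A <= Num.max A 0 by rewrite le_max lexx.
have m0 : 0 <= Num.max A 0 by rewrite le_max lexx orbT.
have c0 := normr_ge0 c.
have a1 : 1 <= a by rewrite /a; lra.
have a0 : 0 < a by lra.
have Aa : A < a by rewrite /a; lra.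
have hm z : a <= z -> (1 / 2 : R) ^+ 2 <= 1 - c / z ^+ 2.
  move=> az; have z1 : 1 <= z by exact: le_trans az.
  have z2 : 0 < z ^+ 2 by rewrite exprn_gt0//; lra.
  have : c / z ^+ 2 <= 1 / 2.
    rewrite ler_pdivrMr//; have := ler_norm c.
    have : 2 * `|c| <= z ^+ 2; last lra.
    rewrite expr2; have : 2 * `|c| <= z by rewrite (le_trans _ az)// /a; lra.
    nra.
  rewrite !expr2; lra.
have h2 : 0 < (1 / 2 : R) by lra.
apply: contrapT => nz.
have w0 z : a <= z -> w z != 0.
  by move=> az; apply/eqP => wz; apply: nz; exists z => //; exact: lt_le_trans az.
pose b z := Num.max z a + 1.
have cw u : forall z, a < z < u -> {for z, continuous w}.
  by move=> z /andP[az _]; exact: ode_continuous ode (lt_trans a0 az).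
have a10 : 0 < a + 1 by lra.
have hm' z : a + 1 <= z -> (1 / 2 : R) ^+ 2 <= 1 - c / z ^+ 2.
  by move=> az; apply: hm; lra.
have [wp|wn] := ltP 0 (w (a + 1)).
  apply: (sturm_zero_pos ode a10 h2 hm') => z az.
  have [p|n] := @ivt_sign w a (z + 1) (cw _) (fun u hu => w0 u (ltW (andP hu).1)).
    by apply: p; apply/andP; split; lra.
  have hz : a < a + 1 < z + 1 by apply/andP; split; lra.
  have := n _ hz; lra.
apply: (sturm_zero_pos (normal_besselN ode) a10 h2 hm') => z az.
have [p|n] := @ivt_sign w a (z + 1) (cw _) (fun u hu => w0 u (ltW (andP hu).1)).
  have hz : a < a + 1 < z + 1 by apply/andP; split; lra.
  have := p _ hz; lra.
by apply: n; apply/andP; split; lra.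
Qed.

(** A solution without multiple zeros has a first zero after a, provided
    that the zeros do not accumulate at a. *)
Lemma next_zero (w : R -> R) (a e : R) (S := [set z | a < z /\ w z = 0]) :
  S !=set0 -> 0 < e -> (forall z, a < z < a + e -> w z != 0) ->
  (forall z, a < z -> {for z, continuous w}) ->
  [/\ a < inf S, w (inf S) = 0 & forall z, a < z < inf S -> w z != 0].
Proof.
move=> S0 e0 we cw.
have lbS : lbound S (a + e).
  move=> z [az wz]; rewrite leNgt; apply/negP => ze.
  by have := we z; rewrite az ze wz eqxx => /(_ isT).
have hS : has_inf S by split=> //; exists (a + e).
have aI : a < inf S by apply: (@lt_le_trans _ _ (a + e)); [rewrite ltrDl|exact: lb_le_inf].
split => //; last first.
  move=> z /andP[az zI]; apply/eqP => wz.
  have : inf S <= z by apply: ge_inf; [exact: hS.2|].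
  by rewrite leNgt zI.
apply: contrapT => /eqP wI.
have : \forall z \near inf S, w z != 0.
  exact: (cvgr_neq0 _ (cw _ aI) wI).
move=> /nbhs_ballP[d /= d0 hd].
have [z [az wz] zd] := inf_adherent d0 hS.
have := hd z; rewrite wz eqxx => /(_ _)/negP; apply => //.
rewrite /ball/= ltr_distlC; apply/andP; split => //.
rewrite (lt_le_trans _ (ge_inf hS.2 (conj az wz)))// ltrBlDr ltrDl//.
Qed.

(** Near a simple zero the function is strictly monotone. *)
Lemma isolated_zero (c : R) (w w' : R -> R) (a : R) : normal_bessel c w w' ->
  0 < a -> w a = 0 -> w' a != 0 ->
  exists2 e, 0 < e & forall z, a < z < a + e -> w z != 0.
Proof.
move=> ode a0 wa w'a.
wlog w'p : w w' ode wa w'a / 0 < w' a.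
  move=> H; move: (w'a); rewrite neq_lt => /orP[n|p]; last exact: (H w w').
  have [|||e e0 he] := H _ _ (normal_besselN ode); rewrite ?wa ?oppr0 ?oppr_eq0 ?oppr_gt0//.
  by exists e => // z hz; rewrite -oppr_eq0 he.
have cw' : {for a, continuous w'} by have [_ h] := ode a a0; exact: isd_continuous h.
have : \forall z \near a, 0 < w' z by exact: (cvgr_gt _ cw').
move=> /nbhs_ballP[d /= d0 hd]; exists d => // z /andP[az zd].
have dw x : x \in `]a, z[%R -> is_derive x 1 w (w' x).
  by rewrite in_itv/= => /andP[ax _]; have [] := ode x (lt_trans a0 ax).
have cw : {within `[a, z], continuous w}.
  apply: continuous_in_subspaceT => x; rewrite inE/= in_itv/= => /andP[ax _].
  exact: ode_continuous ode (lt_le_trans a0 ax).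
have [x] := MVT az dw cw; rewrite in_itv/= => /andP[ax xz].
rewrite wa subr0 => ->; rewrite mulf_neq0 ?subr_eq0 ?(gt_eqF az)//.
rewrite gt_eqF// hd// /ball/= ltr_distlC; apply/andP; split; lra.
Qed.

End Sturm.

(** * The positive zeros of the Bessel functions *)

Section Bessel_zeros.
Context {R : realType} (r : R) (r0 : 0 <= r).
#[local] Opaque Gamma.
Local Notation c := (r ^+ 2 - 1 / 4).
Local Notation w := (besselW r).
Local Notation w' := (besselW' r).
Local Notation j := (bessel_zero r).

Let ode : normal_bessel c w w'.
Proof.
by move=> z z0; split; [exact: is_derive_besselW|exact: is_derive_besselW'].
Qed.

Let cw (z : R) : 0 < z -> {for z, continuous w}.
Proof. by move=> z0; exact: isd_continuous (is_derive_besselW r0 z0). Qed.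

Lemma besselP_sq_continuous : continuous (fun z : R => besselP r (z ^+ 2 / 4)).
Proof.
move=> z; apply: (@continuous_comp _ _ _ (fun z : R => z ^+ 2 / 4) (besselP r)).
  by apply: cvgM; [exact: exprn_continuous|exact: cvg_cst].
exact: isd_continuous (is_derive_besselP _ r0).
Qed.

(** The leading term z^(r + 1/2) P_r 0 at the origin is positive; so the zeros
    do not accumulate at 0 and the first one exists. *)
Let w_pos_near0 : exists2 e, 0 < e & forall z, 0 < z < e -> 0 < w z.
Proof.
have h : \forall z \near (0 : R), 0 < besselP r (z ^+ 2 / 4).
  apply: (cvgr_gt _ (@besselP_sq_continuous 0)).
  by rewrite expr0n /= mul0r besselP0_gt0.
move: h => /nbhs_ballP[d /= d0 hd]; exists d => // z /andP[z0 zd].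
rewrite mulr_gt0 ?powR_gt0// hd// /ball/= sub0r normrN gtr0_norm//.
Qed.

Lemma besselJ_eq0 z : 0 < z -> besselJ r z = 0 <-> w z = 0.
Proof.
move=> z0; rewrite besselJ_besselW//; split => [/eqP|->]; last by rewrite !mulr0.
by rewrite mulf_eq0 gt_eqF ?powR_gt0//= mulf_eq0 gt_eqF ?powR_gt0//= => /eqP.
Qed.

Let w_nz : exists2 a, 0 < a & w a != 0.
Proof.
have [e e0 he] := w_pos_near0; exists (e / 2); first by rewrite divr_gt0.
by rewrite gt_eqF// he// divr_gt0//=; lra.
Qed.

(** A double zero would make the energy vanish. *)
Let w'_nz z : 0 < z -> w z = 0 -> w' z != 0.
Proof.
move=> z0 wz; have [a a0 wa] := w_nz.
have := energy_gt0 ode a0 wa z0; rewrite wz expr0n add0r => h.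
by rewrite -sqrf_eq0 gt_eqF.
Qed.

Let prev k := if k is k'.+1 then j k' else 0.

Let jE k : 0 <= prev k -> j k = inf [set z | prev k < z /\ w z = 0].
Proof.
move=> p0; have -> : j k = inf [set z | prev k < z /\ besselJ r z = 0] by case: k p0.
congr inf; apply/seteqP; split => z /= [pz h]; split => //.
  exact/(besselJ_eq0 (le_lt_trans p0 pz)).
exact/(besselJ_eq0 (le_lt_trans p0 pz)).
Qed.

(** The infima that define the zeros are attained, and the zeros are
    consecutive. *)
Let jP k : 0 <= prev k /\ [/\ prev k < j k, w (j k) = 0 &
  forall z, prev k < z < j k -> w z != 0].
Proof.
have step (a e : R) : 0 <= a -> 0 < e -> (forall z, a < z < a + e -> w z != 0) ->
    let S := [set z | a < z /\ w z = 0] in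
    [/\ a < inf S, w (inf S) = 0 & forall z, a < z < inf S -> w z != 0].
  move=> a0 e0 he; apply: (next_zero _ e0 he).
    by have [z az wz] := sturm_zero a ode; exists z.
  by move=> z az; apply: cw; exact: le_lt_trans az.
elim: k => [|k [p0 [pj wj _]]].
  split => //; rewrite jE//=; have [e e0 he] := w_pos_near0.
  by apply: (step 0 e) => // z; rewrite add0r => /he h; rewrite gt_eqF.
have j0 : 0 < j k by exact: le_lt_trans pj.
split; first exact: ltW.
have [e e0 he] := isolated_zero ode j0 wj (w'_nz j0 wj).
by rewrite jE /prev ?(ltW j0)//; apply: (step _ e) => //; exact: ltW.
Qed.

Lemma bessel_zero_gt0 k : 0 < j k.
Proof. by have [p0 [pj _ _]] := jP k; exact: le_lt_trans pj. Qed.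

Lemma besselW_zero k : w (j k) = 0.
Proof. by have [_ [_ ? _]] := jP k. Qed.

Let j_lt k : j k < j k.+1.
Proof. by have [_ [? _ _]] := jP k.+1. Qed.

Let gap (m : R) k : 0 < m -> (forall z, j k <= z -> 1 - c / z ^+ 2 <= m ^+ 2) ->
  pi <= m * (j k.+1 - j k).
Proof.
move=> m0 hm; have [_ [jj wj wn]] := jP k.+1.
exact: (sturm_gap ode (bessel_zero_gt0 k) jj m0 hm (besselW_zero k) wj wn).
Qed.

(** To the right of the first zero, 1 - c / z^2 is bounded by a constant. *)
Lemma bessel_zero_gap : exists2 g : R, 0 < g & forall k, j k + g <= j k.+1.
Proof.
have j0 := bessel_zero_gt0 0.
pose m := 1 + `|c| / j 0 ^+ 2.
have q0 : 0 <= `|c| / j 0 ^+ 2 by rewrite divr_ge0// sqr_ge0.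
have m0 : 0 < m by rewrite /m; lra.
have jk k : j 0 <= j k by elim: k => // k ih; rewrite (le_trans ih)// ltW.
exists (pi / m); first by rewrite divr_gt0// pi_gt0.
move=> k; rewrite -lerBrDl ler_pdivrMr// mulrC; apply: gap => // z jz.
have jz0 := le_trans (jk k) jz.
have h : - (c / z ^+ 2) <= `|c| / j 0 ^+ 2.
  rewrite (le_trans (ler_norm _))// normrN normrM normfV ler_wpM2l//.
  rewrite ger0_norm ?sqr_ge0// lef_pV2 ?posrE ?exprn_gt0//; last exact: lt_le_trans jz0.
  by rewrite ler_sqr ?nnegrE// ltW// (lt_le_trans j0).
have := sqr_ge0 (m - 1); rewrite /m !expr2; nra.
Qed.

Lemma bessel_zero_ge : exists2 g : R, 0 < g & forall k, k%:R * g <= j k.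
Proof.
have [g g0 hg] := bessel_zero_gap; exists g => // k.
elim: k => [|k ih]; first by rewrite mul0r ltW// bessel_zero_gt0.
by rewrite -natr1 mulrDl mul1r (le_trans _ (hg k))// lerD2r.
Qed.

(** Far away 1 - c / z^2 is at most (1 - e)^-2, and the zeros tend to
    infinity. *)
Lemma bessel_zero_gap_pi (e : R) : 0 < e -> e < 1 ->
  exists N, forall k, (N <= k)%N -> pi * (1 - e) <= j k.+1 - j k.
Proof.
move=> e0 e1; have [g g0 hg] := bessel_zero_ge.
pose m := (1 - e)^-1; have m0 : 0 < m by rewrite invr_gt0; lra.
have me : m * (1 - e) = 1 by rewrite mulVf// gt_eqF//; lra.
have m1 : 1 < m ^+ 2.
  rewrite expr2; have : 1 < m by rewrite invf_gt1; lra.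
  nra.
pose A := 1 + `|c| / (m ^+ 2 - 1).
have A1 : 1 <= A by rewrite /A lerDl divr_ge0//; lra.
exists (Num.truncn (A / g)).+1 => k Nk.
have Aj : A <= j k.
  apply: (le_trans _ (hg k)); rewrite -ler_pdivrMr// ltW//.
  by rewrite (lt_le_trans (truncnS_gt _))// ler_nat.
have h : pi <= m * (j k.+1 - j k).
  apply: gap => // z jz; have Az := le_trans Aj jz.
  have z2 : 0 < z ^+ 2 by rewrite exprn_gt0//; lra.
  have : - (c / z ^+ 2) <= m ^+ 2 - 1; last lra.
  rewrite (le_trans (ler_norm _))// normrN normrM normfV [`|z ^+ 2|]gtr0_norm//.
  rewrite ler_pdivrMr// -ler_pdivrMl; last lra.
  rewrite mulrC (@le_trans _ _ A)//; first by rewrite /A lerDr.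
  rewrite expr2; nra.
have : pi * (1 - e) <= m * (j k.+1 - j k) * (1 - e) by rewrite ler_wpM2r//; lra.
by rewrite mulrAC me mul1r.
Qed.

Let isd_besselJ k :
  is_derive (j k) 1 (besselJ r) (2 `^ (- r) * ((j k) `^ (- (1 / 2)) * w' (j k))).
Proof.
have j0 := bessel_zero_gt0 k.
have h := isd_scale (2 `^ (- r)) (isd_mul (is_derive1_powR (- (1 / 2)) j0) (is_derive_besselW r0 j0)).
have := is_derive_eq h; rewrite besselW_zero mulr0 add0r => /(_ _ erefl) {}h.
apply: (near_eq_is_derive _ h).
near=> z; rewrite besselJ_besselW//; near: z; exact: lt_nbhsr.
Unshelve. all: by end_near. Qed.

Lemma derive_besselJ_zero k : `|derive1 (besselJ r) (j k)| =
  2 `^ (- r) * (j k) `^ (- (1 / 2)) * `|w' (j k)|.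
Proof.
rewrite (isd_derive1 (isd_besselJ k)) !normrM mulrA.
by rewrite (ger0_norm (powR_ge0 2 _)) (ger0_norm (powR_ge0 (j k) _)).
Qed.

(** At a zero of w the energy reduces to w'^2. *)
Lemma besselW'_zero_bounds : exists m M, [/\ 0 < m, 0 < M &
  forall k, m <= `|w' (j k)| <= M].
Proof.
have [a a0 wa] := w_nz.
have [m [M [m0 M0 hE]]] := energy_bounds ode a0 wa (bessel_zero_gt0 0).
exists (Num.sqrt m), (Num.sqrt M); rewrite !sqrtr_gt0; split => // k.
have jk : j 0 <= j k by elim: k => // k ih; rewrite (le_trans ih)// ltW.
have := hE _ jk; rewrite besselW_zero expr0n add0r -sqrtr_sqr => /andP[h1 h2].
by rewrite !ler_wsqrtr.
Qed.

(** Bounded on [0, 1] by continuity; beyond, P_r (z^2 / 4) = w z / z^(r + 1/2)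
    and w is bounded by its energy. *)
Lemma besselP_sq_bounded : exists2 K, 0 < K &
  forall z : R, 0 <= z -> `|besselP r (z ^+ 2 / 4)| <= K.
Proof.
have [a a0 wa] := w_nz.
have [m [M [m0 M0 hE]]] := energy_bounds ode a0 wa ltr01.
have c01 : {within `[0, 1], continuous (fun z : R => besselP r (z ^+ 2 / 4))}.
  exact/continuous_subspaceT/besselP_sq_continuous.
have [u _ hu] := EVT_max ler01 c01; have [v _ hv] := EVT_min ler01 c01.
pose A := `|besselP r (u ^+ 2 / 4)| + `|besselP r (v ^+ 2 / 4)|.
have A0 : 0 <= A by rewrite addr_ge0.
exists (A + Num.sqrt M); first by rewrite ltr_wpDl// sqrtr_gt0.
move=> z z0; have [z1|/ltW z1] := leP z 1.
  have zi : z \in `[0, 1]%R by rewrite in_itv/= z0 z1.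
  rewrite (@le_trans _ _ A)//; last by rewrite lerDl sqrtr_ge0.
  rewrite ler_norml; have := hu _ zi; have := hv _ zi.
  have := ler_norm (besselP r (u ^+ 2 / 4)); have := ler_norm (- besselP r (v ^+ 2 / 4)).
  have := normr_ge0 (besselP r (u ^+ 2 / 4)); have := normr_ge0 (besselP r (v ^+ 2 / 4)).
  rewrite normrN /A => *; apply/andP; split; lra.
rewrite (@le_trans _ _ (Num.sqrt M))//; last by rewrite lerDr.
have zp : 1 <= z `^ (r + 1 / 2).
    have h : 0 <= r + 1 / 2 by rewrite addr_ge0// divr_ge0.
    by have := ler_powR z1 h; rewrite powRr0.
rewrite (@le_trans _ _ `|w z|)//.
  by rewrite /besselW normrM ler_peMl// (le_trans zp)// ler_norm.
rewrite -sqrtr_sqr ler_wsqrtr//; have /andP[_ h] := hE _ z1.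
by rewrite (le_trans _ h)// lerDl sqr_ge0.
Qed.

End Bessel_zeros.

(** * The Schur test *)

Section Schur.
Context {R : realType}.

Lemma weighted_cauchy_schwarz (N : nat) (e r : nat -> R) : (forall k, 0 <= e k) ->
  (\sum_(0 <= k < N) e k * r k) ^+ 2 <=
  (\sum_(0 <= k < N) e k) * (\sum_(0 <= k < N) e k * r k ^+ 2).
Proof.
move=> e0; elim: N => [|N]; first by rewrite !big_geq// expr0n mul0r.
rewrite !big_nat_recr//=; set X := \sum_(_ <= _ < _) _; set Y := \sum_(_ <= _ < _) _.
set Z := \sum_(_ <= _ < _) _ => ih.
have Y0 : 0 <= Y by apply: sumr_ge0 => k _.
have Z0 : 0 <= Z by apply: sumr_ge0 => k _; rewrite mulr_ge0 ?sqr_ge0.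
have h : 2 * (X * r N) <= Z + Y * r N ^+ 2.
  have [Ye|Yn] := eqVneq Y 0.
    have -> : X = 0.
      by apply/eqP; rewrite -sqrf_eq0 eq_le sqr_ge0 andbT (le_trans ih)// Ye mul0r.
    by rewrite Ye !mul0r mulr0 addr0.
  have Yp : 0 < Y by rewrite lt_neqAle eq_sym Yn.
  rewrite -(ler_pM2l Yp); have := sqr_ge0 (X - Y * r N); rewrite !expr2 in ih *; lra.
have := ler_wpM2l (e0 N) h; rewrite !expr2 in ih *; lra.
Qed.

(** The Cauchy-Schwarz inequality in each row, with the weights e n k. *)
Lemma schur_test (M : nat) (A e : nat -> nat -> R) (th : R) (r : nat -> R) :
  (forall n k, `|A n k| <= e n k) -> (forall n k, e n k = e k n) ->
  (forall n, (n < M)%N -> \sum_(0 <= k < M) e n k <= th) -> 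
  \sum_(0 <= n < M) (\sum_(0 <= k < M) A n k * r k) ^+ 2
    <= th ^+ 2 * \sum_(0 <= k < M) r k ^+ 2.
Proof.
move=> Ae es hrow.
have e0 n k : 0 <= e n k by rewrite (le_trans _ (Ae n k)).
have h n : (n < M)%N -> (\sum_(0 <= k < M) A n k * r k) ^+ 2 <=
    th * \sum_(0 <= k < M) e n k * r k ^+ 2.
  move=> nM; apply: (@le_trans _ _ ((\sum_(0 <= k < M) e n k * `|r k|) ^+ 2)).
    rewrite -[leLHS](real_normK (num_real _)) ler_sqr ?nnegrE//; last by apply: sumr_ge0 => k _; rewrite mulr_ge0.
    rewrite (le_trans (ler_norm_sum _ _ _))//; apply: ler_sum => k _.
    by rewrite normrM ler_wpM2r.
  apply: (le_trans (weighted_cauchy_schwarz _ _ (e0 n))).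
  rewrite [X in _ * X](eq_bigr (fun k => e n k * r k ^+ 2)); last first.
    by move=> k _; rewrite real_normK ?num_real.
  by apply: ler_wpM2r (hrow n nM); apply: sumr_ge0 => k _; rewrite mulr_ge0 ?sqr_ge0.
apply: (@le_trans _ _ (\sum_(0 <= n < M) th * \sum_(0 <= k < M) e n k * r k ^+ 2)).
  by rewrite big_nat [leRHS]big_nat; apply: ler_sum => n /andP[_ nM]; exact: h.
rewrite -mulr_sumr exchange_big_nat /= expr2 -mulrA.
have [->|M0] := posnP M; first by rewrite !big_geq// !mulr0.
have th0 : 0 <= th by rewrite (le_trans _ (hrow 0%N M0))// sumr_ge0.
apply: ler_wpM2l => //; rewrite mulr_sumr big_nat [leRHS]big_nat.
apply: ler_sum => k /andP[_ kM].
rewrite -mulr_suml ler_wpM2r ?sqr_ge0//; apply: le_trans (hrow k kM).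
by apply: ler_sum => n _; rewrite es.
Qed.

(** The cosine transform of the window at the frequency 2 m p, where p is the
    frequency of the window, is proportional to this number. *)
Definition ingham_kernel (m : nat) : R := (4 * m%:R ^+ 2 - 1)^-1.

(** The bound for the entry (n, k) of the Gram defect.  The frequencies x_n and
    - x_n form a well-spaced sequence indexed by the integers, in which the
    distance between x_n and - x_k is n + k + 1 steps. *)
Definition ingham_row (n k : nat) : R :=
  (if n == k then 0 else ingham_kernel `|n - k|%N) + ingham_kernel (n + k).+1.

Let tele (m : nat) : R := (2 * (2 * m%:R + 1))^-1.

Let kernelS m : ingham_kernel m.+1 = tele m - tele m.+1.
Proof.
rewrite /ingham_kernel /tele -natr1; set x := m%:R.
have x0 : 0 <= x by exact: ler0n.
by field; rewrite !gt_eqF//; nra.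
Qed.

Let sum_kernel n N : \sum_(0 <= i < N) ingham_kernel (n + i).+1 = tele n - tele (n + N).
Proof.
elim: N => [|N ih]; first by rewrite big_geq// addn0 subrr.
by rewrite big_nat_recr//= ih kernelS addnS; lra.
Qed.

Let tele_ge0 m : 0 <= tele m.
Proof. by rewrite invr_ge0 mulr_ge0// addr_ge0// mulr_ge0. Qed.

(** The sum of 1 / (4 m^2 - 1) over the nonzero integers m is 1. *)
Lemma ingham_row_sum (n M : nat) : (n < M)%N ->
  \sum_(0 <= k < M) ingham_row n k <= 1.
Proof.
move=> nM; rewrite big_split/= sum_kernel.
rewrite (big_cat_nat (n := n)) ?(ltnW nM)//= [X in _ + X + _](big_ltn nM)/= eqxx add0r.
have -> : \sum_(0 <= i < n) (if n == i then 0 else ingham_kernel `|n - i|%N) =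
    tele 0 - tele n.
  rewrite -[n in RHS]add0n -sum_kernel big_nat_rev/= big_nat [RHS]big_nat.
  apply: eq_bigr => i /andP[_ iN]; rewrite add0n ifF; last by apply/eqP => e; lia.
  by congr ingham_kernel; lia.
have -> : \sum_(n.+1 <= i < M) (if n == i then 0 else ingham_kernel `|n - i|%N) =
    tele 0 - tele (M - n.+1)%N.
  rewrite -[(M - n.+1)%N]add0n -sum_kernel -{1}[n.+1]add0n big_addn big_nat [RHS]big_nat.
  apply: eq_bigr => i /andP[_ iN]; rewrite ifF; last by apply/eqP => e; lia.
  by congr ingham_kernel; lia.
have := tele_ge0 (n + M); have := tele_ge0 (M - n.+1)%N.
have -> : tele 0 = 1 / 2 by rewrite /tele mulr0 add0r mulr1 div1r.
lra.
Qed.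

Lemma ingham_row_sym n k : ingham_row n k = ingham_row k n.
Proof. by rewrite /ingham_row eq_sym distnC addnC. Qed.

End Schur.

(** * The cosine window *)

Section Window.
Context {R : realType} (a b : R) (ab : a < b).
Local Notation leb := (@lebesgue_measure R).
Local Notation c0 := ((a + b) / 2).
Local Notation p := (pi / (b - a)).
Local Notation cosc x t := (cos (x * (t - c0))).
Local Notation sinc x t := (sin (x * (t - c0))).
Local Notation win t := (cosc p t).

Let p0 : 0 < p. Proof. by rewrite divr_gt0 ?pi_gt0 ?subr_gt0. Qed.

Lemma isd_sinc (x c t : R) : is_derive t (1 : R) (fun t => sin (x * (t - c))) (x * cos (x * (t - c))).
Proof. by apply: (is_derive_eq (isd_comp (is_derive_sin _) (isd_affine x c t))); rewrite mulrC. Qed.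

Lemma isd_cosc (x c t : R) : is_derive t (1 : R) (fun t => cos (x * (t - c))) (- (x * sin (x * (t - c)))).
Proof. by apply: (is_derive_eq (isd_comp (is_derive_cos _) (isd_affine x c t))); rewrite mulNr mulrC. Qed.

Lemma continuous_cosc (x c : R) : continuous (fun t => cos (x * (t - c))).
Proof. by move=> t; exact: isd_continuous (isd_cosc x c t). Qed.

Lemma continuous_sinc (x c : R) : continuous (fun t => sin (x * (t - c))).
Proof. by move=> t; exact: isd_continuous (isd_sinc x c t). Qed.

Let cos_prod (u v : R) : cos u * cos v = (cos (u - v) + cos (u + v)) / 2.
Proof. rewrite cosB cosD; lra. Qed.

Let sin_prod (u v : R) : sin u * sin v = (cos (u - v) - cos (u + v)) / 2.
Proof. rewrite cosB cosD; lra. Qed.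

Let sin_cos_prod (u v : R) : sin u * cos v = (sin (u + v) + sin (u - v)) / 2.
Proof. rewrite sinB sinD; lra. Qed.

Lemma Rintegral_cosc (x : R) : x != 0 -> \int[leb]_(t in `[a, b]) cosc x t = 2 * sin (x * ((b - a) / 2)) / x.
Proof.
move=> x0.
have dF t : is_derive t (1 : R) (fun t => x^-1 * sinc x t) (cosc x t).
  by apply: (is_derive_eq (isd_scale x^-1 (isd_sinc x c0 t))); rewrite mulKf.
rewrite (Rintegral_antiderivative (ltW ab) dF (@continuous_cosc _ _)).
have -> : b - c0 = (b - a) / 2 by lra.
have -> : a - c0 = - ((b - a) / 2) by lra.
by rewrite mulrN sinN; field.
Qed.

Lemma Rintegral_sinc (x : R) : \int[leb]_(t in `[a, b]) sinc x t = 0.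
Proof.
have [->|x0] := eqVneq x 0.
  by under eq_Rintegral do rewrite mul0r sin0; rewrite Rintegral_itv_cst ?mul0r// ltW.
have dF t : is_derive t (1 : R) (fun t => - x^-1 * cosc x t) (sinc x t).
  by apply: (is_derive_eq (isd_scale (- x^-1) (isd_cosc x c0 t))); rewrite mulrN mulNr opprK mulKf.
rewrite (Rintegral_antiderivative (ltW ab) dF (@continuous_sinc _ _)).
have -> : b - c0 = (b - a) / 2 by lra.
have -> : a - c0 = - ((b - a) / 2) by lra.
by rewrite mulrN cosN subrr.
Qed.

Let contM (f g : R -> R) : continuous f -> continuous g -> continuous (fun t => f t * g t).
Proof. by move=> cf cg t; apply: cvgM; [exact: cf|exact: cg]. Qed.

Let ic x := integ_continuous a b (@continuous_cosc x c0).
Let isn x := integ_continuous a b (@continuous_sinc x c0).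

Definition win_transform (x : R) := \int[leb]_(t in `[a, b]) (win t * cosc x t).

Let win_transformE x : x != p -> x != - p ->
  win_transform x = 2 * p * cos (x * ((b - a) / 2)) / (p ^+ 2 - x ^+ 2).
Proof.
move=> xp xNp; have h1 : p - x != 0 by rewrite subr_eq0 eq_sym.
have h2 : p + x != 0 by rewrite addrC -[p]opprK subr_eq0.
rewrite /win_transform.
rewrite (Rintegral_lincomb (c := 2^-1) (d := 2^-1) _ (ic (p - x)) (ic (p + x)))//; last first.
  by move=> t; rewrite cos_prod -mulrBl -mulrDl; lra.
rewrite !Rintegral_cosc//.
have e : p * ((b - a) / 2) = pi / 2 by field; rewrite gt_eqF// subr_gt0.
rewrite [(p - x) * _]mulrBl [(p + x) * _]mulrDl e sinB sinD sin_pihalf cos_pihalf.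
move: (cos _) (sin _) (p) h1 h2 => C S q h1 h2.
by rewrite subr_sqr; field; rewrite h1 h2.
Qed.

Lemma win_transform0 : win_transform 0 = 2 / p.
Proof.
have pn : p != 0 by rewrite gt_eqF.
rewrite win_transformE; [|by rewrite eq_sym|by rewrite eq_sym oppr_eq0].
by rewrite mul0r cos0 expr0n /= subr0 mulr1; move: (p) pn => q qn; field.
Qed.

(** The closed form of the transform is 2 p cos (x (b - a) / 2) / (p^2 - x^2). *)
Lemma win_transform_bound x : p < `|x| ->
  `|win_transform x| <= 2 * p / (x ^+ 2 - p ^+ 2).
Proof.
move=> px; have px2 : p ^+ 2 < x ^+ 2.
  by rewrite -[x ^+ 2](real_normK (num_real _)) ltr_sqr ?nnegrE ?(ltW p0)// normr_ge0.
rewrite win_transformE; last 2 first.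
- by apply: contraTneq px => ->; rewrite gtr0_norm// ltxx.
- by apply: contraTneq px => ->; rewrite normrN gtr0_norm// ltxx.
rewrite normrM normfV -[p ^+ 2 - _]opprB normrN [`|x ^+ 2 - _|]gtr0_norm ?subr_gt0//.
rewrite ler_wpM2r ?invr_ge0 ?subr_ge0 ?(ltW px2)// normrM.
have p2 : 0 < 2 * p by rewrite pmulr_rgt0.
by rewrite gtr0_norm// ler_piMr ?(ltW p2)// ler_norml cos_geN1 cos_le1.
Qed.

Let iwc x := integ_continuous a b
  (contM (@continuous_cosc p c0) (@continuous_cosc x c0)).

(** Product formulas reduce the Gram matrix to values of the transform; the
    mixed entries vanish because the window is even about the centre. *)
Lemma win_cos_cos x y : \int[leb]_(t in `[a, b]) (win t * (cosc x t * cosc y t)) =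
  (win_transform (x - y) + win_transform (x + y)) / 2.
Proof.
rewrite (Rintegral_lincomb (c := 2^-1) (d := 2^-1) _ (iwc (x - y)) (iwc (x + y)))//.
  by rewrite /win_transform; lra.
by move=> t; rewrite cos_prod -mulrBl -mulrDl; lra.
Qed.

Lemma win_sin_sin x y : \int[leb]_(t in `[a, b]) (win t * (sinc x t * sinc y t)) =
  (win_transform (x - y) - win_transform (x + y)) / 2.
Proof.
rewrite (Rintegral_lincomb (c := 2^-1) (d := - 2^-1) _ (iwc (x - y)) (iwc (x + y)))//.
  by rewrite /win_transform; lra.
by move=> t; rewrite sin_prod -mulrBl -mulrDl; lra.
Qed.

Let win_sin x : \int[leb]_(t in `[a, b]) (win t * sinc x t) = 0.
Proof.
rewrite (Rintegral_lincomb (c := 2^-1) (d := 2^-1) _ (isn (x + p)) (isn (x - p)))//.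
  by rewrite !Rintegral_sinc !mulr0 addr0.
by move=> t; rewrite mulrC sin_cos_prod -mulrBl -mulrDl; lra.
Qed.

Lemma win_sin_cos x y : \int[leb]_(t in `[a, b]) (win t * (sinc x t * cosc y t)) = 0.
Proof.
have i z : leb.-integrable `[a, b] (EFin \o (fun t => win t * sinc z t)).
  by apply: integ_continuous; apply: contM; [exact: continuous_cosc|exact: continuous_sinc].
rewrite (Rintegral_lincomb (c := 2^-1) (d := 2^-1) _ (i (x + y)) (i (x - y)))//.
  by rewrite !win_sin !mulr0 addr0.
by move=> t; rewrite sin_cos_prod -mulrBl -mulrDl; lra.
Qed.

Lemma win_ge0 t : a <= t <= b -> 0 <= win t <= 1.
Proof.
move=> /andP[at_ tb]; rewrite cos_le1 andbT; apply: cos_ge0_pihalf.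
have e : p * ((b - a) / 2) = pi / 2 by field; rewrite gt_eqF// subr_gt0.
rewrite -e -mulrN !ler_pM2l//; apply/andP; split; lra.
Qed.

(** On the middle half of [a, b] the weighted integral controls the unweighted
    one. *)
Lemma win_middle t : `|t - c0| <= (b - a) / 4 -> cos (pi / 4) <= win t.
Proof.
move=> h; rewrite -[leRHS]cos_norm.
have e : p * ((b - a) / 4) = pi / 4 by field; rewrite gt_eqF// subr_gt0.
have h' : `|p * (t - c0)| <= pi / 4 by rewrite normrM gtr0_norm// -e ler_pM2l.
have pi0 := @pi_gt0 R.
rewrite leNgt; apply/negP; rewrite ltr_cos ?in_itv/= ?normr_ge0 ?(le_trans h')//; lra.
Qed.

End Window.

(** * The Gram matrix of a well-spaced family *)

Section Gram.
Context {R : realType} (a b : R) (ab : a < b).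
Local Notation leb := (@lebesgue_measure R).
Local Notation c0 := ((a + b) / 2).
Local Notation p := (pi / (b - a)).
Local Notation cosc x t := (cos (x * (t - c0))).
Local Notation sinc x t := (sin (x * (t - c0))).
Local Notation win t := (cosc p t).
Local Notation K := (win_transform a b).

(** The condition on the first term is the gap condition between x_0 and - x_0,
    since the cosines and sines involve both. *)
Definition well_spaced (g : R) (x : nat -> R) :=
  g / 2 <= x 0%N /\ forall k, x k + g <= x k.+1.

Variables (s g : R) (x : nat -> R).
Hypotheses (s1 : 1 <= s) (hg : 2 * p * s <= g) (hx : well_spaced g x).

Let p0 : 0 < p. Proof. by rewrite divr_gt0 ?pi_gt0 ?subr_gt0. Qed.

Let ps0 : 0 < 2 * p * s.
Proof. by rewrite mulr_gt0 ?(lt_le_trans ltr01 s1)// pmulr_rgt0. Qed.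

Let g0 : 0 < g. Proof. exact: lt_le_trans hg. Qed.

Let x_ge k : g * (k%:R + 1 / 2) <= x k.
Proof.
elim: k => [|k ih]; first by have := hx.1; lra.
by have := hx.2 k; rewrite -natr1; lra.
Qed.

Let x_sub n i : g * i%:R <= x (n + i)%N - x n.
Proof.
elim: i => [|i ih]; first by rewrite addn0 subrr mulr0.
by have := hx.2 (n + i)%N; rewrite addnS -natr1; lra.
Qed.

Let K_small (y : R) (m : nat) : (0 < m)%N -> g * m%:R <= `|y| ->
  `|p / 2 * K y| <= s ^- 2 * ingham_kernel m.
Proof.
move=> m0 hy; have m1 : 1 <= m%:R :> R by rewrite ler1n.
have s0 : 0 < s by exact: lt_le_trans s1.
have hy' : 2 * p * s * m%:R <= `|y| by rewrite (le_trans _ hy)// ler_wpM2r// ler0n.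
have py : p < `|y|.
  apply: lt_le_trans hy'; move: (p) p0 => q q0.
  have h : 1 <= s * m%:R by rewrite mulr_ege1.
  by rewrite -!mulrA mulrCA ltr_pMr//; lra.
have y2 : 4 * p ^+ 2 * s ^+ 2 * m%:R ^+ 2 <= y ^+ 2.
  rewrite -[y ^+ 2](real_normK (num_real _)).
  rewrite (_ : 4 * p ^+ 2 * s ^+ 2 * m%:R ^+ 2 = (2 * p * s * m%:R) ^+ 2); last by ring.
  by rewrite ler_sqr ?nnegrE ?normr_ge0// mulr_ge0// ltW.
have := win_transform_bound ab py.
move: (p) p0 py y2 => q q0 qy y2 h.
have hk : 0 < 4 * m%:R ^+ 2 - 1 :> R by have := exprn_ege1 2 m1; lra.
have q2 : 0 < q ^+ 2 by rewrite exprn_gt0.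
have s2 : 1 <= s ^+ 2 by exact: exprn_ege1.
have le1 : q ^+ 2 * s ^+ 2 * (4 * m%:R ^+ 2 - 1) <= y ^+ 2 - q ^+ 2.
  have : q ^+ 2 <= q ^+ 2 * s ^+ 2 by rewrite ler_peMr// ltW.
  lra.
have pos1 : 0 < q ^+ 2 * s ^+ 2 * (4 * m%:R ^+ 2 - 1).
  by rewrite mulr_gt0// mulr_gt0// exprn_gt0.
have pos2 : 0 < y ^+ 2 - q ^+ 2 by exact: lt_le_trans le1.
rewrite normrM gtr0_norm ?divr_gt0//.
apply: (@le_trans _ _ (q / 2 * (2 * q / (y ^+ 2 - q ^+ 2)))).
  by apply: ler_wpM2l h; rewrite divr_ge0// ltW.
have -> : q / 2 * (2 * q / (y ^+ 2 - q ^+ 2)) = q ^+ 2 / (y ^+ 2 - q ^+ 2).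
  by field; rewrite gt_eqF.
have -> : s ^- 2 * ingham_kernel m = q ^+ 2 / (q ^+ 2 * s ^+ 2 * (4 * m%:R ^+ 2 - 1)).
  by rewrite /ingham_kernel; field; rewrite !gt_eqF.
by rewrite ler_wpM2l ?(ltW q2)// lef_pV2.
Qed.

Let defect (sgn : R) n k : R := p * ((K (x n - x k) + sgn * K (x n + x k)) / 2) - (n == k)%:R.

Let defect_bound sgn n k : `|sgn| = 1 -> `|defect sgn n k| <= s ^- 2 * ingham_row n k.
Proof.
move=> hs; have h2 : `|p / 2 * K (x n + x k)| <= s ^- 2 * ingham_kernel (n + k).+1.
  apply: K_small => //; rewrite ger0_norm.
    have e : (n + k).+1%:R = n%:R + k%:R + 1 :> R by rewrite -natr1 natrD.
    by have := x_ge n; have := x_ge k; rewrite e; lra.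
  by rewrite addr_ge0//; [move: (x_ge n)|move: (x_ge k)]; apply: le_trans;
    rewrite mulr_ge0 ?(ltW g0)// addr_ge0.
rewrite /defect /ingham_row; have [nk|nk] := eqVneq n k.
  rewrite nk in h2 *; rewrite subrr win_transform0// add0r.
  have -> : p * ((2 / p + sgn * K (x k + x k)) / 2) - 1 = sgn * (p / 2 * K (x k + x k)).
    by move: (K _) (p) (gt_eqF p0) => L q qn; field; rewrite qn.
  by rewrite normrM hs mul1r.
have h1 : `|p / 2 * K (x n - x k)| <= s ^- 2 * ingham_kernel `|n - k|%N.
  apply: K_small; first by move/eqP: nk => nk; lia.
  have [nk'|kn] := leqP n k.
    have e : (n + (k - n))%N = k by lia.
    rewrite distrC ger0_norm; last first.
      by rewrite -e (le_trans _ (x_sub n (k - n)))// mulr_ge0 ?(ltW g0).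
    by rewrite -{2}e (le_trans _ (x_sub n (k - n)))// ler_wpM2l ?(ltW g0)// ler_nat; lia.
  have e : (k + (n - k))%N = n by lia.
  rewrite ger0_norm; last first.
    by rewrite -e (le_trans _ (x_sub k (n - k)))// mulr_ge0 ?(ltW g0).
  by rewrite -{2}e (le_trans _ (x_sub k (n - k)))// ler_wpM2l ?(ltW g0)// ler_nat; lia.
rewrite subr0 mulrDr.
have -> : p * ((K (x n - x k) + sgn * K (x n + x k)) / 2) =
   p / 2 * K (x n - x k) + sgn * (p / 2 * K (x n + x k)) by lra.
by rewrite (le_trans (ler_normD _ _))// lerD// normrM hs mul1r.
Qed.

Section Sum.
Variables (M : nat) (u v : nat -> R).

Definition trig_sum (t : R) :=
  \sum_(0 <= k < M) (u k * cosc (x k) t + v k * sinc (x k) t).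

Let energy := \sum_(0 <= k < M) (u k ^+ 2 + v k ^+ 2).

Let contM (f h : R -> R) : continuous f -> continuous h -> continuous (fun t => f t * h t).
Proof. by move=> cf ch t; apply: cvgM; [exact: cf|exact: ch]. Qed.

Let cwc y z : continuous (fun t => win t * (cosc y t * cosc z t)).
Proof. by apply: contM; [|apply: contM]; exact: continuous_cosc. Qed.

Let cwsc y z : continuous (fun t => win t * (sinc y t * cosc z t)).
Proof. by apply: contM; [|apply: contM]; [exact: continuous_cosc|exact: continuous_sinc|exact: continuous_cosc]. Qed.

Let cws y z : continuous (fun t => win t * (sinc y t * sinc z t)).
Proof. by apply: contM; [|apply: contM]; [exact: continuous_cosc|exact: continuous_sinc..]. Qed.

Let int_cos n : \int[leb]_(t in `[a, b]) (win t * trig_sum t * cosc (x n) t) =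
  \sum_(0 <= k < M) u k * ((K (x n - x k) + 1 * K (x n + x k)) / 2).
Proof.
transitivity (\int[leb]_(t in `[a, b]) (\sum_(0 <= k < M)
   (u k * (win t * (cosc (x n) t * cosc (x k) t))
    + v k * (win t * (sinc (x k) t * cosc (x n) t))))).
  apply: eq_Rintegral => t _; rewrite /trig_sum mulr_sumr mulr_suml.
  by apply: eq_bigr => k _; ring.
rewrite Rintegral_sum//; last first.
  by move=> k; apply: integ_add => //; apply: integ_scale => //; exact: integ_continuous.
apply: eq_bigr => k _.
rewrite (Rintegral_lincomb (c := u k) (d := v k) _ (integ_continuous a b (@cwc (x n) (x k)))
  (integ_continuous a b (@cwsc (x k) (x n))))//.
by rewrite win_cos_cos// win_sin_cos// mulr0 addr0 mul1r.
Qed.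

Let int_sin n : \int[leb]_(t in `[a, b]) (win t * trig_sum t * sinc (x n) t) =
  \sum_(0 <= k < M) v k * ((K (x n - x k) + (-1) * K (x n + x k)) / 2).
Proof.
transitivity (\int[leb]_(t in `[a, b]) (\sum_(0 <= k < M)
   (v k * (win t * (sinc (x n) t * sinc (x k) t))
    + u k * (win t * (sinc (x n) t * cosc (x k) t))))).
  apply: eq_Rintegral => t _; rewrite /trig_sum mulr_sumr mulr_suml.
  by apply: eq_bigr => k _; ring.
rewrite Rintegral_sum//; last first.
  by move=> k; apply: integ_add => //; apply: integ_scale => //; exact: integ_continuous.
apply: eq_bigr => k _.
rewrite (Rintegral_lincomb (c := v k) (d := u k) _ (integ_continuous a b (@cws (x n) (x k)))
  (integ_continuous a b (@cwsc (x n) (x k))))//.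
by rewrite win_sin_sin// win_sin_cos// mulr0 addr0 mulN1r.
Qed.

Let schur_defect sgn (r : nat -> R) : `|sgn| = 1 ->
  \sum_(0 <= n < M) (\sum_(0 <= k < M) defect sgn n k * r k) ^+ 2
    <= (s ^- 2) ^+ 2 * \sum_(0 <= k < M) r k ^+ 2.
Proof.
move=> hs; apply: (@schur_test _ _ _ (fun n k => s ^- 2 * ingham_row n k)).
- by move=> n k; exact: defect_bound.
- by move=> n k; rewrite ingham_row_sym.
- move=> n nM; rewrite -mulr_sumr ler_piMr ?ingham_row_sum//.
  by rewrite invr_ge0 sqr_ge0.
Qed.

Let defect_sum sgn (r : nat -> R) n : (n < M)%N ->
  p * (\sum_(0 <= k < M) r k * ((K (x n - x k) + sgn * K (x n + x k)) / 2)) - r n =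
  \sum_(0 <= k < M) defect sgn n k * r k.
Proof.
move=> nM; rewrite /defect; under [RHS]eq_bigr do rewrite mulrBl.
rewrite sumrB mulr_sumr; congr (_ - _).
  by apply: eq_bigr => k _; ring.
rewrite (bigD1_seq n) ?mem_index_iota ?iota_uniq//= eqxx mul1r big1 ?addr0//.
by move=> k kn; rewrite eq_sym (negbTE kn) mul0r.
Qed.

(** The Gram matrix of the windowed family, multiplied by p, differs from
    the identity by a matrix of norm at most 1 / s^2. *)
Lemma gram_defect :
  \sum_(0 <= n < M)
    ((p * (\int[leb]_(t in `[a, b]) (win t * trig_sum t * cosc (x n) t)) - u n) ^+ 2
     + (p * (\int[leb]_(t in `[a, b]) (win t * trig_sum t * sinc (x n) t)) - v n) ^+ 2)
  <= (s ^- 2) ^+ 2 * energy.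
Proof.
rewrite /energy !big_split/= mulrDr lerD//.
  rewrite (le_trans _ (schur_defect u (normr1 _)))//.
  rewrite big_nat [leRHS]big_nat; apply: ler_sum => n /andP[_ nM].
  by rewrite int_cos defect_sum.
rewrite (le_trans _ (schur_defect v (etrans (normrN _) (normr1 _))))//.
rewrite big_nat [leRHS]big_nat; apply: ler_sum => n /andP[_ nM].
by rewrite int_sin defect_sum.
Qed.

Lemma continuous_trig_sum : continuous trig_sum.
Proof.
apply: continuous_sumn => k t; apply: cvgD; apply: cvgMr.
  exact: continuous_cosc.
exact: continuous_sinc.
Qed.

(** The Gram matrix is at distance at most 1 from the identity, up to the
    factor p, so its norm is at most 2. *)
Lemma gram_upper :
  \int[leb]_(t in `[a, b]) (win t * trig_sum t ^+ 2) <= 2 / p * energy.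
Proof.
pose C n := \int[leb]_(t in `[a, b]) (win t * trig_sum t * cosc (x n) t).
pose S n := \int[leb]_(t in `[a, b]) (win t * trig_sum t * sinc (x n) t).
have cw : continuous (fun t => win t * trig_sum t).
  by apply: contM; [exact: continuous_cosc|exact: continuous_trig_sum].
have -> : \int[leb]_(t in `[a, b]) (win t * trig_sum t ^+ 2) =
    \sum_(0 <= n < M) (u n * C n + v n * S n).
  transitivity (\int[leb]_(t in `[a, b]) (\sum_(0 <= n < M)
     (u n * (win t * trig_sum t * cosc (x n) t) + v n * (win t * trig_sum t * sinc (x n) t)))).
    apply: eq_Rintegral => t _; rewrite expr2 {2}/trig_sum mulrA mulr_sumr.
    by apply: eq_bigr => k _; ring.
  have ic n := integ_continuous a b (contM cw (@continuous_cosc _ (x n) c0)).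
  have is_ n := integ_continuous a b (contM cw (@continuous_sinc _ (x n) c0)).
  rewrite Rintegral_sum//; last first.
    by move=> k; apply: integ_add => //; apply: integ_scale.
  by apply: eq_bigr => n _; rewrite (Rintegral_lincomb (c := u n) (d := v n) _ (ic n) (is_ n)).
have E0 : 0 <= energy by apply: sumr_ge0 => k _; rewrite addr_ge0 ?sqr_ge0.
have := gram_defect; rewrite -/energy -/(C _) => hd.
have {}hd : \sum_(0 <= n < M) ((p * C n - u n) ^+ 2 + (p * S n - v n) ^+ 2) <= energy.
  apply: (le_trans hd); rewrite ler_piMl// exprn_ile1 ?invr_ge0 ?sqr_ge0//.
  by rewrite invf_le1 ?exprn_ege1// exprn_gt0// (lt_le_trans _ s1).
have h n : p * (u n * C n + v n * S n) <= 3 / 2 * (u n ^+ 2 + v n ^+ 2)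
   + 1 / 2 * ((p * C n - u n) ^+ 2 + (p * S n - v n) ^+ 2).
  have := sqr_ge0 (p * C n - u n - u n); have := sqr_ge0 (p * S n - v n - v n).
  by move: (p) (C n) (S n) => q c d; rewrite !expr2; lra.
rewrite -(ler_pM2l p0) mulr_sumr.
have -> : p * (2 / p * energy) = 3 / 2 * energy + 1 / 2 * energy.
  by move: (p) (gt_eqF p0) => q qn; field; rewrite qn.
apply: (@le_trans _ _ (\sum_(0 <= n < M) (3 / 2 * (u n ^+ 2 + v n ^+ 2)
   + 1 / 2 * ((p * C n - u n) ^+ 2 + (p * S n - v n) ^+ 2)))).
  by apply: ler_sum => n _.
by rewrite big_split/= -!mulr_sumr lerD2l ler_wpM2l.
Qed.

End Sum.
End Gram.

(** * A Riesz-Fischer theorem *)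

Section Riesz_Fischer.
Context {R : realType}.
Local Notation leb := (@lebesgue_measure R).
Local Notation integ D f := (leb.-integrable D (EFin \o f)).

Lemma continuous_bounded_itv (a b : R) (f : R -> R) : a < b -> continuous f ->
  exists2 C, 0 <= C & forall t, `[a, b]%classic t -> `|f t| <= C.
Proof.
move=> ab cf; have cn : {within `[a, b], continuous (fun t => `|f t|)}.
  apply: continuous_subspaceT => t; apply: (@continuous_comp _ _ _ f Num.norm).
    exact: cf.
  exact: norm_continuous.
have [c _ hc] := EVT_max (ltW ab) cn.
exists `|f c| => // t tab; exact: hc.
Qed.

Lemma nneseries_le_bound (u : nat -> R) (M : R) : (forall k, 0 <= u k) ->
  (forall N, \sum_(0 <= k < N) u k <= M) -> (\sum_(0 <= k <oo) (u k)%:E <= M%:E)%E.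
Proof.
move=> u0 uM; apply: lime_le.
  by apply: is_cvg_nneseries => n _ _; rewrite lee_fin.
by apply: nearW => n; rewrite sumEFin lee_fin.
Qed.

Lemma nneseries_bound (u : nat -> R) : (forall k, 0 <= u k) ->
  (\sum_(0 <= k <oo) (u k)%:E < +oo)%E ->
  exists2 M, 0 <= M & forall N, \sum_(0 <= k < N) u k <= M.
Proof.
move=> u0 us; pose S := (\sum_(0 <= k <oo) (u k)%:E)%E.
have S0 : (0 <= S)%E by apply: nneseries_ge0 => k _ _; rewrite lee_fin.
exists (fine S); first exact: fine_ge0.
move=> N; rewrite -lee_fin fineK ?ge0_fin_numE// -sumEFin.
by apply: nneseries_lim_ge => k _ _; rewrite lee_fin.
Qed.

Lemma sum_geometric_le (q : R) N : 0 <= q -> q < 1 ->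
  \sum_(0 <= k < N) q ^+ k <= (1 - q)^-1.
Proof.
move=> q0 q1; have e : (1 - q) * \sum_(0 <= k < N) q ^+ k = 1 - q ^+ N.
  elim: N => [|N ih]; first by rewrite big_geq// mulr0 expr0 subrr.
  by rewrite big_nat_recr//= mulrDr ih exprS; ring.
rewrite -[leLHS](mulKf (_ : 1 - q != 0)) ?e; last by rewrite subr_eq0 eq_sym lt_eqF.
by rewrite ler_piMr ?invr_ge0 ?subr_ge0 ?(ltW q1)// lerBlDr lerDl exprn_ge0.
Qed.

Definition square_integrable (a b : R) (f : R -> R) :=
  measurable_fun `[a, b] f /\ integ `[a, b] (fun t => f t ^+ 2).

(* [g j] has square norm O(q^j).  With rho = sqrt q the function
   H = \sum_j g_j^2 / rho^j is integrable, hence finite almost everywhere, and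
   by the Cauchy-Schwarz inequality it dominates the squares of the partial
   sums. *)
Section Series.
Variables (a b : R) (ab : a < b) (g : nat -> R -> R) (A q : R).
Hypotheses (q0 : 0 < q) (q1 : q < 1) (cg : forall j, continuous (g j)).
Hypothesis hg : forall j, \int[leb]_(t in `[a, b]) (g j t ^+ 2) <= A * q ^+ j.

Let rho := Num.sqrt q.
Let rho0 : 0 < rho. Proof. by rewrite sqrtr_gt0. Qed.
Let rho1 : rho < 1. Proof. by rewrite -sqrtr1 ltr_sqrt. Qed.
Let rho2 : rho ^+ 2 = q. Proof. by rewrite sqr_sqrtr// ltW. Qed.
Let L := (1 - rho)^-1.
Let L0 : 0 < L. Proof. by rewrite invr_gt0 subr_gt0. Qed.

Let w j t : R := rho ^+ j * (g j t / rho ^+ j) ^+ 2.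
Let w0 j t : 0 <= w j t. Proof. by rewrite mulr_ge0 ?sqr_ge0// exprn_ge0// ltW. Qed.

Let wE j t : w j t = rho ^- j * g j t ^+ 2.
Proof. by rewrite /w; field; rewrite gt_eqF// exprn_gt0. Qed.

Let mD : measurable (`[a, b]%classic : set (measurableTypeR R)).
Proof. exact: measurable_itv. Qed.

Let cg2 j : continuous (fun t => g j t ^+ 2).
Proof. by move=> t; apply: (@continuous_comp _ _ _ (g j) (fun x : R => x ^+ 2)); [exact: cg|exact: exprn_continuous]. Qed.

Let iw j : integ `[a, b] (w j).
Proof.
rewrite (_ : w j = fun t => rho ^- j * g j t ^+ 2); last by apply/funext => t; rewrite wE.
by apply: integ_scale => //; exact: integ_continuous.
Qed.

Let H (t : R) : \bar R := (\sum_(0 <= j <oo) (w j t)%:E)%E.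
Let H0 t : (0 <= H t)%E. Proof. by apply: nneseries_ge0 => k _ _; rewrite lee_fin. Qed.

Let intw j : \int[leb]_(t in `[a, b]) w j t <= A * rho ^+ j.
Proof.
rewrite (_ : w j = fun t => rho ^- j * g j t ^+ 2); last by apply/funext => t; rewrite wE.
rewrite RintegralZl//; last exact: integ_continuous.
rewrite mulrC ler_pdivrMr ?exprn_gt0// -mulrA -expr2 -exprM mulnC exprM rho2.
exact: hg.
Qed.

Let A0 : 0 <= A.
Proof.
have := hg 0%N; rewrite expr0 mulr1; apply: le_trans.
by apply: Rintegral_ge0 => t _; exact: sqr_ge0.
Qed.

Let mH : measurable_fun `[a, b] H.
Proof.
apply: ge0_emeasurable_sum => [k t _ _|k _]; first by rewrite lee_fin.
exact: (measurable_int leb (iw k)).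
Qed.

Let iH : leb.-integrable `[a, b] H.
Proof.
apply/integrableP; split => //.
under eq_integral do rewrite gee0_abs//.
rewrite /H integral_nneseries//; last by move=> j t _; rewrite lee_fin.
  have e j : (\int[leb]_(t in `[a, b]) (w j t)%:E = (\int[leb]_(t in `[a, b]) w j t)%:E)%E.
    by rewrite /Rintegral fineK//; exact: integrable_fin_num (iw j).
  under eq_eseriesr do rewrite e.
  apply: (@le_lt_trans _ _ (A * L)%:E); last exact: ltry.
  apply: nneseries_le_bound => [k|N]; first by apply: Rintegral_ge0 => t _.
  apply: (@le_trans _ _ (\sum_(0 <= j < N) A * rho ^+ j)).
    by apply: ler_sum => j _; exact: intw.
  by rewrite -mulr_sumr ler_wpM2l// sum_geometric_le// ltW.
by move=> j; exact: (measurable_int leb (iw j)).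
Qed.

Let S J t : R := \sum_(0 <= j < J) g j t.

Let f t : R := fine (limn_esup (fun J => (S J t)%:E)).

Let mS J : measurable_fun `[a, b] (S J).
Proof.
apply: measurable_sum => j; apply: measurable_funTS.
exact: continuous_measurable_fun.
Qed.

Let mf : measurable_fun `[a, b] f.
Proof.
apply: measurableT_comp; first exact: fine_measurable.
by apply: measurable_fun_limn_esup => J; exact/measurable_EFinP.
Qed.

Let S_bound J t : H t \is a fin_num -> S J t ^+ 2 <= L * fine (H t).
Proof.
move=> Ht; have -> : S J t = \sum_(0 <= j < J) rho ^+ j * (g j t / rho ^+ j).
  by apply: eq_bigr => j _; rewrite mulrC divfK// gt_eqF// exprn_gt0.
apply: (le_trans (weighted_cauchy_schwarz _ _ _)).
  by move=> k; rewrite exprn_ge0// ltW.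
apply: ler_pM.
- by apply: sumr_ge0 => k _; rewrite exprn_ge0// ltW.
- by apply: sumr_ge0 => k _; exact: w0.
- by rewrite sum_geometric_le// ltW.
- rewrite -lee_fin fineK// -sumEFin.
  by apply: nneseries_lim_ge => k _ _; rewrite lee_fin; exact: (w0 k t).
Qed.

Let S_cvg t : H t \is a fin_num -> (fun J => S J t) @ \oo --> f t.
Proof.
move=> Ht; have Hlt : (H t < +oo)%E by rewrite ltey_eq Ht.
have [M M0 hM] := nneseries_bound (w0 ^~ t) Hlt.
have cS : cvgn (fun J => S J t).
  apply: (@normed_cvg _ _ (fun j => g j t)).
  apply: (@series_le_cvg _ _ (fun j => rho ^+ j + w j t)).
  - by move=> n; exact: normr_ge0.
  - by move=> n; rewrite addr_ge0// exprn_ge0// ltW.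
  - move=> n /=; have r0 : 0 < rho ^+ n by rewrite exprn_gt0.
    rewrite wE; set r := rho ^+ n in r0 *.
    rewrite -(ler_pM2l r0) mulrDr mulrA divff ?gt_eqF// mul1r -[g n t ^+ 2](real_normK (num_real _)).
    have := sqr_ge0 (r - `|g n t|); have := normr_ge0 (g n t); rewrite !expr2.
    have := ltW r0; nra.
  - apply: nondecreasing_is_cvgn.
      apply/nondecreasing_seqP => n; rewrite seriesSr lerDl.
      by rewrite addr_ge0// exprn_ge0// ltW.
    exists (L + M) => _ [n _ <-]; rewrite /series/= big_split/= lerD//.
    by rewrite sum_geometric_le// ltW.
have cE : (fun J => (S J t)%:E) @ \oo --> (limn (fun J => S J t))%:E.
  by apply: cvg_EFin; [exact: nearW|exact: cS].
by rewrite /f (cvg_limn_einf_sup cE).2.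
Qed.

Let H_ae : {ae leb, forall t, `[a, b]%classic t -> H t \is a fin_num}.
Proof. exact: integrable_ae. Qed.

Let f_bound t : H t \is a fin_num -> f t ^+ 2 <= L * fine (H t).
Proof.
move=> Ht; have h : (fun J => S J t ^+ 2) @ \oo --> f t ^+ 2.
  by rewrite expr2; under eq_fun do rewrite expr2; apply: cvgM; exact: S_cvg.
rewrite -(cvg_lim _ h)//; apply: limr_le; first by apply/cvg_ex; exists (f t ^+ 2).
by apply: nearW => J; exact: S_bound.
Qed.

(** The partial sums converge almost everywhere and are dominated, so that their
    integrals against continuous functions converge as well. *)
Lemma riesz_fischer : exists2 f, square_integrable a b f &
  forall phi, continuous phi ->
  (fun J => \sum_(0 <= j < J) \int[leb]_(t in `[a, b]) (g j t * phi t)) @ \oo -->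
     \int[leb]_(t in `[a, b]) (f t * phi t).
Proof.
exists f.
  split => //; apply/integrableP; split.
    by apply/measurable_EFinP; exact: measurable_funX.
  have iLH := integrableZl mD L iH.
  apply: (@le_lt_trans _ _ (\int[leb]_(t in `[a, b]) (L%:E * H t))%E); last first.
    have /integrableP[_] := iLH; apply: le_lt_trans; apply: ge0_le_integral => //.
    - by move=> t _; rewrite mule_ge0// lee_fin ltW.
    - exact: measurable_int iLH.
    - by apply: measurableT_comp => //; exact: measurable_int iLH.
    - by move=> t _; exact: lee_abs.
  apply: ae_ge0_le_integral => //.
  - by apply: measurableT_comp => //; apply/measurable_EFinP; exact: measurable_funX.
  - by move=> t _; rewrite mule_ge0// lee_fin ltW.
  - exact: measurable_int iLH.
  - apply: (@filterS _ _ (ae_filter_ringOfSetsType leb) _ _ _ H_ae) => t h /h Ht.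
    rewrite gee0_abs ?lee_fin ?sqr_ge0//= -[H t]fineK// -EFinM lee_fin.
    exact: f_bound.
move=> phi cphi; have [C C0 hC] := continuous_bounded_itv ab cphi.
have mphi : measurable_fun `[a, b] phi.
  by apply: measurable_funTS; exact: continuous_measurable_fun.
have i1 : integ `[a, b] (fun=> C) by apply: integ_continuous => t; exact: cvg_cst.
have mSp J : measurable_fun `[a, b] (fun t => S J t * phi t).
  by apply: measurable_funM; [exact: mS|exact: mphi].
have mfp : measurable_fun `[a, b] (fun t => f t * phi t).
  by apply: measurable_funM; [exact: mf|exact: mphi].
have iG := integrableD mD i1 (integrableZl mD (C * L) iH).
have [||||iff _ lim] := dominated_convergence mD (f_ := fun J t => (S J t * phi t)%:E)
   (f := fun t => (f t * phi t)%:E) (g := fun t => (C%:E + (C * L)%:E * H t)%E) _ _ _ iG.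
- by move=> J; apply/measurable_EFinP; exact: mSp.
- by apply/measurable_EFinP; exact: mfp.
- apply: (@filterS _ _ (ae_filter_ringOfSetsType leb) _ _ _ H_ae) => t h /h Ht.
  apply: cvg_EFin; first exact: nearW.
  by apply: cvgM; [exact: S_cvg|exact: cvg_cst].
- apply: (@filterS _ _ (ae_filter_ringOfSetsType leb) _ _ _ H_ae) => t h J /[dup] tab /h Ht.
  rewrite -[H t]fineK// -EFinM -EFinD lee_fin normrM.
  have h1 := S_bound J Ht; have h2 := hC t tab.
  have h3 : `|S J t| <= 1 + L * fine (H t).
    rewrite -[S J t ^+ 2](real_normK (num_real _)) in h1.
    have := sqr_ge0 (`|S J t| - 1); have := normr_ge0 (S J t); rewrite !expr2 in h1 *; lra.
  by rewrite mulrC -mulrA -[X in X + _]mulr1 -mulrDr ler_pM.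
have e : (\int[leb]_(t in `[a, b]) (f t * phi t)%:E = (\int[leb]_(t in `[a, b]) (f t * phi t))%:E)%E.
  by rewrite /Rintegral fineK//; exact: integrable_fin_num iff.
rewrite e in lim; have l2 := fine_cvg lim.
suff -> : (fun J => \sum_(0 <= j < J) \int[leb]_(t in `[a, b]) (g j t * phi t)) =
   (fun J => fine (\int[leb]_(t in `[a, b]) (S J t * phi t)%:E)%E) by exact: l2.
apply/funext => J; rewrite -Rintegral_sum//; last first.
  by move=> j; apply: integ_continuous => t; apply: cvgM; [exact: cg|exact: cphi].
by apply: eq_Rintegral => t _; rewrite mulr_suml.
Qed.
End Series.
End Riesz_Fischer.

(** * The moment problem for well-spaced frequencies *)

Section Interpolation.
Context {R : realType}.
Local Notation leb := (@lebesgue_measure R).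

(** Moments are centred at the middle of the interval, where the window is even
    and cosines and sines are orthogonal to each other. *)
Definition cos_moment (a b y : R) (f : R -> R) : R :=
  \int[leb]_(t in `[a, b]) (f t * cos (y * (t - (a + b) / 2))).
Definition sin_moment (a b y : R) (f : R -> R) : R :=
  \int[leb]_(t in `[a, b]) (f t * sin (y * (t - (a + b) / 2))).

Definition l2_bound (B : R) (u v : nat -> R) :=
  forall N, \sum_(0 <= k < N) (u k ^+ 2 + v k ^+ 2) <= B.

Definition interpolating (a b : R) (x : nat -> R) := forall u v B, l2_bound B u v ->
  exists2 f, square_integrable a b f &
    forall n, cos_moment a b (x n) f = u n /\ sin_moment a b (x n) f = v n.

Let l2_tail (B e : R) (u v : nat -> R) : l2_bound B u v -> 0 < e ->
  exists N, forall M, (N <= M)%N -> \sum_(N <= k < M) (u k ^+ 2 + v k ^+ 2) <= e.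
Proof.
move=> hB e0; pose S N := \sum_(0 <= k < N) (u k ^+ 2 + v k ^+ 2).
have nd : nondecreasing_seq S.
  apply/nondecreasing_seqP => n; rewrite /S big_nat_recr//= lerDl.
  by rewrite addr_ge0 ?sqr_ge0.
have cS : cvgn S by apply: nondecreasing_is_cvgn => //; exists B => _ [n _ <-]; exact: hB.
have : \forall N \near \oo, `|limn S - S N| < e by move/cvgrPdist_lt : cS; exact.
move=> [N _ hN]; exists N => M NM.
have := hN N (leqnn N); rewrite ltr_norml => /andP[_ h].
have hM : S M <= limn S by exact: nondecreasing_cvgn_le.
have : S M = S N + \sum_(N <= k < M) (u k ^+ 2 + v k ^+ 2).
  by rewrite /S -big_cat_nat.
lra.
Qed.

Section Step.
Variables (a b g s : R) (x : nat -> R).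
Hypotheses (ab : a < b) (s1 : 1 < s) (hg : 2 * (pi / (b - a)) * s <= g) (hx : well_spaced g x).
Local Notation p := (pi / (b - a)).
Local Notation c0 := ((a + b) / 2).

Let p0 : 0 < p. Proof. by rewrite divr_gt0 ?pi_gt0 ?subr_gt0. Qed.

Let th : R := (s ^- 2) ^+ 2.
Let th0 : 0 <= th. Proof. exact: sqr_ge0. Qed.
Let th1 : th < 1.
Proof.
have s2 : 1 < s ^+ 2 by rewrite exprn_egt1.
rewrite /th exprn_ilt1 ?invr_ge0 ?sqr_ge0// invf_lt1//.
exact: lt_trans s2.
Qed.
Let q := (1 + th) / 2.

Let sq_split (d y z : R) : 0 < d -> (y + z) ^+ 2 <= (1 + d) * y ^+ 2 + (1 + d^-1) * z ^+ 2.
Proof.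
move=> d0; rewrite -subr_ge0.
have -> : (1 + d) * y ^+ 2 + (1 + d^-1) * z ^+ 2 - (y + z) ^+ 2 = d^-1 * (d * y - z) ^+ 2.
  by field; rewrite gt_eqF.
by rewrite mulr_ge0 ?sqr_ge0// invr_ge0 ltW.
Qed.

(* Multiplying the trigonometric sum of a truncation of the data by the window
   solves the moment problem up to the Gram defect and the discarded tail. *)
Let step u v B : 0 < B -> l2_bound B u v -> exists G : R -> R, [/\ continuous G,
    \int[leb]_(t in `[a, b]) (G t ^+ 2) <= 2 * p * B &
    l2_bound (q * B) (fun n => u n - cos_moment a b (x n) G)
                     (fun n => v n - sin_moment a b (x n) G)].
Proof.
move=> B0 hB; pose d := (1 - th) / 4; have d0 : 0 < d by rewrite divr_gt0// subr_gt0.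
have d1 : 0 < 1 + d^-1 by rewrite addr_gt0// invr_gt0.
have [|N hN] := @l2_tail B (d / (1 + d^-1) * B) u v hB.
  by rewrite mulr_gt0// divr_gt0.
pose u' k := if (k < N)%N then u k else 0.
pose v' k := if (k < N)%N then v k else 0.
pose F := trig_sum a b x N u v.
have FE M : (N <= M)%N -> trig_sum a b x M u' v' = F.
  move=> NM; apply/funext => t; rewrite /trig_sum (big_cat_nat (n := N))//= [X in _ + X]big_nat.
  rewrite [X in _ + X]big1 ?addr0; last first.
    by move=> k /andP[Nk _]; rewrite /u' /v' ltnNge Nk/= !mul0r addr0.
  by rewrite big_nat /F /trig_sum [RHS]big_nat; apply: eq_bigr => k /andP[_ kN]; rewrite /u' /v' kN.
have s1' := ltW s1.
have cF : continuous F by exact: continuous_trig_sum.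
have cw : continuous (fun t => cos (p * (t - c0)) * F t).
  by move=> t; apply: cvgM; [exact: continuous_cosc|exact: cF].
pose G t := p * (cos (p * (t - c0)) * F t).
have cG : continuous G by move=> t; apply: cvgMr; exact: cw.
have Gc n : cos_moment a b (x n) G =
    p * \int[leb]_(t in `[a, b]) (cos (p * (t - c0)) * F t * cos (x n * (t - c0))).
  rewrite -RintegralZl//; first by apply: eq_Rintegral => t _; rewrite /G; ring.
  by apply: integ_continuous => t; apply: cvgM; [exact: cw|exact: continuous_cosc].
have Gs n : sin_moment a b (x n) G =
    p * \int[leb]_(t in `[a, b]) (cos (p * (t - c0)) * F t * sin (x n * (t - c0))).
  rewrite -RintegralZl//; first by apply: eq_Rintegral => t _; rewrite /G; ring.
  by apply: integ_continuous => t; apply: cvgM; [exact: cw|exact: continuous_sinc].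
exists G; split => //.
  have ciw : continuous (fun t => cos (p * (t - c0)) * F t ^+ 2).
    move=> t; apply: cvgM; first exact: continuous_cosc.
    by apply: (@continuous_comp _ _ _ F (fun y : R => y ^+ 2)); [exact: cF|exact: exprn_continuous].
  apply: (@le_trans _ _ (p ^+ 2 * \int[leb]_(t in `[a, b]) (cos (p * (t - c0)) * F t ^+ 2))).
    rewrite -RintegralZl//; last exact: integ_continuous.
    apply: le_Rintegral => //.
    - apply: integ_continuous => t.
      by apply: (@continuous_comp _ _ _ G (fun y : R => y ^+ 2)); [exact: cG|exact: exprn_continuous].
    - by apply: integ_scale => //; exact: integ_continuous.
    - move=> t /= tab; rewrite /G exprMn ler_wpM2l ?sqr_ge0// exprMn ler_wpM2r ?sqr_ge0//.
      have /andP[w0 w1] : 0 <= cos (p * (t - c0)) <= 1.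
        by apply: win_ge0 => //; move: tab; rewrite in_itv.
      by rewrite expr2 ler_piMl.
  have := gram_upper ab s1' hg hx N u v; rewrite -/F => h.
  have h2 : 2 / p * \sum_(0 <= k < N) (u k ^+ 2 + v k ^+ 2) <= 2 / p * B.
    by apply: ler_wpM2l; [apply: divr_ge0 => //; exact: ltW|exact: hB].
  have h3 := ler_wpM2l (sqr_ge0 p) (le_trans h h2).
  apply: (le_trans h3); rewrite (_ : p ^+ 2 * (2 / p * B) = 2 * p * B)//.
  by move: (p) (gt_eqF p0) => r rn; field; rewrite rn.
suff hM M : (N <= M)%N -> \sum_(0 <= n < M) ((u n - cos_moment a b (x n) G) ^+ 2
    + (v n - sin_moment a b (x n) G) ^+ 2) <= q * B.
  move=> M; apply: le_trans (hM (maxn N M) (leq_maxl _ _)).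
  rewrite [leRHS](big_cat_nat (n := M)) ?leq_maxr//= lerDl.
  by apply: sumr_ge0 => k _; rewrite addr_ge0 ?sqr_ge0.
move=> NM; have := gram_defect ab s1' hg hx M u' v'; rewrite (FE M NM).
have -> : \sum_(0 <= k < M) (u' k ^+ 2 + v' k ^+ 2) = \sum_(0 <= k < N) (u k ^+ 2 + v k ^+ 2).
  rewrite (big_cat_nat (n := N))//= [X in _ + X]big_nat [X in _ + X]big1 ?addr0; last first.
    by move=> k /andP[Nk _]; rewrite /u' /v' ltnNge Nk/= expr0n addr0.
  by rewrite big_nat [RHS]big_nat; apply: eq_bigr => k /andP[_ kN]; rewrite /u' /v' kN.
under eq_bigr do rewrite -Gc -Gs.
rewrite -/th => h.
have {}h := le_trans h (ler_wpM2l th0 (hB N)).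
have tail : \sum_(0 <= n < M) ((u n - u' n) ^+ 2 + (v n - v' n) ^+ 2) <= d / (1 + d^-1) * B.
  rewrite (big_cat_nat (n := N))//= [X in X + _]big_nat [X in X + _]big1 ?add0r; last first.
    by move=> k /andP[_ kN]; rewrite /u' /v' kN !subrr expr0n addr0.
  apply: le_trans (hN M NM); rewrite big_nat [leRHS]big_nat; apply: ler_sum => k /andP[Nk _].
  by rewrite /u' /v' ltnNge Nk/= !subr0.
apply: (@le_trans _ _ ((1 + d) * (th * B) + (1 + d^-1) * (d / (1 + d^-1) * B))); last first.
  rewrite (_ : (1 + d^-1) * (d / (1 + d^-1) * B) = d * B); last first.
    by field; rewrite !gt_eqF//; rewrite addrC; move: d1; lra.
  rewrite mulrA -mulrDl ler_pM2r// /q /d.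
  move: (th) th0 th1 => y y0 y1; nra.
have h' := ler_wpM2l (ltW (addr_gt0 ltr01 d0)) h.
have t' := ler_wpM2l (ltW d1) tail.
apply: le_trans (lerD h' t'); rewrite !mulr_sumr -big_split/=.
apply: ler_sum => n _.
have e1 := sq_split (u' n - cos_moment a b (x n) G) (u n - u' n) d0.
have e2 := sq_split (v' n - sin_moment a b (x n) G) (v n - v' n) d0.
rewrite (_ : u' n - cos_moment a b (x n) G + (u n - u' n) = u n - cos_moment a b (x n) G) in e1; last by ring.
rewrite (_ : v' n - sin_moment a b (x n) G + (v n - v' n) = v n - sin_moment a b (x n) G) in e2; last by ring.
rewrite -[(cos_moment _ _ _ _ - _) ^+ 2]sqrrN opprB -[(sin_moment _ _ _ _ - _) ^+ 2]sqrrN opprB.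
lra.
Qed.

(** Ingham's theorem, in its dual form: each step reduces the data by a fixed
    factor, and the corrections form a series to which the Riesz-Fischer
    theorem applies. *)
Lemma well_spaced_interpolating : interpolating a b x.
Proof.
move=> u v B0 hB0; pose B := `|B0| + 1.
have B_gt0 : 0 < B by rewrite ltr_wpDl.
have hB : l2_bound B u v.
  by move=> N; rewrite (le_trans (hB0 N))// /B (le_trans (ler_norm _))// lerDl.
pose P (z : (nat -> R) * (nat -> R) * R) (G : R -> R) :=
  0 < z.2 -> l2_bound z.2 z.1.1 z.1.2 -> [/\ continuous G,
    \int[leb]_(t in `[a, b]) (G t ^+ 2) <= 2 * p * z.2 &
    l2_bound (q * z.2) (fun n => z.1.1 n - cos_moment a b (x n) G)
                     (fun n => z.1.2 n - sin_moment a b (x n) G)].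
have /choice[G hG] : forall z, exists G, P z G.
  move=> z; have [z0|z0] := ltP 0 z.2; last by exists (fun=> 0) => z1; rewrite ltNge z0 in z1.
  have [hz|hz] := pselect (l2_bound z.2 z.1.1 z.1.2).
    by have [K hK] := step z0 hz; exists K.
  by exists (fun=> 0).
pose resid (y : (nat -> R) * (nat -> R)) (K : R -> R) :=
  ((fun n => y.1 n - cos_moment a b (x n) K), (fun n => y.2 n - sin_moment a b (x n) K)).
pose st := fix st j := if j is j'.+1 then resid (st j') (G (st j', q ^+ j' * B)) else (u, v).
pose h j := G (st j, q ^+ j * B).
have q0 : 0 < q by rewrite /q; move: (th) th0 => y y0; lra.
have q1 : q < 1 by rewrite /q; move: (th) th1 => y y1; lra.
have qB j : 0 < q ^+ j * B by rewrite mulr_gt0// exprn_gt0.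
have hst j : l2_bound (q ^+ j * B) (st j).1 (st j).2.
  elim: j => [|j ih]; first by rewrite expr0 mul1r.
  by have [_ _] := hG (st j, q ^+ j * B) (qB j) ih; rewrite mulrA -exprS.
have hh j := hG (st j, q ^+ j * B) (qB j) (hst j).
have [||f fL2 hf] := @riesz_fischer R a b ab h (2 * p * B) q q0 q1.
- by move=> j; have [] := hh j.
- move=> j; have [_ h2 _] := hh j.
  by rewrite (_ : 2 * p * B * q ^+ j = 2 * p * (q ^+ j * B))//; ring.
exists f => // n.
have sq0 (y : nat -> R) : (forall j, y j ^+ 2 <= q ^+ j * B) -> y @ \oo --> (0 : R).
  move=> hy; have gq : (fun j => q ^+ j * B) @ \oo --> (0 : R).
    rewrite -(mul0r B); apply: cvgM; last exact: cvg_cst.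
    by apply: cvg_expr; rewrite gtr0_norm.
  apply/cvgr0Pnorm_lt => e e0.
  have : \forall j \near \oo, q ^+ j * B < e ^+ 2 by apply: (cvgr_lt _ gq); rewrite exprn_gt0.
  apply: filterS => j hj; rewrite -ltr_sqr ?nnegrE ?normr_ge0 ?(ltW e0)//.
  by rewrite real_normK ?num_real// (le_lt_trans (hy j)).
have tele (m : (R -> R) -> R) (y : nat -> R) : (forall j, y j.+1 = y j - m (h j)) ->
    forall J, \sum_(0 <= j < J) m (h j) = y 0%N - y J.
  move=> hy; elim=> [|J ih]; first by rewrite big_geq// subrr.
  by rewrite big_nat_recr//= ih hy; ring.
have single (y z : nat -> R) K m : l2_bound K y z -> y m ^+ 2 <= K /\ z m ^+ 2 <= K.
  move=> hK; have := hK m.+1; rewrite big_nat_recr//=.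
  have : 0 <= \sum_(0 <= k < m) (y k ^+ 2 + z k ^+ 2).
    by apply: sumr_ge0 => k _; rewrite addr_ge0 ?sqr_ge0.
  have := sqr_ge0 (y m); have := sqr_ge0 (z m); lra.
split.
  have l1 := hf _ (@continuous_cosc _ (x n) c0).
  have l2 : (fun J => u n - (st J).1 n) @ \oo --> u n.
    rewrite -[X in _ --> X]subr0; apply: cvgB; first exact: cvg_cst.
    by apply: sq0 => j; have [] := single _ _ _ n (hst j).
  have e : (fun J => \sum_(0 <= j < J) cos_moment a b (x n) (h j)) = (fun J => u n - (st J).1 n).
    by apply/funext => J; exact: (tele (cos_moment a b (x n)) (fun j => (st j).1 n)).
  by rewrite -e in l2; exact: cvg_unique l1 l2.
have l1 := hf _ (@continuous_sinc _ (x n) c0).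
have l2 : (fun J => v n - (st J).2 n) @ \oo --> v n.
  rewrite -[X in _ --> X]subr0; apply: cvgB; first exact: cvg_cst.
  by apply: sq0 => j; have [] := single _ _ _ n (hst j).
have e : (fun J => \sum_(0 <= j < J) sin_moment a b (x n) (h j)) = (fun J => v n - (st J).2 n).
  by apply/funext => J; exact: (tele (sin_moment a b (x n)) (fun j => (st j).2 n)).
by rewrite -e in l2; exact: cvg_unique l1 l2.
Qed.

End Step.
End Interpolation.

(** * Integration by parts for integrable functions *)

Section Fubini_parts.
Context {R : realType}.
Local Notation leb := (@lebesgue_measure R).
Local Notation integ D f := (leb.-integrable D (EFin \o f)).
Variables (a b : R) (p P F : R -> R).
Hypotheses (ab : a <= b) (cp : continuous p)
  (dP : forall t, is_derive t (1 : R) P (p t)) (iF : integ `[a, b] F).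

Let D : set (measurableTypeR R) := `[a, b]%classic.
Let mD : measurable D. Proof. exact: measurable_itv. Qed.

Let FD : R -> R := F \_ D.
Let pD : R -> R := p \_ D.

Let iFD : integ setT FD.
Proof. by rewrite /FD -restrict_EFin; apply/integrable_restrict => //; rewrite setTI. Qed.

Let ipD : integ setT pD.
Proof.
rewrite /pD -restrict_EFin; apply/integrable_restrict => //; rewrite setTI.
exact: integ_continuous.
Qed.

Let mFD : measurable_fun setT FD. Proof. exact: integ_measurable iFD. Qed.
Let mpD : measurable_fun setT pD. Proof. exact: integ_measurable ipD. Qed.

Let k (z : measurableTypeR R * measurableTypeR R) : R := if z.2 <= z.1 then pD z.1 * FD z.2 else 0.

Let mk : measurable_fun setT k.
Proof.
apply: measurable_fun_ifT => //.
  by apply: measurable_fun_ler; [exact: measurable_snd|exact: measurable_fst].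
apply: measurable_funM.
  exact: (measurableT_comp mpD measurable_fst).
exact: (measurableT_comp mFD measurable_snd).
Qed.

Let k0 (z : measurableTypeR R * measurableTypeR R) : R := `|pD z.1| * `|FD z.2|.

Let mk0 : measurable_fun setT k0.
Proof.
apply: measurable_funM; apply: measurableT_comp => //.
  exact: (measurableT_comp mpD measurable_fst).
exact: (measurableT_comp mFD measurable_snd).
Qed.

Let ik0 : (leb \x leb)%E.-integrable setT (EFin \o k0).
Proof.
apply/integrable12ltyP; first exact/measurable_EFinP.
have /integrableP[mp' hp] := ipD; have /integrableP[mF' hF] := iFD.
have mn : measurable_fun setT (fun y : R => `|(FD y)%:E|%E) by exact: measurableT_comp.
have mn' : measurable_fun setT (fun y : R => `|(pD y)%:E|%E) by exact: measurableT_comp.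
pose C := (\int[leb]_y `|(FD y)%:E|)%E.
have C0 : (0 <= C)%E by exact: integral_ge0.
rewrite (eq_integral (fun x : measurableTypeR R => (C * `|(pD x)%:E|)%E)); last first.
  move=> x _; transitivity (\int[leb]_y (`|(pD x)%:E| * `|(FD y)%:E|))%E.
    by apply: eq_integral => y _; rewrite /= /k0 normrM !normr_id EFinM.
  by rewrite ge0_integralZl// muleC.
rewrite ge0_integralZl//.
by rewrite lte_mul_pinfty// ge0_fin_numE.
Qed.

Let ik : (leb \x leb)%E.-integrable setT (EFin \o k).
Proof.
apply: (le_integrable _ _ _ ik0) => //; first exact/measurable_EFinP.
move=> [x y] _; rewrite /k /k0 /= lee_fin normrM !normr_id; case: ifP => _.
  by rewrite normrM.
by rewrite normr0 mulr_ge0.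
Qed.

Let iF_itv (t : R) : integ setT (F \_ (`[a, t]%classic `&` D)).
Proof.
have mI : measurable (`[a, t]%classic `&` D : set (measurableTypeR R)).
  by apply: measurableI => //; exact: measurable_itv.
rewrite -restrict_EFin; apply/integrable_restrict => //; rewrite setTI.
by apply: (integrableS mD) iF => //.
Qed.

Let ip_itv (r : R) : integ setT (p \_ (`[r, b]%classic `&` D)).
Proof.
have mI : measurable (`[r, b]%classic `&` D : set (measurableTypeR R)).
  by apply: measurableI => //; exact: measurable_itv.
rewrite -restrict_EFin; apply/integrable_restrict => //; rewrite setTI.
by apply: (integrableS mD) (integ_continuous a b cp) => //.
Qed.

Let restrict_int (A : set (measurableTypeR R)) (h : R -> R) :
  (\int[leb]_t ((h \_ A) t)%:E = \int[leb]_(t in A) (h t)%:E)%E.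
Proof.
rewrite [RHS]integral_mkcond; apply: eq_integral => t _.
by rewrite !patchE; case: ifP.
Qed.

Let inner1 (t : R) : (\int[leb]_r (k (t, r))%:E =
  (((fun t => p t * \int[leb]_(r in `[a, t]) F r) \_ D) t)%:E)%E.
Proof.
rewrite patchE; case: ifPn => [|tD]; last first.
  rewrite (eq_integral (fun=> 0%E : \bar R)) ?integral0// => r _.
  by rewrite /k /= /pD patchE (negbTE tD) mul0r if_same.
rewrite inE /D /= in_itv/= => /andP[at_ tb].
rewrite (eq_integral (fun r : measurableTypeR R => (p t)%:E * ((F \_ (`[a, t]%classic `&` D)) r)%:E)%E); last first.
  move=> r _; rewrite -EFinM /k /pD /FD !patchE /=.
  rewrite (mem_set (_ : D t)); last by rewrite /D /= in_itv/= at_.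
  congr EFin; have [rt|tr] := leP r t.
    have [rD|rD] := boolP (r \in D); last first.
      by rewrite ifF// in_setI (negbTE rD) andbF.
    rewrite ifT// in_setI rD andbT inE/= in_itv/= rt andbT.
    by move: rD; rewrite inE /D /= in_itv/= => /andP[].
  rewrite ifF ?mulr0// in_setI; apply/negbTE; rewrite negb_and.
  by apply/orP; left; apply/negP; rewrite inE/= in_itv/= => /andP[_]; rewrite leNgt tr.
rewrite integralZl//; last exact: iF_itv.
rewrite EFinM; congr (_ * _)%E; rewrite restrict_int.
have -> : `[a, t]%classic `&` D = `[a, t]%classic.
  by apply: setIidl; apply: subset_itvl; rewrite bnd_simp.
rewrite /Rintegral fineK//; apply: integrable_fin_num => //.
by apply: (integrableS mD) iF => //; apply: subset_itvl; rewrite bnd_simp.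
Qed.

Let inner2 (r : R) : (\int[leb]_t (k (t, r))%:E =
  (((fun r => F r * (P b - P r)) \_ D) r)%:E)%E.
Proof.
rewrite patchE; case: ifPn => [|rD]; last first.
  rewrite (eq_integral (fun=> 0%E : \bar R)) ?integral0// => t _.
  by rewrite /k /= /FD [X in _ * X]patchE (negbTE rD) mulr0 if_same.
rewrite inE /D /= in_itv/= => /andP[ar rb].
rewrite (eq_integral (fun t : measurableTypeR R => (F r)%:E * ((p \_ (`[r, b]%classic `&` D)) t)%:E)%E); last first.
  move=> t _; rewrite -EFinM /k /pD /FD !patchE /=.
  rewrite (mem_set (_ : D r)); last by rewrite /D /= in_itv/= ar.
  congr EFin; have [rt|tr] := leP r t.
    have [tD|tD] := boolP (t \in D); last first.
      by rewrite ifF ?mul0r ?mulr0// in_setI (negbTE tD) andbF.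
    rewrite mulrC ifT// in_setI tD andbT inE/= in_itv/= rt/=.
    by move: tD; rewrite inE /D /= in_itv/= => /andP[].
  rewrite ifF ?mulr0// in_setI; apply/negbTE; rewrite negb_and.
  by apply/orP; left; apply/negP; rewrite inE/= in_itv/= => /andP[]; rewrite leNgt tr.
rewrite integralZl//; last exact: ip_itv.
rewrite EFinM; congr (_ * _)%E; rewrite restrict_int.
have -> : `[r, b]%classic `&` D = `[r, b]%classic.
  by apply: setIidl; apply: subset_itvr; rewrite bnd_simp.
rewrite -(Rintegral_antiderivative rb dP cp) /Rintegral fineK//.
by apply: integrable_fin_num => //; exact: integ_continuous.
Qed.

Let cP : continuous P. Proof. by move=> t; exact: isd_continuous (dP t). Qed.

(** Fubini's theorem on the triangle r <= t: the primitive of F need not be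
    differentiable, which rules out the classical integration by parts. *)
Lemma Fubini_parts : \int[leb]_(t in `[a, b]) (p t * \int[leb]_(r in `[a, t]) F r) =
  P b * \int[leb]_(t in `[a, b]) F t - \int[leb]_(t in `[a, b]) (P t * F t).
Proof.
have := Fubini ik; rewrite /=.
under eq_integral do rewrite inner1.
under [RHS]eq_integral do rewrite inner2.
move/(congr1 fine); rewrite -!/(Rintegral _ _ _) -!Rintegral_mkcond => ->.
have [c0 [_ hP]] : exists2 C, 0 <= C & forall t, D t -> `|P t| <= C.
  move: ab; rewrite le_eqVlt => /predU1P[e|ab']; last exact: continuous_bounded_itv.
  exists `|P a| => // t; rewrite /D /= in_itv/= -e => /andP[h1 h2].
  by rewrite (_ : t = a)//; apply/eqP; rewrite eq_le h1 h2.
have iPF : integ `[a, b] (fun t => P t * F t).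
  apply: (integ_mul_bounded _ _ iF hP) => //.
  by apply: measurable_funTS; exact: continuous_measurable_fun.
rewrite -RintegralZl// -RintegralB//; last exact: integ_scale.
by apply: eq_Rintegral => t _; ring.
Qed.
End Fubini_parts.

(** * Bessel's inequality *)

Section Bessel_inequality.
Context {R : realType}.
Local Notation leb := (@lebesgue_measure R).
Local Notation integ D f := (leb.-integrable D (EFin \o f)).

Lemma square_integrable_integ (a b : R) (f : R -> R) :
  square_integrable a b f -> integ `[a, b] f.
Proof.
move=> [mf if2]; have mD : measurable (`[a, b]%classic : set (measurableTypeR R)) by exact: measurable_itv.
have i1 : integ `[a, b] (fun=> 1) by apply: integ_continuous => t; exact: cvg_cst.
apply: (integ_dominated mD mf (integ_add mD i1 if2)) => t _.
rewrite -[f t ^+ 2](real_normK (num_real _)).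
have := sqr_ge0 (`|f t| - 1); have := normr_ge0 (f t); rewrite !expr2; lra.
Qed.

Lemma square_integrable_mul (a b : R) (f phi : R -> R) :
  square_integrable a b f -> continuous phi -> integ `[a, b] (fun t => f t * phi t).
Proof.
move=> hf cphi; have mD : measurable (`[a, b]%classic : set (measurableTypeR R)) by exact: measurable_itv.
have hi := square_integrable_integ hf.
have [ab|ba] := ltP a b.
  have [C _ hC] := continuous_bounded_itv ab cphi.
  rewrite (_ : (fun t => f t * phi t) = fun t => phi t * f t); last by apply/funext => t; rewrite mulrC.
  apply: (integ_mul_bounded mD _ hi hC).
  by apply: measurable_funTS; exact: continuous_measurable_fun.
rewrite (_ : (fun t => f t * phi t) = fun t => phi t * f t); last by apply/funext => t; rewrite mulrC.
apply: (@integ_mul_bounded _ _ mD _ _ `|phi a| _ hi).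
  by apply: measurable_funTS; exact: continuous_measurable_fun.
move=> t /=; rewrite in_itv/= => /andP[at_ tb].
by rewrite (_ : t = a)//; apply/eqP; rewrite eq_le at_ (le_trans tb ba).
Qed.

Lemma square_integrableD (a b : R) (f h : R -> R) : square_integrable a b f ->
  square_integrable a b h -> square_integrable a b (fun t => f t + h t).
Proof.
move=> [mf if2] [mh ih2]; have mD : measurable (`[a, b]%classic : set (measurableTypeR R)) by exact: measurable_itv.
have m : measurable_fun `[a, b] (fun t => f t + h t) by exact: measurable_funD.
split => //; have i := integ_scale mD 2 (integ_add mD if2 ih2).
apply: (integ_dominated mD _ i) => [|t _]; first exact: measurable_funX.
rewrite ger0_norm ?sqr_ge0//; have := sqr_ge0 (f t - h t); rewrite !expr2; lra.
Qed.

Lemma square_integrableZ (a b c : R) (f : R -> R) : square_integrable a b f ->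
  square_integrable a b (fun t => c * f t).
Proof.
move=> [mf if2]; have mD : measurable (`[a, b]%classic : set (measurableTypeR R)) by exact: measurable_itv.
split; first by apply: measurable_funM => //; exact: measurable_cst.
rewrite (_ : (fun t => (c * f t) ^+ 2) = fun t => c ^+ 2 * f t ^+ 2).
  exact: integ_scale.
by apply/funext => t; rewrite exprMn.
Qed.

Lemma square_integrable_continuous (a b : R) (f : R -> R) : continuous f ->
  square_integrable a b f.
Proof.
move=> cf; split.
  by apply: measurable_funTS; exact: continuous_measurable_fun.
apply: integ_continuous => t.
by apply: (@continuous_comp _ _ _ f (fun y : R => y ^+ 2)); [exact: cf|exact: exprn_continuous].
Qed.

Lemma Rintegral_subset (A B : set (measurableTypeR R)) (f : R -> R) :
  measurable A -> measurable B -> A `<=` B -> integ B f ->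
  (forall t, B t -> 0 <= f t) ->
  \int[leb]_(t in A) f t <= \int[leb]_(t in B) f t.
Proof.
move=> mA mB AB iB f0; have iA : integ A f by exact: integrableS iB.
rewrite /Rintegral fine_le//; [exact: integrable_fin_num|exact: integrable_fin_num|].
by apply: ge0_subset_integral => //; exact: measurable_int iB.
Qed.

(** Every gap is large enough for a long window, and [a, b] lies in the middle
    half of its support, where the window is bounded below.  The inequality then
    follows by duality from the upper bound for the Gram matrix; the constant
    does not depend on [a, b]. *)
Lemma bessel_inequality (T g : R) (x : nat -> R) : 0 < T -> 0 < g ->
  well_spaced g x -> exists2 K, 0 < K & forall a b f, - T <= a -> b <= T ->
  square_integrable a b f -> forall M,
  \sum_(0 <= n < M) ((\int[leb]_(t in `[a, b]) (f t * cos (x n * t))) ^+ 2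
     + (\int[leb]_(t in `[a, b]) (f t * sin (x n * t))) ^+ 2)
  <= K * \int[leb]_(t in `[a, b]) f t ^+ 2.
Proof.
move=> T0 g0 hx; have pi0 := @pi_gt0 R.
pose L := 2 * Num.max T (pi / g).
have LT : 2 * T <= L by rewrite ler_pM2l// le_max lexx.
have Lg : 2 * (pi / g) <= L by rewrite ler_pM2l// le_max lexx orbT.
have L0 : 0 < L by lra.
have LL : - L < L by lra.
have c0 : (- L + L) / 2 = 0 by rewrite addNr mul0r.
pose p := pi / (L - - L); have pE : p = pi / (2 * L) by rewrite /p; congr (_ / _); lra.
have p0 : 0 < p by rewrite pE divr_gt0// mulr_gt0.
have hg : 2 * p * 1 <= g.
  rewrite mulr1 pE; have : pi * 2 <= L * g by rewrite -ler_pdivrMr//; lra.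
  move=> h; rewrite (_ : 2 * (pi / (2 * L)) = pi / L); last by field; rewrite gt_eqF.
  by rewrite ler_pdivrMr//; lra.
pose c1 : R := cos (pi / 4).
have c10 : 0 < c1 by apply: cos_gt0_pihalf; apply/andP; split; lra.
pose K := c1^-1 * (2 / p).
have K0 : 0 < K by rewrite mulr_gt0 ?invr_gt0// divr_gt0.
exists K => // a b f aT bT hf M.
pose u n := \int[leb]_(t in `[a, b]) (f t * cos (x n * t)).
pose v n := \int[leb]_(t in `[a, b]) (f t * sin (x n * t)).
pose S := \sum_(0 <= n < M) (u n ^+ 2 + v n ^+ 2).
rewrite -/S; pose F := trig_sum (- L) L x M u v.
have FE t : F t = \sum_(0 <= k < M) (u k * cos (x k * t) + v k * sin (x k * t)).
  by rewrite /F /trig_sum c0; apply: eq_bigr => k _; rewrite subr0.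
have cF : continuous F by exact: continuous_trig_sum.
have cF2 : continuous (fun t => F t ^+ 2).
  by move=> t; apply: (@continuous_comp _ _ _ F (fun y : R => y ^+ 2)); [exact: cF|exact: exprn_continuous].
have cw : continuous (fun t => cos (p * (t - (- L + L) / 2)) * F t ^+ 2).
  by move=> t; apply: cvgM; [exact: continuous_cosc|exact: cF2].
have mD : measurable (`[a, b]%classic : set (measurableTypeR R)) by exact: measurable_itv.
have S0 : 0 <= S by apply: sumr_ge0 => k _; rewrite addr_ge0 ?sqr_ge0.
have cosx y : continuous (fun t : R => cos (y * t)).
  move=> t; have := @continuous_cosc R y 0 t.
  by rewrite (_ : (fun t => cos (y * (t - 0))) = (fun t => cos (y * t)))//; apply/funext => z; rewrite subr0.
have sinx y : continuous (fun t : R => sin (y * t)).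
  move=> t; have := @continuous_sinc R y 0 t.
  by rewrite (_ : (fun t => sin (y * (t - 0))) = (fun t => sin (y * t)))//; apply/funext => z; rewrite subr0.
have fF : \int[leb]_(t in `[a, b]) (f t * F t) = S.
  transitivity (\int[leb]_(t in `[a, b]) (\sum_(0 <= k < M)
      (u k * (f t * cos (x k * t)) + v k * (f t * sin (x k * t))))).
    apply: eq_Rintegral => t _; rewrite FE mulr_sumr; apply: eq_bigr => k _; ring.
  have ic k := square_integrable_mul hf (@cosx (x k)).
  have is_ k := square_integrable_mul hf (@sinx (x k)).
  rewrite Rintegral_sum//; last by move=> k; apply: integ_add => //; exact: integ_scale.
  apply: eq_bigr => k _.
  by rewrite (Rintegral_lincomb (c := u k) (d := v k) mD (ic k) (is_ k))// !expr2.
have F2 : \int[leb]_(t in `[a, b]) F t ^+ 2 <= K * S.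
  have h := gram_upper LL (lexx 1) hg hx M u v; rewrite -/F -/S -/p in h.
  rewrite /K -mulrA -ler_pdivrMl ?invr_gt0// invrK; apply: le_trans h.
  apply: (@le_trans _ _ (\int[leb]_(t in `[a, b]) (cos (p * (t - (- L + L) / 2)) * F t ^+ 2))).
    rewrite -RintegralZl//; last exact: integ_continuous.
    apply: le_Rintegral => //.
    - by apply: integ_scale => //; exact: integ_continuous.
    - exact: integ_continuous.
    - move=> t /=; rewrite in_itv/= => /andP[at_ tb]; rewrite ler_wpM2r ?sqr_ge0//.
      apply: (win_middle LL); rewrite c0 subr0 ler_norml; apply/andP; split; lra.
  apply: Rintegral_subset => //.
  - by apply: subset_itv; rewrite bnd_simp; lra.
  - exact: integ_continuous.
  - move=> t /=; rewrite in_itv/= => tL; rewrite mulr_ge0 ?sqr_ge0//.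
    by have /andP[] := win_ge0 LL tL.
have ifF := square_integrable_mul hf cF.
have iF2 := integ_continuous a b cF2.
have := hf.2 => if2.
have : 0 <= \int[leb]_(t in `[a, b]) ((f t ^+ 2 + K^-1 ^+ 2 * F t ^+ 2) - 2 * K^-1 * (f t * F t)).
  apply: Rintegral_ge0 => t _.
  rewrite (_ : _ - _ = (f t - K^-1 * F t) ^+ 2) ?sqr_ge0//; ring.
rewrite RintegralB//; [|by apply: integ_add => //; exact: integ_scale|exact: integ_scale].
rewrite RintegralD//; last exact: integ_scale.
rewrite !RintegralZl// fF => h.
have h2 := ler_wpM2l (sqr_ge0 K^-1) F2.
have h3 : K^-1 ^+ 2 * (K * S) = K^-1 * S by field; rewrite gt_eqF.
rewrite h3 in h2.
rewrite -ler_pdivrMl//; lra.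
Qed.

End Bessel_inequality.

(** * Exchanging one frequency *)

Section Exchange.
Context {R : realType}.
Local Notation leb := (@lebesgue_measure R).
Local Notation integ D f := (leb.-integrable D (EFin \o f)).
Variables (a b : R) (ab : a < b).
Local Notation c0 := ((a + b) / 2).
Local Notation cosc x t := (cos (x * (t - c0))).
Local Notation sinc x t := (sin (x * (t - c0))).

Let mD : measurable (`[a, b]%classic : set (measurableTypeR R)).
Proof. exact: measurable_itv. Qed.

Section Multiplier.
Variables (y : R) (f : R -> R).
Hypotheses (y0 : 0 < y) (hf : square_integrable a b f)
  (fc : cos_moment a b y f = 0) (fs : sin_moment a b y f = 0).

Let A t := \int[leb]_(r in `[a, t]) (f r * cosc y r).
Let B t := \int[leb]_(r in `[a, t]) (f r * sinc y r).

(** The solution of Q'' + y^2 Q = f with vanishing Cauchy data at a.  As the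
    moments of f at the frequency y vanish, its Cauchy data at b vanish too,
    so that no boundary term appears in the moments of Q. *)
Definition duhamel t := y^-1 * (sinc y t * A t - cosc y t * B t).

Let primitive_ok (h : R -> R) : integ `[a, b] h ->
  measurable_fun `[a, b] (fun t => \int[leb]_(r in `[a, t]) h r) /\
  exists2 C, 0 <= C & forall t, a <= t <= b -> `|\int[leb]_(r in `[a, t]) h r| <= C.
Proof.
move=> ih; split.
  apply: subspace_continuous_measurable_fun => //.
  exact: (parameterized_integral_continuous (ltW ab) ih).
exists (\int[leb]_(r in `[a, b]) `|h r|); first by apply: Rintegral_ge0 => t _.
move=> t /andP[at_ tb]; have sub : `[a, t] `<=` `[a, b] by apply: subset_itvl; rewrite bnd_simp.
have iht : integ `[a, t] h by apply: (integrableS mD) ih => //.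
apply: (le_trans (le_normr_Rintegral _ iht)) => //.
apply: Rintegral_subset => //.
exact: integrable_norm.
Qed.

Let icf := square_integrable_mul hf (@continuous_cosc _ y c0).
Let isf := square_integrable_mul hf (@continuous_sinc _ y c0).

Let iprim (p h : R -> R) : continuous p -> integ `[a, b] h ->
  integ `[a, b] (fun t => p t * \int[leb]_(r in `[a, t]) h r).
Proof.
move=> cp ih; have [m [C C0 hC]] := primitive_ok ih.
have mp : measurable_fun `[a, b] p.
  by apply: measurable_funTS; exact: continuous_measurable_fun.
apply: (integ_dominated mD _ (integ_scale mD C (integrable_norm (integ_continuous a b cp)))).
  exact: measurable_funM.
move=> t /=; rewrite in_itv/= => tab; rewrite normrM mulrC.
by rewrite ler_wpM2r ?hC.
Qed.

Lemma square_integrable_duhamel : square_integrable a b duhamel.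
Proof.
have [mA [CA CA0 hA]] := primitive_ok icf; have [mB [CB CB0 hB]] := primitive_ok isf.
have mQ : measurable_fun `[a, b] duhamel.
  apply: measurable_funM; first exact: measurable_cst.
  apply: measurable_funB; apply: measurable_funM => //; apply: measurable_funTS;
    apply: continuous_measurable_fun; [exact: continuous_sinc|exact: continuous_cosc].
split => //; pose C := (y^-1 * (CA + CB)) ^+ 2.
have iC : integ `[a, b] (fun=> C) by apply: integ_continuous => t; exact: cvg_cst.
apply: (integ_dominated mD _ iC); first exact: measurable_funX.
move=> t /=; rewrite in_itv/= => tab; rewrite normrX ler_sqr ?nnegrE//; last first.
  by rewrite mulr_ge0 ?invr_ge0 ?(ltW y0)// addr_ge0.
rewrite normrM gtr0_norm ?invr_gt0// ler_wpM2l ?invr_ge0 ?(ltW y0)//.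
apply: (le_trans (ler_normB _ _)); apply: lerD; rewrite normrM.
  rewrite -[leRHS]mul1r ler_pM ?hA//; by rewrite ler_norml sin_geN1 sin_le1.
rewrite -[leRHS]mul1r ler_pM ?hB//; by rewrite ler_norml cos_geN1 cos_le1.
Qed.

Let duhamel_mul (phi P1 P2 : R -> R) (k : R) : continuous phi ->
  (forall t, is_derive t (1 : R) P1 (sinc y t * phi t)) ->
  (forall t, is_derive t (1 : R) P2 (cosc y t * phi t)) ->
  (forall t, P2 t * sinc y t - P1 t * cosc y t = k * phi t) ->
  \int[leb]_(t in `[a, b]) (duhamel t * phi t) =
  y^-1 * k * \int[leb]_(t in `[a, b]) (f t * phi t).
Proof.
move=> cphi d1 d2 e.
have c1 : continuous (fun t => sinc y t * phi t).
  by move=> t; apply: cvgM; [exact: continuous_sinc|exact: cphi].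
have c2 : continuous (fun t => cosc y t * phi t).
  by move=> t; apply: cvgM; [exact: continuous_cosc|exact: cphi].
have i1 := iprim c1 icf; have i2 := iprim c2 isf.
rewrite (Rintegral_lincomb (c := y^-1) (d := - y^-1) mD i1 i2); last first.
  by move=> t; rewrite /duhamel /A /B; ring.
rewrite (Fubini_parts (ltW ab) c1 d1 icf) (Fubini_parts (ltW ab) c2 d2 isf).
rewrite -/(cos_moment a b y f) -/(sin_moment a b y f) fc fs !mulr0 !sub0r.
have cP1 : continuous P1 by move=> t; exact: isd_continuous (d1 t).
have cP2 : continuous P2 by move=> t; exact: isd_continuous (d2 t).
have j1 : integ `[a, b] (fun t => f t * (P1 t * cosc y t)).
  by apply: square_integrable_mul => // t; apply: cvgM; [exact: cP1|exact: continuous_cosc].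
have j2 : integ `[a, b] (fun t => f t * (P2 t * sinc y t)).
  by apply: square_integrable_mul => // t; apply: cvgM; [exact: cP2|exact: continuous_sinc].
have -> : \int[leb]_(t in `[a, b]) (P1 t * (f t * cosc y t)) = \int[leb]_(t in `[a, b]) (f t * (P1 t * cosc y t)).
  by apply: eq_Rintegral => t _; ring.
have -> : \int[leb]_(t in `[a, b]) (P2 t * (f t * sinc y t)) = \int[leb]_(t in `[a, b]) (f t * (P2 t * sinc y t)).
  by apply: eq_Rintegral => t _; ring.
have j3 := square_integrable_mul hf cphi.
have gen (X Y : R) : y^-1 * - X + - y^-1 * - Y = y^-1 * (Y - X) by ring.
rewrite gen.
rewrite -RintegralB// -mulrA; congr (_ * _); rewrite -RintegralZl//.
by apply: eq_Rintegral => t _; have := e t; rewrite -mulrBr => ->; ring.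
Qed.

Let trig1 (u : R) : cos u ^+ 2 = 1 - sin u ^+ 2.
Proof. by have := cos2Dsin2 u; lra. Qed.

(** Two integrations by parts, with the operator D^2 + y^2 applied to
    cos (w t). *)
Lemma cos_moment_duhamel w : w ^+ 2 != y ^+ 2 ->
  cos_moment a b w duhamel = cos_moment a b w f / (y ^+ 2 - w ^+ 2).
Proof.
move=> wy; have d0 : y ^+ 2 - w ^+ 2 != 0 by rewrite subr_eq0 eq_sym.
have yn : y != 0 by rewrite gt_eqF.
have d1 t : is_derive t (1 : R)
    (fun t => (y ^+ 2 - w ^+ 2)^-1 * - (y * (cosc y t * cosc w t) + w * (sinc y t * sinc w t)))
    (sinc y t * cosc w t).
  apply: (is_derive_eq (isd_scale _ (isd_opp (isd_add
    (isd_scale y (isd_mul (isd_cosc y c0 t) (isd_cosc w c0 t)))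
    (isd_scale w (isd_mul (isd_sinc y c0 t) (isd_sinc w c0 t))))))).
  by field.
have d2 t : is_derive t (1 : R)
    (fun t => (y ^+ 2 - w ^+ 2)^-1 * (y * (sinc y t * cosc w t) - w * (cosc y t * sinc w t)))
    (cosc y t * cosc w t).
  apply: (is_derive_eq (isd_scale _ (isd_sub
    (isd_scale y (isd_mul (isd_sinc y c0 t) (isd_cosc w c0 t)))
    (isd_scale w (isd_mul (isd_cosc y c0 t) (isd_sinc w c0 t)))))).
  by field.
rewrite /cos_moment (duhamel_mul (k := y / (y ^+ 2 - w ^+ 2)) (@continuous_cosc _ w c0) d1 d2).
  by rewrite mulrA mulVf// mul1r mulrC.
move=> t; move: (sinc w t) (cosc w t) => S C.
have := trig1 (y * (t - c0)); move: (sinc y t) (cosc y t) => s c h.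
have gen X : X * (y * (s * C) - w * (c * S)) * s - X * - (y * (c * C) + w * (s * S)) * c
    = X * y * C * (s ^+ 2 + c ^+ 2) by ring.
by rewrite gen h; field.
Qed.

Lemma sin_moment_duhamel w : w ^+ 2 != y ^+ 2 ->
  sin_moment a b w duhamel = sin_moment a b w f / (y ^+ 2 - w ^+ 2).
Proof.
move=> wy; have d0 : y ^+ 2 - w ^+ 2 != 0 by rewrite subr_eq0 eq_sym.
have yn : y != 0 by rewrite gt_eqF.
have d1 t : is_derive t (1 : R)
    (fun t => (y ^+ 2 - w ^+ 2)^-1 * - (y * (cosc y t * sinc w t) - w * (sinc y t * cosc w t)))
    (sinc y t * sinc w t).
  apply: (is_derive_eq (isd_scale _ (isd_opp (isd_sub
    (isd_scale y (isd_mul (isd_cosc y c0 t) (isd_sinc w c0 t)))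
    (isd_scale w (isd_mul (isd_sinc y c0 t) (isd_cosc w c0 t))))))).
  by field.
have d2 t : is_derive t (1 : R)
    (fun t => (y ^+ 2 - w ^+ 2)^-1 * (y * (sinc y t * sinc w t) + w * (cosc y t * cosc w t)))
    (cosc y t * sinc w t).
  apply: (is_derive_eq (isd_scale _ (isd_add
    (isd_scale y (isd_mul (isd_sinc y c0 t) (isd_sinc w c0 t)))
    (isd_scale w (isd_mul (isd_cosc y c0 t) (isd_cosc w c0 t)))))).
  by field.
rewrite /sin_moment (duhamel_mul (k := y / (y ^+ 2 - w ^+ 2)) (@continuous_sinc _ w c0) d1 d2).
  by rewrite mulrA mulVf// mul1r mulrC.
move=> t; move: (sinc w t) (cosc w t) => S C.
have := trig1 (y * (t - c0)); move: (sinc y t) (cosc y t) => s c h.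
have gen X : X * (y * (s * S) + w * (c * C)) * s - X * - (y * (c * S) - w * (s * C)) * c
    = X * y * S * (s ^+ 2 + c ^+ 2) by ring.
by rewrite gen h; field.
Qed.

End Multiplier.
End Exchange.

Section Replace.
Context {R : realType}.
Local Notation leb := (@lebesgue_measure R).
Variables (a b : R) (ab : a < b).
Local Notation c0 := ((a + b) / 2).

Definition bessel_family (x : nat -> R) := forall f, square_integrable a b f ->
  exists B, l2_bound B (fun n => cos_moment a b (x n) f) (fun n => sin_moment a b (x n) f).

Let cos_momentD y f h : square_integrable a b f -> square_integrable a b h ->
  cos_moment a b y (fun t => f t + h t) = cos_moment a b y f + cos_moment a b y h.
Proof.
move=> hf hh; rewrite /cos_moment -RintegralD//;
  [|exact: square_integrable_mul hf (@continuous_cosc _ _ _)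
   |exact: square_integrable_mul hh (@continuous_cosc _ _ _)].
by apply: eq_Rintegral => t _; rewrite mulrDl.
Qed.

Let sin_momentD y f h : square_integrable a b f -> square_integrable a b h ->
  sin_moment a b y (fun t => f t + h t) = sin_moment a b y f + sin_moment a b y h.
Proof.
move=> hf hh; rewrite /sin_moment -RintegralD//;
  [|exact: square_integrable_mul hf (@continuous_sinc _ _ _)
   |exact: square_integrable_mul hh (@continuous_sinc _ _ _)].
by apply: eq_Rintegral => t _; rewrite mulrDl.
Qed.

Let cos_momentZ y c f : square_integrable a b f ->
  cos_moment a b y (fun t => c * f t) = c * cos_moment a b y f.
Proof.
move=> hf; rewrite /cos_moment -RintegralZl//;
  [|exact: square_integrable_mul hf (@continuous_cosc _ _ _)].
by apply: eq_Rintegral => t _; rewrite mulrA.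
Qed.

Let sin_momentZ y c f : square_integrable a b f ->
  sin_moment a b y (fun t => c * f t) = c * sin_moment a b y f.
Proof.
move=> hf; rewrite /sin_moment -RintegralZl//;
  [|exact: square_integrable_mul hf (@continuous_sinc _ _ _)].
by apply: eq_Rintegral => t _; rewrite mulrA.
Qed.

Let sin_lt (t : R) : 0 < t -> `|sin t| < t.
Proof.
move=> t0; rewrite ltr_norml; have [t1|t1] := ltP 1 t.
  rewrite (le_lt_trans (sin_le1 t) t1) andbT (lt_le_trans _ (sin_geN1 t))//.
  by rewrite ltrN2.
have tpi : t <= pi by have := pi_ge2 R; lra.
have s0 : 0 <= sin t by rewrite sin_ge0_pi// (ltW t0).
rewrite (lt_le_trans _ s0) ?oppr_lt0//=.
have ds x : x \in `]0, t[%R -> is_derive x (1 : R) sin (cos x).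
  by move=> _; exact: is_derive_sin.
have cs : {within `[0, t], continuous sin} by apply: continuous_subspaceT; exact: continuous_sin.
have [c] := MVT t0 ds cs; rewrite in_itv/= => /andP[ct0 ct]; rewrite sin0 !subr0 => ->.
rewrite -[ltRHS]mul1r ltr_pM2r// -(cos0 R) ltr_cos// in_itv/= ?lexx ?pi_ge0//.
by rewrite ltW//= (le_trans (ltW ct)).
Qed.

(* The moments of cos and sin at their own frequency do not vanish. *)
Let base (z u v : R) : 0 < z -> exists2 f, square_integrable a b f &
  cos_moment a b z f = u /\ sin_moment a b z f = v.
Proof.
move=> z0; have z2 : 2 * z != 0 by rewrite mulf_neq0// gt_eqF.
have L0 : 0 < b - a by rewrite subr_gt0.
pose s := sin (z * (b - a)) / z.
have : `|s| < b - a.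
  rewrite normrM normfV (gtr0_norm z0) ltr_pdivrMr// [ltRHS]mulrC.
  exact: sin_lt (mulr_gt0 z0 L0).
rewrite ltr_norml => /andP[sl su].
have i1 : leb.-integrable `[a, b] (EFin \o (fun=> 1 : R)).
  by apply: integ_continuous => t; exact: cvg_cst.
have ic2 := integ_continuous a b (@continuous_cosc _ (2 * z) c0).
have is2 := integ_continuous a b (@continuous_sinc _ (2 * z) c0).
have int1 : \int[leb]_(t in `[a, b]) (1 : R) = b - a.
  by rewrite Rintegral_itv_cst ?ltW// mul1r.
have int2 : \int[leb]_(t in `[a, b]) cos (2 * z * (t - c0)) = s.
  rewrite Rintegral_cosc// /s (_ : 2 * z * ((b - a) / 2) = z * (b - a)); last by field.
  by field; rewrite gt_eqF.
have e2 t : 2 * z * (t - c0) = z * (t - c0) + z * (t - c0) by ring.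
have mD : measurable (`[a, b]%classic : set (measurableTypeR R)) by exact: measurable_itv.
have cc : cos_moment a b z (fun t => cos (z * (t - c0))) = (b - a + s) / 2.
  rewrite /cos_moment (Rintegral_lincomb (c := 2^-1) (d := 2^-1) mD i1 ic2) ?int1 ?int2; first by lra.
  by move=> t; rewrite e2 cosD; have := cos2Dsin2 (z * (t - c0)); rewrite !expr2; lra.
have ss : sin_moment a b z (fun t => sin (z * (t - c0))) = (b - a - s) / 2.
  rewrite /sin_moment (Rintegral_lincomb (c := 2^-1) (d := - 2^-1) mD i1 ic2) ?int1 ?int2; first by lra.
  by move=> t; rewrite e2 cosD; have := cos2Dsin2 (z * (t - c0)); rewrite !expr2; lra.
have cs : cos_moment a b z (fun t => sin (z * (t - c0))) = 0.
  rewrite /cos_moment (Rintegral_lincomb (c := 2^-1) (d := 0) mD is2 is2) ?Rintegral_sinc ?mulr0 ?addr0//.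
  by move=> t; rewrite e2 sinD mul0r addr0; lra.
have sc : sin_moment a b z (fun t => cos (z * (t - c0))) = 0.
  rewrite /sin_moment (Rintegral_lincomb (c := 2^-1) (d := 0) mD is2 is2) ?Rintegral_sinc ?mulr0 ?addr0//.
  by move=> t; rewrite e2 sinD mul0r addr0; lra.
have hc := square_integrable_continuous a b (@continuous_cosc _ z c0).
have hs := square_integrable_continuous a b (@continuous_sinc _ z c0).
have hcu := square_integrableZ (u / ((b - a + s) / 2)) hc.
have hsv := square_integrableZ (v / ((b - a - s) / 2)) hs.
exists (fun t => u / ((b - a + s) / 2) * cos (z * (t - c0)) + v / ((b - a - s) / 2) * sin (z * (t - c0))).
  exact: square_integrableD.
rewrite cos_momentD// sin_momentD// !cos_momentZ// !sin_momentZ// cc ss cs sc !mulr0 addr0 add0r.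
by split; rewrite divfK// gt_eqF// divr_gt0//; lra.
Qed.

(** If f solves a moment problem with vanishing data at x_i, adding
    (z^2 - x_i^2) Q, where Q'' + x_i^2 Q = f, multiplies its moments at w by
    (z^2 - w^2) / (x_i^2 - w^2): they vanish at z instead of x_i, and the inverse
    factors at the other frequencies are bounded.  General data
    are reduced to this case by subtracting a function with the prescribed
    moments at z alone; the moments of that function are square-summable by
    Bessel's inequality. *)
Lemma interpolating_replace (x : nat -> R) (i : nat) (z d : R) :
  interpolating a b x -> bessel_family x -> 0 < x i -> 0 < z -> 0 < d ->
  (forall n, n != i -> x n ^+ 2 != x i ^+ 2) ->
  (forall n, n != i -> d <= `|z ^+ 2 - x n ^+ 2|) ->
  let x' := fun n => if n == i then z else x n in
  interpolating a b x' /\ bessel_family x'.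
Proof.
move=> hint hbes xi0 z0 d0 hsep hz x'.
have hbes' : bessel_family x'.
  move=> f hf; have [B hB] := hbes f hf.
  exists (B + (cos_moment a b z f ^+ 2 + sin_moment a b z f ^+ 2)) => N.
  apply: (@le_trans _ _ (\sum_(0 <= k < N) ((cos_moment a b (x k) f ^+ 2 + sin_moment a b (x k) f ^+ 2)
      + (k == i)%:R * (cos_moment a b z f ^+ 2 + sin_moment a b z f ^+ 2)))).
    apply: ler_sum => k _; rewrite /x'; case: eqVneq => [->|ki].
      by rewrite mul1r lerDr addr_ge0 ?sqr_ge0.
    by rewrite mul0r addr0.
  rewrite big_split/= lerD// -mulr_suml ler_piMl ?addr_ge0 ?sqr_ge0//.
  have [iN|Ni] := ltnP i N.
    rewrite (bigD1_seq i) ?mem_index_iota ?iota_uniq//= eqxx big1 ?addr0//.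
    by move=> k /negbTE ->.
  rewrite big_nat big1// => k /andP[_ kN]; rewrite (_ : (k == i) = false)//.
  by apply/negbTE; rewrite neq_ltn (leq_trans kN Ni).
split => //.
have [zx|zx] := eqVneq z (x i).
  suff -> : x' = x by [].
  by apply/funext => n; rewrite /x'; case: eqVneq => // ->.
have zx2 : z ^+ 2 != x i ^+ 2 by rewrite eqf_sqr negb_or zx/= gt_eqF// (lt_trans _ z0)// oppr_lt0.
pose C := 1 + `|x i ^+ 2 - z ^+ 2| / d.
have C0 : 0 <= C by rewrite addr_ge0// divr_ge0// ltW.
(* data vanishing at the new frequency *)
have vanishing u v B : l2_bound B u v -> u i = 0 -> v i = 0 ->
    exists2 f, square_integrable a b f & forall n,
    cos_moment a b (x' n) f = u n /\ sin_moment a b (x' n) f = v n.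
  move=> hB ui vi; pose r n := (x i ^+ 2 - x n ^+ 2) / (z ^+ 2 - x n ^+ 2).
  have rC n : n != i -> r n ^+ 2 <= C ^+ 2.
    move=> ni; rewrite -[leLHS](real_normK (num_real _)) ler_sqr ?nnegrE ?normr_ge0//.
    have dn := hz n ni; have q0 : z ^+ 2 - x n ^+ 2 != 0 by rewrite -normr_gt0 (lt_le_trans d0).
    rewrite /r (_ : x i ^+ 2 - x n ^+ 2 = (z ^+ 2 - x n ^+ 2) + (x i ^+ 2 - z ^+ 2)); last by ring.
    rewrite mulrDl divff// (le_trans (ler_normD _ _))// normr1 lerD2l normrM normfV.
    by rewrite ler_wpM2l// lef_pV2// posrE (lt_le_trans d0).
  have hB' : l2_bound (C ^+ 2 * B) (fun n => r n * u n) (fun n => r n * v n).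
    move=> N; apply: (@le_trans _ _ (\sum_(0 <= k < N) C ^+ 2 * (u k ^+ 2 + v k ^+ 2))).
      apply: ler_sum => k _; have [->|ki] := eqVneq k i.
        by rewrite ui vi !mulr0 expr0n addr0 mulr0.
      by rewrite [(r k * u k) ^+ 2]exprMn [(r k * v k) ^+ 2]exprMn -mulrDr ler_wpM2r ?addr_ge0 ?sqr_ge0 ?(rC k ki).
    by rewrite -mulr_sumr ler_wpM2l ?sqr_ge0.
  have [f hf hm] := hint _ _ _ hB'.
  have [fc fs] : cos_moment a b (x i) f = 0 /\ sin_moment a b (x i) f = 0.
    by have [-> ->] := hm i; rewrite ui vi !mulr0.
  pose Q := duhamel a b (x i) f.
  have hQ : square_integrable a b Q by exact: square_integrable_duhamel.
  have hcQ := square_integrableZ (z ^+ 2 - x i ^+ 2) hQ.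
  exists (fun t => f t + (z ^+ 2 - x i ^+ 2) * Q t); first exact: square_integrableD.
  have key w : w ^+ 2 != x i ^+ 2 -> 
      cos_moment a b w (fun t => f t + (z ^+ 2 - x i ^+ 2) * Q t) =
        (z ^+ 2 - w ^+ 2) / (x i ^+ 2 - w ^+ 2) * cos_moment a b w f /\
      sin_moment a b w (fun t => f t + (z ^+ 2 - x i ^+ 2) * Q t) =
        (z ^+ 2 - w ^+ 2) / (x i ^+ 2 - w ^+ 2) * sin_moment a b w f.
    move=> wx; have wx' : x i ^+ 2 - w ^+ 2 != 0 by rewrite subr_eq0 eq_sym.
    rewrite cos_momentD// sin_momentD// cos_momentZ// sin_momentZ//.
    rewrite cos_moment_duhamel// sin_moment_duhamel//.
    by split; field.
  move=> n; rewrite /x'; case: (eqVneq n i) => [->|ni].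
    by have [-> ->] := key z zx2; rewrite subrr mul0r !mul0r ui vi.
  have [-> ->] := key (x n) (hsep n ni); have [-> ->] := hm n.
  have dn := hz n ni; have q0 : z ^+ 2 - x n ^+ 2 != 0 by rewrite -normr_gt0 (lt_le_trans d0).
  have q1 : x i ^+ 2 - x n ^+ 2 != 0 by rewrite subr_eq0 eq_sym hsep.
  by rewrite /r; split; field; rewrite q0 q1.
move=> u v B hB; have [h hh [hu hv]] := base (u i) (v i) z0.
have [B' hB'] := hbes' h hh.
have [|||f hf hm] := @vanishing (fun n => u n - cos_moment a b (x' n) h)
   (fun n => v n - sin_moment a b (x' n) h) (2 * B + 2 * B').
- move=> N; apply: (@le_trans _ _ (\sum_(0 <= k < N) (2 * (u k ^+ 2 + v k ^+ 2)
     + 2 * (cos_moment a b (x' k) h ^+ 2 + sin_moment a b (x' k) h ^+ 2)))).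
    apply: ler_sum => k _; have := sqr_ge0 (u k + cos_moment a b (x' k) h).
    have := sqr_ge0 (v k + sin_moment a b (x' k) h); rewrite !expr2; lra.
  by rewrite big_split/= -!mulr_sumr lerD// ler_wpM2l.
- by rewrite /x' eqxx hu subrr.
- by rewrite /x' eqxx hv subrr.
exists (fun t => f t + h t); first exact: square_integrableD.
move=> n; rewrite cos_momentD// sin_momentD//; have [-> ->] := hm n.
by rewrite !subrK.
Qed.

End Replace.

(** * The moment problem under an asymptotic gap *)

Section Asymptotic_gap.
Context {R : realType}.
Local Notation leb := (@lebesgue_measure R).

(** The addition formulas for cos and sin. *)
Lemma moment_rotation (a b y : R) (f : R -> R) : square_integrable a b f ->
  let c := (a + b) / 2 in
  let C := \int[leb]_(t in `[a, b]) (f t * cos (y * t)) in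
  let S := \int[leb]_(t in `[a, b]) (f t * sin (y * t)) in
  cos_moment a b y f = cos (y * c) * C + sin (y * c) * S /\
  sin_moment a b y f = cos (y * c) * S + (- sin (y * c)) * C.
Proof.
move=> hf c C S; have mD : measurable (`[a, b]%classic : set (measurableTypeR R)) by exact: measurable_itv.
have e t : y * (t - c) = y * t - y * c by ring.
have ic : leb.-integrable `[a, b] (EFin \o (fun t => f t * cos (y * t))).
  have := square_integrable_mul hf (@continuous_cosc _ y 0).
  by rewrite (_ : (fun t => f t * cos (y * (t - 0))) = (fun t => f t * cos (y * t)))//; apply/funext => z; rewrite subr0.
have is_ : leb.-integrable `[a, b] (EFin \o (fun t => f t * sin (y * t))).
  have := square_integrable_mul hf (@continuous_sinc _ y 0).
  by rewrite (_ : (fun t => f t * sin (y * (t - 0))) = (fun t => f t * sin (y * t)))//; apply/funext => z; rewrite subr0.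
split.
  rewrite /cos_moment (Rintegral_lincomb (c := cos (y * c)) (d := sin (y * c)) mD ic is_)// => t.
  by rewrite e cosB; ring.
rewrite /sin_moment (Rintegral_lincomb (c := cos (y * c)) (d := - sin (y * c)) mD is_ ic)// => t.
by rewrite e sinB; ring.
Qed.

Lemma well_spaced_bessel (a b g : R) (x : nat -> R) : 0 < g -> well_spaced g x ->
  bessel_family a b x.
Proof.
move=> g0 hx f hf; have T0 : 0 < `|a| + `|b| + 1.
  by rewrite ltr_wpDl// addr_ge0.
have [K K0 hK] := bessel_inequality T0 g0 hx.
exists (K * \int[leb]_(t in `[a, b]) f t ^+ 2) => N.
have := hK a b f _ _ hf N; have := ler_norm b; have := ler_norm (- a); rewrite normrN.
have := normr_ge0 a; have := normr_ge0 b => b0 a0 ha hb h.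
apply: le_trans (h _ _); [|lra|lra].
apply: ler_sum => n _; have [-> ->] := moment_rotation (x n) hf.
have := cos2Dsin2 (x n * ((a + b) / 2)).
set C := cos _; set S := sin _; set u := \int[_]_(_ in _) _; set v := \int[_]_(_ in _) _ => e.
have -> : (C * u + S * v) ^+ 2 + (C * v + - S * u) ^+ 2 = (C ^+ 2 + S ^+ 2) * (u ^+ 2 + v ^+ 2) by ring.
by rewrite e mul1r.
Qed.

Let avoid (s : seq R) (l u : R) : l < u -> exists2 x, l < x < u & x \notin s.
Proof.
elim: s l u => [|h s ih] l u lu.
  by exists ((l + u) / 2) => //; rewrite !midf_lt.
have [/andP[lh hu]|nh] := boolP (l < h < u).
  have [x /andP[lx xh] xs] := ih l h lh.
  exists x; first by rewrite lx (lt_trans xh).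
  by rewrite inE negb_or lt_eqF.
have [x lxu xs] := ih l u lu; exists x => //.
by rewrite inE negb_or xs andbT; apply: contraNneq nh => <-.
Qed.

Let finite_lb (f : nat -> R) (P : pred nat) N :
  (forall n, (n < N)%N -> P n -> 0 < f n) ->
  exists2 d, 0 < d & forall n, (n < N)%N -> P n -> d <= f n.
Proof.
elim: N => [|N ih] hf; first by exists 1.
have [|d d0 hd] := ih; first by move=> n nN; apply: hf; exact: ltnW.
have [PN|nP] := boolP (P N).
  exists (Num.min d (f N)); first by rewrite lt_min d0 hf.
  move=> n; rewrite ltnS leq_eqVlt => /predU1P[->|nN] Pn.
    by rewrite ge_min lexx orbT.
  by rewrite ge_min hd.
exists d => // n; rewrite ltnS leq_eqVlt => /predU1P[->|nN] Pn; last exact: hd.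
by rewrite Pn in nP.
Qed.

(** The first N frequencies are replaced by g' (k + 1/2), with N so large that
    the new sequence is well spaced with a gap g' > 2 pi / (b - a).  Choosing
    g' outside a finite set keeps the new frequencies different from all the
    true ones, which the exchange requires. *)
Lemma interpolating_asymptotic_gap (a b g0 g : R) (om : nat -> R) : a < b ->
  0 < om 0%N -> 0 < g0 -> (forall k, om k + g0 <= om k.+1) ->
  (exists N, forall k, (N <= k)%N -> om k + g <= om k.+1) ->
  2 * (pi / (b - a)) < g -> interpolating a b om.
Proof.
move=> ab om0 g0_gt0 hgap [N0 hN0] hg.
pose p := pi / (b - a); have p0 : 0 < p by rewrite divr_gt0 ?pi_gt0 ?subr_gt0.
rewrite -/p in hg.
have om_lt m n : (m < n)%N -> om m < om n.
  elim: n => // n ih; rewrite ltnS leq_eqVlt => /predU1P[->|/ih].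
    by rewrite (lt_le_trans _ (hgap n))// ltrDl.
  by move/lt_trans; apply; rewrite (lt_le_trans _ (hgap n))// ltrDl.
have om_pos n : 0 < om n by case: n => // n; exact: lt_trans om0 (om_lt 0%N n.+1 isT).
pose g2 := (2 * p + g) / 2; have g2g : g2 < g by rewrite /g2; lra.
have pg2 : 2 * p < g2 by rewrite /g2; lra.
have g_pos : 0 < g by lra.
have [N hN] : exists N, (N0 <= N)%N /\ g2 * (N%:R + 1 / 2) <= om N.
  have om_ge i : g * i%:R <= om (N0 + i)%N.
    elim: i => [|i ih]; first by rewrite mulr0 addn0 ltW.
    have := hN0 (N0 + i)%N (leq_addr _ _); rewrite addnS -natr1 mulrDr mulr1; lra.
  pose A := g2 * (N0%:R + 1 / 2) / (g - g2).
  exists (N0 + (Num.truncn A).+1)%N; split; first exact: leq_addr.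
  apply: le_trans (om_ge _).
  have := truncnS_gt A; set i := _.+1 => hi.
  have : g2 * (N0%:R + 1 / 2) <= i%:R * (g - g2) by rewrite -ler_pdivrMr ?subr_gt0// ltW.
  rewrite natrD; lra.
(* the values of g' for which a new frequency would coincide with a true one *)
pose bad := [seq om k / (i%:R + 1 / 2) | k <- iota 0 N, i <- iota 0 N].
have [g' /andP[pg' g'g2] g'bad] := avoid bad pg2.
have g'0 : 0 < g' by lra.
have half n : 0 < n%:R + 1 / 2 :> R by rewrite ltr_wpDl// divr_gt0.
have g'N : g' * (N%:R + 1 / 2) <= om N.
  by apply: le_trans hN.2; rewrite ler_wpM2r ?ltW.
have fake_om i k : (i < N)%N -> (k < N)%N -> g' * (i%:R + 1 / 2) != om k.
  move=> iN kN; apply: contraNneq g'bad => e; apply/allpairsP; exists (k, i) => /=.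
  by rewrite !mem_iota; split=> //; rewrite -e mulfK// gt_eqF.
(* the sequence after m exchanges *)
pose y m k := if (k < m)%N then om k else if (k < N)%N then g' * (k%:R + 1 / 2) else om k.
have y_pos m k : 0 < y m k by rewrite /y; case: ifP => // _; case: ifP => // _; rewrite mulr_gt0.
have ws : well_spaced g' (y 0%N).
  rewrite /well_spaced /y /=; split.
    case: ifPn => [_|N00]; first by rewrite add0r; lra.
    by move: g'N; move: N00; rewrite -eqn0Ngt => /eqP ->; rewrite add0r; lra.
  move=> k; have [kN|Nk] := ltnP k N.
    have [k1N|Nk1] := ltnP k.+1 N; first by rewrite -natr1; lra.
    have -> : k.+1 = N by apply/eqP; rewrite eqn_leq kN Nk1.
    by apply: le_trans g'N; have -> : N = k.+1 by [apply/eqP; rewrite eqn_leq kN Nk1]; rewrite -natr1; lra.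
  rewrite ltnNge (leqW Nk)/=; apply: le_trans (hN0 k (leq_trans hN.1 Nk)); lra.
suff H m : (m <= N)%N -> interpolating a b (y m) /\ bessel_family a b (y m).
  have [h _] := H N (leqnn N); suff <- : y N = om by [].
  by apply/funext => k; rewrite /y; case: (k < N)%N.
elim: m => [_|m ih mN].
  split; last exact: (well_spaced_bessel g'0 ws).
  apply: (well_spaced_interpolating ab (s := g' / (2 * p)) _ _ ws).
    by rewrite ltr_pdivlMr ?mul1r// mulr_gt0.
  by rewrite -/p mulrC divfK// gt_eqF// mulr_gt0.
have [hint hbes] := ih (ltnW mN).
have ym : y m m = g' * (m%:R + 1 / 2) by rewrite /y ltnn mN.
have neq_om n : n != m -> y m n != om m.
  move=> nm; rewrite /y; case: ifPn => [nlt|nge]; first by rewrite lt_eqF// om_lt.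
  case: ifPn => [nN|Nn]; first exact: fake_om.
  by rewrite gt_eqF// om_lt// ltn_neqAle eq_sym nm leqNgt.
have neq_fake n : n != m -> y m n != y m m.
  move=> nm; rewrite ym /y; case: ifPn => [nlt|nge].
    by rewrite eq_sym fake_om// (ltn_trans nlt).
  case: ifPn => [nN|Nn].
    have g'n : g' != 0 by rewrite gt_eqF.
    by rewrite (inj_eq (mulfI g'n)) (inj_eq (addIr _)) eqr_nat.
  have h1 : g' * (m%:R + 1 / 2) < om N.
    by apply: lt_le_trans g'N; rewrite ltr_pM2l// ltrD2r ltr_nat.
  rewrite gt_eqF// (lt_le_trans h1)//; rewrite -leqNgt leq_eqVlt in Nn.
  by case/predU1P: Nn => [->//|/om_lt/ltW].
have sqr_neq (u v : R) : 0 < u -> 0 < v -> u != v -> u ^+ 2 != v ^+ 2.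
  by move=> u0 v0 uv; rewrite eqf_sqr negb_or uv/= gt_eqF// (lt_trans _ u0)// oppr_lt0.
have [|d1 d10 hd1] := @finite_lb (fun n => `|om m ^+ 2 - y m n ^+ 2|) (fun n => n != m) N.
  move=> n _ nm; rewrite normr_gt0 subr_eq0 eq_sym.
  exact: sqr_neq (neq_om n nm).
pose d2 := om N ^+ 2 - om m ^+ 2.
have d20 : 0 < d2 by rewrite subr_gt0 ltr_sqr ?nnegrE ?ltW ?om_lt.
have [|||||h1 h2] := @interpolating_replace _ a b ab (y m) m (om m) (Num.min d1 d2) hint hbes => //.
- by rewrite lt_min d10.
- by move=> n nm; exact: sqr_neq (neq_fake n nm).
- move=> n nm; rewrite ge_min; have [nN|Nn] := ltnP n N; first by rewrite hd1.
    have -> : y m n = om n by rewrite /y ltnNge (leq_trans (ltnW mN) Nn)/= ltnNge Nn.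
    have oNn : om N <= om n by move: Nn; rewrite leq_eqVlt => /predU1P[->//|/om_lt/ltW].
  have sq : om N ^+ 2 <= om n ^+ 2.
    by rewrite ler_sqr// nnegrE; apply: ltW; exact: om_pos.
  apply/orP; right; rewrite distrC; apply: le_trans (ler_norm _).
  by rewrite /d2 lerB.
suff -> : y m.+1 = (fun n => if n == m then om m else y m n) by [].
by apply/funext => n; rewrite /y ltnS leq_eqVlt; case: eqVneq => [->|nm].
Qed.

End Asymptotic_gap.

Local Open Scope complex_scope.
Local Notation Re := (@complex.Re _).
Local Notation Im := (@complex.Im _).

(** * Dominated convergence for series *)

Section Tannery.
Context {R : realType}.

Lemma l1_tail (c : nat -> R) (B e : R) : (forall k, 0 <= c k) ->
  (forall N, \sum_(0 <= k < N) c k <= B) -> 0 < e ->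
  exists N, forall M, (N <= M)%N -> \sum_(N <= k < M) c k <= e.
Proof.
move=> c0 hB e0; pose S N := \sum_(0 <= k < N) c k.
have nd : nondecreasing_seq S.
  by apply/nondecreasing_seqP => n; rewrite /S big_nat_recr//= lerDl.
have cS : cvgn S by apply: nondecreasing_is_cvgn => //; exists B => _ [n _ <-]; exact: hB.
have : \forall N \near \oo, `|limn S - S N| < e by move/cvgrPdist_lt : cS; exact.
move=> [N _ hN]; exists N => M NM.
have := hN N (leqnn N); rewrite ltr_norml => /andP[_ h].
have hM : S M <= limn S by exact: nondecreasing_cvgn_le.
have : S M = S N + \sum_(N <= k < M) c k by rewrite /S -big_cat_nat.
lra.
Qed.

Lemma cvg_e0 (I : Type) (F : set_system I) {FF : Filter F} (h : I -> \bar R) :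
  (forall i, (0 <= h i)%E) -> (forall e, 0 < e -> \forall i \near F, (h i <= e%:E)%E) ->
  h i @[i --> F] --> 0%E.
Proof.
move=> h0 he; apply: cvg_EFin.
  apply: filterS (he 1 ltr01) => i hi; rewrite ge0_fin_numE//.
  exact: le_lt_trans hi (ltry _).
apply/cvgr0Pnorm_le => e e0; apply: filterS (he e e0) => i hi /=.
rewrite ger0_norm ?fine_ge0// -lee_fin fineK// ge0_fin_numE//.
exact: le_lt_trans hi (ltry _).
Qed.

Lemma cvg_sum0 (I : Type) (F : set_system I) {FF : Filter F} (p : nat -> I -> R) N :
  (forall k, p k i @[i --> F] --> 0) -> \sum_(0 <= k < N) p k i @[i --> F] --> 0.
Proof.
move=> hp; elim: N => [|N ih].
  by rewrite (_ : (fun i => _) = fun=> 0); [exact: cvg_cst|apply/funext => i; rewrite big_geq].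
rewrite (_ : (fun i => _) = fun i => \sum_(0 <= k < N) p k i + p N i); last first.
  by apply/funext => i; rewrite big_nat_recr.
by rewrite -[X in _ --> X](addr0 0); apply: cvgD.
Qed.

(** Dominated convergence to 0 for series of nonnegative terms. *)
Lemma nneseries_cvg0 (I : Type) (F : set_system I) {FF : Filter F}
    (p : nat -> I -> R) (c : nat -> R) (B : R) :
  (forall k i, 0 <= p k i) -> (forall N, \sum_(0 <= k < N) c k <= B) ->
  (\forall i \near F, forall k, p k i <= c k) ->
  (forall k, p k i @[i --> F] --> 0) ->
  (\sum_(0 <= k <oo) (p k i)%:E)%E @[i --> F] --> 0%E.
Proof.
move=> p0 hB pc hp; apply: cvg_e0 => [i|e e0].
  by apply: nneseries_ge0 => k _ _; rewrite lee_fin.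
have e2 : 0 < e / 2 by rewrite divr_gt0.
have [c0|nc] := pselect (forall k, 0 <= c k); last first.
  apply: filterS pc => i hi; exfalso; apply: nc => k.
  exact: le_trans (p0 k i) (hi k).
have [N hN] := l1_tail c0 hB e2.
have hfin : \sum_(0 <= k < N) p k i @[i --> F] --> 0 by exact: cvg_sum0.
have : \forall i \near F, \sum_(0 <= k < N) p k i < e / 2 by exact: (cvgr_lt _ hfin _ e2).
apply: filterS2 pc => i hi hs; apply: nneseries_le_bound => // M.
apply: (@le_trans _ _ (\sum_(0 <= k < maxn N M) p k i)).
  rewrite [leRHS](big_cat_nat (n := M)) ?leq_maxr//= lerDl.
  by apply: sumr_ge0 => k _.
rewrite (big_cat_nat (n := N)) ?leq_maxl//=.
have : \sum_(N <= k < maxn N M) p k i <= \sum_(N <= k < maxn N M) c k.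
  by apply: ler_sum => k _.
have := hN (maxn N M) (leq_maxl _ _); lra.
Qed.

Lemma partial_sum_le (u : nat -> R) (e : R) : (forall k, 0 <= u k) ->
  (\sum_(0 <= k <oo) (u k)%:E <= e%:E)%E -> forall N, \sum_(0 <= k < N) u k <= e.
Proof.
move=> u0 ue N; rewrite -lee_fin -sumEFin; apply: le_trans ue.
by apply: nneseries_lim_ge => k _ _; rewrite lee_fin.
Qed.

Lemma abs_cvg_series (u : nat -> R) (B : R) :
  (forall N, \sum_(0 <= k < N) `|u k| <= B) -> cvgn (series u).
Proof.
move=> hB; apply: normed_cvg; apply: nondecreasing_is_cvgn.
  by apply/nondecreasing_seqP => n; rewrite /series /=; rewrite [leRHS]big_nat_recr//= lerDl.
by exists B => _ [n _ <-]; exact: hB.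
Qed.

(** The tails of all the series are at most the tail of the dominating one, so
    that only finite sums have to converge. *)
Lemma tannery (I : Type) (F : set_system I) {FF : ProperFilter F}
    (p : nat -> I -> R) (c l : nat -> R) (B : R) :
  (forall N, \sum_(0 <= k < N) c k <= B) ->
  (forall k i, `|p k i| <= c k) ->
  (forall k, p k i @[i --> F] --> l k) ->
  limn (series (p ^~ i)) @[i --> F] --> limn (series l).
Proof.
move=> hB pc hp.
have c0 k : 0 <= c k.
  have [i _] := @filter_ex _ _ FF setT filterT.
  exact: le_trans (pc k i).
have lc k : `|l k| <= c k.
  rewrite -(cvg_lim _ (cvg_norm (hp k)))//; apply: limr_le.
    by apply/cvg_ex; exists `|l k|; exact: cvg_norm (hp k).
  by apply: nearW => i.
have cp i : cvgn (series (p ^~ i)).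
  by apply: (@abs_cvg_series _ B) => N; rewrite (le_trans _ (hB N))//; exact: ler_sum.
have cl : cvgn (series l).
  by apply: (@abs_cvg_series _ B) => N; rewrite (le_trans _ (hB N))//; exact: ler_sum.
apply/cvgrPdist_le => e e0; have e4 : 0 < e / 4 by rewrite divr_gt0.
have [N hN] := l1_tail c0 hB e4.
have tail (u : nat -> R) : (forall k, `|u k| <= c k) -> cvgn (series u) ->
    `|limn (series u) - \sum_(0 <= k < N) u k| <= e / 4.
  move=> uc cu.
  have h : (fun M => `|series u M - \sum_(0 <= k < N) u k|) @ \oo --> `|limn (series u) - \sum_(0 <= k < N) u k|.
    by apply: cvg_norm; apply: cvgB; [exact: cu|exact: cvg_cst].
  rewrite -(cvg_lim _ h)//; apply: limr_le; first by apply/cvg_ex; eexists; exact: h.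
  exists N => // M /= NM; rewrite /series/= (big_cat_nat (n := N))//= addrAC subrr add0r.
  by apply: (le_trans (ler_norm_sum _ _ _)); apply: le_trans (hN M NM); exact: ler_sum.
have hfin : \sum_(0 <= k < N) (p k i - l k) @[i --> F] --> 0.
  apply: (cvg_sum0 (p := fun k i => p k i - l k)) => k.
  by rewrite -(subrr (l k)); apply: cvgB; [exact: hp|exact: cvg_cst].
have : \forall i \near F, `|\sum_(0 <= k < N) (p k i - l k)| <= e / 4.
  by move/cvgr0Pnorm_le : hfin; exact.
apply: filterS => i; rewrite sumrB => hi.
have t1 := tail _ lc cl; have t2 := tail _ (pc ^~ i) (cp i).
move: t1 t2 hi; rewrite !ler_norml.
by move=> /andP[? ?] /andP[? ?] /andP[? ?]; apply/andP; split; lra.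
Qed.

End Tannery.

(** * Complex series and spectral spaces *)

Section Complex_series.
Context {R : realType}.
Implicit Types (u v : nat -> R[i]) (z w : R[i]).

Lemma sqrmod_ge0 z : 0 <= sqrmod z. Proof. by rewrite addr_ge0 ?sqr_ge0. Qed.

Lemma sqrmodD_le z w : sqrmod (z + w) <= 2 * sqrmod z + 2 * sqrmod w.
Proof.
case: z w => [a b] [c d]; rewrite /sqrmod /=.
have := sqr_ge0 (a - c); have := sqr_ge0 (b - d); lra.
Qed.

Lemma sqrmodM z w : sqrmod (z * w) = sqrmod z * sqrmod w.
Proof. by case: z w => [a b] [c d]; rewrite /sqrmod /=; simpc => /=; ring. Qed.

Lemma sqrmod_realM (r : R) z : sqrmod (r%:C * z) = r ^+ 2 * sqrmod z.
Proof. by rewrite sqrmodM; congr (_ * _); rewrite /sqrmod /= expr0n addr0. Qed.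

Lemma sqrmodN z : sqrmod (- z) = sqrmod z.
Proof. by case: z => a b; rewrite /sqrmod /= !sqrrN. Qed.

Lemma sqrmod0 : sqrmod (0 : R[i]) = 0.
Proof. by rewrite /sqrmod /= expr0n addr0. Qed.

Lemma Re_realM (r : R) z : Re (r%:C * z) = r * Re z.
Proof. by case: z => a b; rewrite /real_complex_def; simpc. Qed.
Lemma Im_realM (r : R) z : Im (r%:C * z) = r * Im z.
Proof. by case: z => a b; rewrite /real_complex_def; simpc. Qed.
Lemma ReD z w : Re (z + w) = Re z + Re w. Proof. by case: z w => [a b] []. Qed.
Lemma ImD z w : Im (z + w) = Im z + Im w. Proof. by case: z w => [a b] []. Qed.
Lemma ReB z w : Re (z - w) = Re z - Re w. Proof. by case: z w => [a b] []. Qed.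
Lemma ImB z w : Im (z - w) = Im z - Im w. Proof. by case: z w => [a b] []. Qed.
Lemma ReM z w : Re (z * w) = Re z * Re w - Im z * Im w.
Proof. by case: z w => [a b] []. Qed.
Lemma ImM z w : Im (z * w) = Re z * Im w + Im z * Re w.
Proof. by case: z w => [a b] []. Qed.
Lemma complexP z w : Re z = Re w -> Im z = Im w -> z = w.
Proof. by case: z w => [a b] [c d] /= -> ->. Qed.

Lemma Re_mul_conj_le z w : `|Re (z * conjc w)| <= (sqrmod z + sqrmod w) / 2.
Proof.
case: z w => [a b] [c d]; rewrite /sqrmod ReM /= ler_norml; apply/andP; split.
  have := sqr_ge0 (a + c); have := sqr_ge0 (b + d); lra.
have := sqr_ge0 (a - c); have := sqr_ge0 (b - d); lra.
Qed.

Lemma Im_mul_conj_le z w : `|Im (z * conjc w)| <= (sqrmod z + sqrmod w) / 2.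
Proof.
case: z w => [a b] [c d]; rewrite /sqrmod ImM /= ler_norml; apply/andP; split.
  have := sqr_ge0 (a - d); have := sqr_ge0 (b + c); lra.
have := sqr_ge0 (a + d); have := sqr_ge0 (b - c); lra.
Qed.


Definition csummable u := cvgn (series (Re \o u)) /\ cvgn (series (Im \o u)).

Lemma csummable_bounded u (c : nat -> R) (B : R) :
  (forall N, \sum_(0 <= k < N) c k <= B) ->
  (forall k, `|Re (u k)| <= c k /\ `|Im (u k)| <= c k) -> csummable u.
Proof.
move=> hB uc; split; apply: (@abs_cvg_series _ _ B) => N;
  apply: le_trans (hB N); apply: ler_sum => k _; have [] := uc k => //.
Qed.

Lemma csumD u v : csummable u -> csummable v ->
  csummable (fun k => u k + v k) /\ csum (fun k => u k + v k) = csum u + csum v.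
Proof.
move=> [ur ui] [vr vi].
have er : Re \o (fun k => u k + v k) = (Re \o u) \+ (Re \o v) by apply/funext => k /=; rewrite ReD.
have ei : Im \o (fun k => u k + v k) = (Im \o u) \+ (Im \o v) by apply/funext => k /=; rewrite ImD.
split; first by split; rewrite ?er ?ei; exact: is_cvg_seriesD.
by rewrite /csum er ei !lim_seriesD.
Qed.

Lemma csumZ u (c : R[i]) : csummable u ->
  csummable (fun k => c * u k) /\ csum (fun k => c * u k) = c * csum u.
Proof.
move=> [ur ui].
have er : Re \o (fun k => c * u k) = (Re c *: (Re \o u)) \+ (- Im c *: (Im \o u)).
  by apply/funext => k /=; rewrite ReM -mulNr.
have ei : Im \o (fun k => c * u k) = (Re c *: (Im \o u)) \+ (Im c *: (Re \o u)).
  by apply/funext => k /=; rewrite ImM.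
split; first by split; rewrite ?er ?ei; apply: is_cvg_seriesD; exact: is_cvg_seriesZ.
rewrite /csum er ei !lim_seriesD; try exact: is_cvg_seriesZ.
by rewrite !lim_seriesZ//; apply: complexP; rewrite ?ReM ?ImM /GRing.scale/= ?mulNr.
Qed.

Lemma csum_conj u : csummable u ->
  csummable (fun k => conjc (u k)) /\ csum (fun k => conjc (u k)) = conjc (csum u).
Proof.
move=> [ur ui].
have er : Re \o (fun k => conjc (u k)) = Re \o u by apply/funext => k /=; case: (u k).
have ei : Im \o (fun k => conjc (u k)) = (-1) *: (Im \o u).
  by apply/funext => k /=; transitivity (-1 * Im (u k)); [case: (u k) => a b /=; rewrite mulN1r|].
split; first by split; rewrite ?er ?ei; [|exact: is_cvg_seriesZ].
by rewrite /csum er ei lim_seriesZ//= /GRing.scale/= mulN1r.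
Qed.

Lemma csum_single n z : csum (fun k => if k == n then z else 0) = z.
Proof.
have lim1 (r : nat -> R) : (forall k, k != n -> r k = 0) -> limn (series r) = r n.
  move=> hr; apply/cvg_lim => //; apply/cvgrPdist_lt => e e0; exists n.+1 => // N /= nN.
  rewrite /series/= (bigD1_seq n)/= ?mem_index_iota ?iota_uniq//.
  by rewrite big1 ?addr0 ?subrr ?normr0.
rewrite /csum lim1 ?lim1 /= ?eqxx; first by case: z.
- by move=> k /negPf ->.
- by move=> k /negPf ->.
Qed.

Lemma csum0 (u : nat -> R[i]) : (forall k, u k = 0) -> csum u = 0.
Proof.
move=> u0; rewrite -[RHS](csum_single 0); congr csum; apply/funext => k.
by rewrite u0; case: ifP.
Qed.

Lemma conjc_mul_real (z : R[i]) (r : R) : conjc (z * r%:C) = r%:C * conjc z.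
Proof. by case: z => x y; apply: complexP; rewrite /real_complex_def /=; ring. Qed.

Lemma ReN z : Re (- z) = - Re z. Proof. by case: z. Qed.
Lemma ImN z : Im (- z) = - Im z. Proof. by case: z. Qed.

End Complex_series.

Section Spectral_space.
Context {R : realType} (lam : nat -> R) (lam0 : forall k, 0 < lam k).
Local Notation coefs := (nat -> R[i]).
Implicit Types (a c : coefs) (s : R).

Let term_ge0 s a k : 0 <= lam k `^ s * sqrmod (a k).
Proof. by rewrite mulr_ge0 ?powR_ge0 ?sqrmod_ge0. Qed.

Lemma HspaceP s a : Hspace lam s a <->
  exists B, forall N, \sum_(0 <= k < N) lam k `^ s * sqrmod (a k) <= B.
Proof.
split=> [/(nneseries_bound (term_ge0 s a))[B _ hB]|[B hB]]; first by exists B.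
exact: le_lt_trans (nneseries_le_bound (term_ge0 s a) hB) (ltry _).
Qed.

Lemma Hspace_le s a (p : nat -> R) (B : R) :
  (forall N, \sum_(0 <= k < N) p k <= B) ->
  (forall k, lam k `^ s * sqrmod (a k) <= p k) -> Hspace lam s a.
Proof.
move=> hB hp; apply/HspaceP; exists B => N.
by apply: le_trans (hB N); apply: ler_sum.
Qed.

Lemma HspaceD s a c : Hspace lam s a -> Hspace lam s c ->
  Hspace lam s (fun k => a k + c k).
Proof.
move=> /HspaceP[A hA] /HspaceP[C hC].
apply: (@Hspace_le _ _ (fun k => 2 * (lam k `^ s * sqrmod (a k)) + 2 * (lam k `^ s * sqrmod (c k))) (2 * A + 2 * C)).
  move=> N; rewrite big_split -!mulr_sumr/=; have := hA N; have := hC N; lra.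
move=> k; rewrite [leRHS](_ : _ = lam k `^ s * (2 * sqrmod (a k) + 2 * sqrmod (c k))).
  by rewrite ler_wpM2l ?powR_ge0 ?sqrmodD_le.
by ring.
Qed.

Lemma HspaceN s a : Hspace lam s a -> Hspace lam s (fun k => - a k).
Proof. by move=> /HspaceP[A hA]; apply: (Hspace_le hA) => k; rewrite sqrmodN. Qed.

Lemma sqnormH_ge0 s a : (0 <= sqnormH lam s a)%E.
Proof. by apply: nneseries_ge0 => k _ _; rewrite lee_fin. Qed.

Lemma Hspace_single s n (z : R[i]) : Hspace lam s (fun k => if k == n then z else 0).
Proof.
apply/HspaceP; exists (lam n `^ s * sqrmod z) => N.
apply: (@le_trans _ _ (\sum_(0 <= k < N.+1 + n.+1) lam k `^ s * sqrmod (if k == n then z else 0))).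
  rewrite [leRHS](big_cat_nat (n := N))//=; last by lia.
  by rewrite lerDl; apply: sumr_ge0 => k _; exact: (term_ge0 s (fun k => if k == n then z else 0)).
have hn : n \in index_iota 0 (N.+1 + n.+1) by rewrite mem_index_iota; lia.
rewrite (bigD1_seq n hn (iota_uniq _ _)) /=.
rewrite eqxx big1 ?addr0// => k /negPf ->; by rewrite sqrmod0 mulr0.
Qed.

Lemma innerH_summable s a c : Hspace lam s a -> Hspace lam s c ->
  csummable (fun k => (lam k `^ s)%:C * a k * conjc (c k)).
Proof.
move=> /HspaceP[A hA] /HspaceP[C hC].
apply: (@csummable_bounded _ _ (fun k => (lam k `^ s * sqrmod (a k) + lam k `^ s * sqrmod (c k)) / 2) ((A + C) / 2)).
  move=> N; rewrite -mulr_suml big_split/=; have := hA N; have := hC N; lra.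
move=> k; rewrite -mulrA Re_realM Im_realM !normrM (ger0_norm (powR_ge0 _ _)).
rewrite -mulrDr -mulrA; split; apply: ler_wpM2l; rewrite ?powR_ge0//.
  exact: Re_mul_conj_le.
exact: Im_mul_conj_le.
Qed.

Lemma innerH_single s a n (z : R[i]) :
  innerH lam s a (fun k => if k == n then z else 0) = (lam n `^ s)%:C * a n * conjc z.
Proof.
rewrite -[RHS](csum_single n); congr csum; apply/funext => k.
case: eqP => [-> //|_]; rewrite (_ : conjc 0 = 0) ?mulr0//.
by rewrite /conjc/= oppr0.
Qed.

End Spectral_space.

(** * Energy of the free waves *)

Section Wave_energy.
Context {R : realType} (lam : nat -> R) (lam0 : forall k, 0 < lam k) (s : R).
Local Notation coefs := (nat -> R[i]).
Local Notation state := ((nat -> R[i]) * (nat -> R[i]))%type.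
Local Notation om k := (Num.sqrt (lam k)).
Implicit Types (W Z : state).

(** The contribution of the mode k to the squared norm of H^(s+1) x H^s, with
    lambda^(s+1) split so that powers of the same exponent factor out. *)
Definition mode_energy W k : R :=
  lam k `^ s * (lam k * sqrmod (W.1 k) + sqrmod (W.2 k)).

Lemma mode_energy_ge0 W k : 0 <= mode_energy W k.
Proof.
by rewrite mulr_ge0 ?powR_ge0// addr_ge0 ?sqrmod_ge0// mulr_ge0 ?sqrmod_ge0// ltW.
Qed.

Lemma powR_succ k : lam k `^ (s + 1) = lam k `^ s * lam k.
Proof.
by rewrite powRD ?powRr1//; [exact: ltW|rewrite (gt_eqF (lam0 k)) implybT].
Qed.

Lemma energyE W : (sqnormH lam (s + 1) W.1 + sqnormH lam s W.2 =
  \sum_(0 <= k <oo) (mode_energy W k)%:E)%E.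
Proof.
have ge0 r a k : (0 <= (lam k `^ r * sqrmod (a k))%:E)%E.
  by rewrite lee_fin mulr_ge0 ?powR_ge0 ?sqrmod_ge0.
rewrite /sqnormH -!nneseriesD//; apply: eq_eseriesr => k _.
by rewrite -EFinD; congr EFin; rewrite powR_succ /mode_energy; ring.
Qed.

Lemma finite_energyP W :
  (Hspace lam (s + 1) W.1 /\ Hspace lam s W.2) <->
  exists B, forall N, \sum_(0 <= k < N) mode_energy W k <= B.
Proof.
have e k : mode_energy W k = lam k `^ (s + 1) * sqrmod (W.1 k) + lam k `^ s * sqrmod (W.2 k).
  by rewrite powR_succ /mode_energy; ring.
split=> [[/HspaceP[A hA] /HspaceP[B hB]]|[B hB]].
  exists (A + B) => N; rewrite (eq_bigr _ (fun k _ => e k)) big_split/=.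
  by rewrite lerD.
by split; apply: (Hspace_le hB) => k; rewrite e ?lerDl ?lerDr mulr_ge0 ?powR_ge0 ?sqrmod_ge0.
Qed.

Lemma mode_energyD_le W Z k :
  mode_energy (W + Z) k <= 2 * mode_energy W k + 2 * mode_energy Z k.
Proof.
rewrite [leRHS](_ : _ = lam k `^ s * (lam k * (2 * sqrmod (W.1 k) + 2 * sqrmod (Z.1 k))
   + (2 * sqrmod (W.2 k) + 2 * sqrmod (Z.2 k)))); last by rewrite /mode_energy; ring.
rewrite ler_wpM2l ?powR_ge0// lerD ?sqrmodD_le// ler_wpM2l ?sqrmodD_le//.
exact: ltW.
Qed.

Lemma mode_energyN W k : mode_energy (- W) k = mode_energy W k.
Proof. by rewrite /mode_energy !sqrmodN. Qed.

Lemma mode_energyB_le W Z k :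
  mode_energy (W - Z) k <= 2 * mode_energy W k + 2 * mode_energy Z k.
Proof. by rewrite (le_trans (mode_energyD_le _ _ _))// mode_energyN. Qed.

(** The group is unitary on each mode separately; dominated convergence over
    the modes rests on this pointwise form. *)
Lemma mode_energy_group t W k : mode_energy (wave_group lam t W) k = mode_energy W k.
Proof.
congr (_ * _) => /=; have l0 := lam0 k; set w := Num.sqrt _.
have w0 : w != 0 by rewrite gt_eqF// sqrtr_gt0.
have -> : lam k = w ^+ 2 by rewrite sqr_sqrtr// ltW.
have := cos2Dsin2 (w * t).
case: (W.1 k) (W.2 k) => [x y] [x' y'] E.
rewrite /sqrmod /real_complex_def /=; simpc => /=.
transitivity ((cos (w * t) ^+ 2 + sin (w * t) ^+ 2) *
  (w ^+ 2 * (x ^+ 2 + y ^+ 2) + (x' ^+ 2 + y' ^+ 2))); first by field.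
by rewrite E mul1r.
Qed.

Lemma wave_groupDr t W Z : wave_group lam t (W + Z) = wave_group lam t W + wave_group lam t Z.
Proof. by congr pair; apply/funext => k /=; rewrite !fctE; ring. Qed.

Lemma cvg_sqrmod (I : Type) (F : set_system I) {FF : Filter F} (h : I -> R[i]) (z : R[i]) :
  Re (h i) @[i --> F] --> Re z -> Im (h i) @[i --> F] --> Im z ->
  sqrmod (h i - z) @[i --> F] --> 0.
Proof.
move=> hr hi; rewrite (_ : (fun i => _) = fun i => (Re (h i) - Re z) ^+ 2 + (Im (h i) - Im z) ^+ 2); last first.
  by apply/funext => i; rewrite /sqrmod ReB ImB.
have sq (p : I -> R) (q : R) : p i @[i --> F] --> q -> (p i - q) ^+ 2 @[i --> F] --> 0.
  move=> hp; rewrite -[X in _ --> X](expr0n _ 2) -(subrr q) expr2.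
  have h2 : p i - q @[i --> F] --> q - q by apply: cvgB => //; exact: cvg_cst.
  by rewrite (_ : (fun i => _) = fun i => (p i - q) * (p i - q)); [exact: cvgM|apply/funext => i; rewrite expr2].
by rewrite -[X in _ --> X](addr0 0); apply: cvgD; exact: sq.
Qed.

Lemma wave_group_continuous Z t : Hspace lam (s + 1) Z.1 -> Hspace lam s Z.2 ->
  (\sum_(0 <= k <oo) (mode_energy (wave_group lam r Z - wave_group lam t Z) k)%:E)%E
    @[r --> t] --> 0%E.
Proof.
move=> h1 h2; have /finite_energyP[B hB] := conj h1 h2.
apply: (@nneseries_cvg0 _ _ (nbhs t) _ _ (fun k => 4 * mode_energy Z k) (4 * B)).
- by move=> k r; exact: mode_energy_ge0.
- by move=> N; rewrite -mulr_sumr ler_pM2l.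
- apply: nearW => r k; rewrite (le_trans (mode_energyB_le _ _ _))// !mode_energy_group.
  by lra.
move=> k; have [d1 d2 d3 d4] := is_derive_wave_group lam0 Z k t.
have c1 : sqrmod ((wave_group lam r Z).1 k - (wave_group lam t Z).1 k) @[r --> t] --> 0.
  by apply: cvg_sqrmod; [exact: isd_continuous d1|exact: isd_continuous d2].
have c2 : sqrmod ((wave_group lam r Z).2 k - (wave_group lam t Z).2 k) @[r --> t] --> 0.
  by apply: cvg_sqrmod; [exact: isd_continuous d3|exact: isd_continuous d4].
have := cvgM (cvg_cst (lam k `^ s)) (cvgD (cvgM (cvg_cst (lam k)) c1) c2).
by rewrite mulr0 add0r mulr0; apply.
Qed.

Lemma is_derive_quotient (f : R -> R) (t df : R) : is_derive t (1 : R) f df ->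
  (f r - f t) / (r - t) @[r --> t^'] --> df.
Proof.
move=> hf; have hd := @ex_derive _ _ _ _ _ _ _ hf.
have := hd; rewrite /derivable => /cvg_ex[l hl]; have := cvg_lim (@norm_hausdorff _ _) hl.
rewrite -/(derive f t 1) (@derive_val _ _ _ _ _ _ _ hf) => el; rewrite -{}el in hl.
apply/cvgrPdist_lt => e e0; move/cvgrPdist_lt : hl => /(_ e e0).
rewrite !near_withinE => /nbhs_ballP[d d0 hb].
apply/nbhs_ballP; exists d => // r hr rt.
have := hb (r - t); rewrite /ball/= sub0r normrN distrC => /(_ hr).
rewrite subr_eq0 => /(_ rt); rewrite /GRing.scale/= mulr1 subrK.
by rewrite mulrC.
Qed.

Lemma mean_value (f df : R -> R) (t r : R) :
  (forall x, is_derive x (1 : R) f (df x)) -> exists c, f r - f t = df c * (r - t).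
Proof.
move=> hf; have cf : continuous f by move=> x; exact: isd_continuous (hf x).
have [tr|/ltW rt] := leP t r.
  by have [c _ hc] := MVT_segment tr (fun x _ => hf x) (continuous_subspaceT cf); exists c.
have [c _ hc] := MVT_segment rt (fun x _ => hf x) (continuous_subspaceT cf).
by exists c; rewrite -opprB hc -mulrN opprB.
Qed.

(** By the mean value theorem, the difference quotient of a mode is a value of
    its velocity, whose energy is at most that of the mode. *)
Lemma wave_group_time_derivative Z t : Hspace lam (s + 1) Z.1 -> Hspace lam s Z.2 ->
  sqnormH lam s (fun k => ((wave_group lam r Z).1 k - (wave_group lam t Z).1 k) / (r - t)%:C
      - (wave_group lam t Z).2 k) @[r --> t^'] --> 0%E.
Proof.
move=> h1 h2; have /finite_energyP[B hB] := conj h1 h2.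
have divE (z : R[i]) (d : R) : z / d%:C = (d^-1)%:C * z by rewrite mulrC -fmorphV.
have dr k u : is_derive u (1 : R) (fun r => Re ((wave_group lam r Z).1 k)) (Re ((wave_group lam u Z).2 k)).
  by have [] := is_derive_wave_group lam0 Z k u.
have di k u : is_derive u (1 : R) (fun r => Im ((wave_group lam r Z).1 k)) (Im ((wave_group lam u Z).2 k)).
  by have [] := is_derive_wave_group lam0 Z k u.
apply: (@nneseries_cvg0 _ _ t^' _ _ (fun k => 8 * mode_energy Z k) (8 * B)).
- by move=> k r; rewrite mulr_ge0 ?powR_ge0 ?sqrmod_ge0.
- by move=> N; rewrite -mulr_sumr ler_pM2l.
- rewrite near_withinE; apply: nearW => r rt k.
  have rt0 : r - t != 0 by rewrite subr_eq0.
  have [c1 e1] := mean_value t r (dr k).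
  have [c2 e2] := mean_value t r (di k).
  have b u : lam k `^ s * sqrmod ((wave_group lam u Z).2 k) <= mode_energy Z k.
    rewrite -(mode_energy_group u) /mode_energy ler_wpM2l ?powR_ge0// lerDr.
    by rewrite mulr_ge0 ?sqrmod_ge0// ltW.
  have qr : Re (((wave_group lam r Z).1 k - (wave_group lam t Z).1 k) / (r - t)%:C) = Re ((wave_group lam c1 Z).2 k).
    by rewrite divE Re_realM ReB e1 mulrC mulfK.
  have qi : Im (((wave_group lam r Z).1 k - (wave_group lam t Z).1 k) / (r - t)%:C) = Im ((wave_group lam c2 Z).2 k).
    by rewrite divE Im_realM ImB e2 mulrC mulfK.
  have := b t; have := b c1; have := b c2.
  rewrite /sqrmod ReB ImB qr qi.
  move: (powR_ge0 (lam k) s).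
  move: (Re _) (Im _) (Re _) (Im _) (Re _) (Im _) (lam k `^ s) (mode_energy Z k).
  move=> x y x1 y1 x2 y2 l E l0.
  have := mulr_ge0 l0 (sqr_ge0 (x1 + x)); have := mulr_ge0 l0 (sqr_ge0 (y2 + y)).
  have := mulr_ge0 l0 (sqr_ge0 y1); have := mulr_ge0 l0 (sqr_ge0 x2).
  have := mulr_ge0 l0 (sqr_ge0 x); have := mulr_ge0 l0 (sqr_ge0 y); lra.
move=> k; have c : sqrmod (((wave_group lam r Z).1 k - (wave_group lam t Z).1 k) / (r - t)%:C
      - (wave_group lam t Z).2 k) @[r --> t^'] --> 0.
  apply: cvg_sqrmod.
    rewrite (_ : (fun r => _) = fun r => (Re ((wave_group lam r Z).1 k) - Re ((wave_group lam t Z).1 k)) / (r - t)).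
      exact: is_derive_quotient.
    by apply/funext => r; rewrite divE Re_realM ReB mulrC.
  rewrite (_ : (fun r => _) = fun r => (Im ((wave_group lam r Z).1 k) - Im ((wave_group lam t Z).1 k)) / (r - t)).
    exact: is_derive_quotient.
  by apply/funext => r; rewrite divE Im_realM ImB mulrC.
by have := cvgM (cvg_cst (lam k `^ s)) c; rewrite mulr0; apply.
Qed.

End Wave_energy.

Lemma mode_energy_le {R : realType} (lam : nat -> R) (lam0 : forall k, 0 < lam k) (s : R) W k :
  ((mode_energy lam s W k)%:E <= sqnormH lam (s + 1) W.1 + sqnormH lam s W.2)%E.
Proof.
rewrite (energyE lam0).
apply: (@le_trans _ _ (\sum_(0 <= i < k.+1) (mode_energy lam s W i)%:E)%E).
  rewrite sumEFin lee_fin big_nat_recr//= lerDr.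
  by apply: sumr_ge0 => i _; exact: mode_energy_ge0.
by apply: nneseries_lim_ge => i _ _; rewrite lee_fin mode_energy_ge0.
Qed.

(** The arithmetic-geometric mean inequality on one mode. *)
Lemma mode_pairing_le {R : realType} (lam : nat -> R) (lam0 : forall k, 0 < lam k) (s : R) U W k :
  let z := (lam k `^ (s + 1))%:C * U.1 k * conjc (W.1 k)
    + (lam k `^ s)%:C * U.2 k * conjc (W.2 k) in
  `|Re z| <= (mode_energy lam s U k + mode_energy lam s W k) / 2 /\
  `|Im z| <= (mode_energy lam s U k + mode_energy lam s W k) / 2.
Proof.
move=> z; have l0 := lam0 k; have L0 := powR_ge0 (lam k) s.
have -> : (mode_energy lam s U k + mode_energy lam s W k) / 2 =
    lam k `^ s * lam k * ((sqrmod (U.1 k) + sqrmod (W.1 k)) / 2)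
    + lam k `^ s * ((sqrmod (U.2 k) + sqrmod (W.2 k)) / 2) by rewrite /mode_energy; field.
have L1 : 0 <= lam k `^ s * lam k by rewrite mulr_ge0// ltW.
rewrite /z (powR_succ lam0) -!mulrA ReD ImD !Re_realM !Im_realM mulrA.
have scale (c x y : R) : 0 <= c -> `|x| <= y -> `|c * x| <= c * y.
  by move=> c0 h; rewrite normrM ger0_norm// ler_wpM2l.
split; apply: le_trans (ler_normD _ _) _; apply: lerD; apply: scale => //;
  try exact: Re_mul_conj_le; exact: Im_mul_conj_le.
Qed.


(** * Duhamel's formula *)

Section Duhamel_formula.
Context {R : realType} (lam : nat -> R) (lam0 : forall k, 0 < lam k).
Context (s : R) (bt : nat -> R).
Local Notation state := ((nat -> R[i]) * (nat -> R[i]))%type.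
Local Notation om k := (Num.sqrt (lam k)).
Local Notation leb := (@lebesgue_measure R).

Definition square_integrableC (a b : R) (f : R -> R[i]) :=
  square_integrable a b (Re \o f) /\ square_integrable a b (Im \o f).

Definition fourier_cos (f : R -> R[i]) (y a b : R) : R[i] :=
  cintegral `[a, b] (fun r => (cos (y * r))%:C * f r).
Definition fourier_sin (f : R -> R[i]) (y a b : R) : R[i] :=
  cintegral `[a, b] (fun r => (sin (y * r))%:C * f r).

(** The contribution of the control on [a, b] to the state, transported back to
    time 0 by the free evolution. *)
Definition input_state (f : R -> R[i]) (a b : R) : state :=
  (fun k => (bt k)%:C * fourier_cos f (om k) a b,
   fun k => (om k * bt k)%:C * fourier_sin f (om k) a b).

Lemma square_integrable_sub (a b c d : R) (f : R -> R) : `[a, b] `<=` `[c, d] ->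
  square_integrable c d f -> square_integrable a b f.
Proof.
move=> h [mf i2]; have mD : measurable (`[c, d]%classic : set (measurableTypeR R)) by exact: measurable_itv.
split; first exact: measurable_funS mf.
by apply: integrableS i2 => //; exact: measurable_itv.
Qed.

Lemma continuous_cosM (y : R) : continuous (fun r : R => cos (y * r)).
Proof.
move=> r; apply: (@continuous_comp _ _ _ (fun r => y * r) cos); last exact: continuous_cos.
by apply: cvgM; [exact: cvg_cst|exact: cvg_id].
Qed.

Lemma continuous_sinM (y : R) : continuous (fun r : R => sin (y * r)).
Proof.
move=> r; apply: (@continuous_comp _ _ _ (fun r => y * r) sin); last exact: continuous_sin.
by apply: cvgM; [exact: cvg_cst|exact: cvg_id].
Qed.

Lemma fourier_cosE f y a b : fourier_cos f y a b =
  (\int[leb]_(r in `[a, b]) (Re (f r) * cos (y * r))) +i*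
  (\int[leb]_(r in `[a, b]) (Im (f r) * cos (y * r))).
Proof.
by congr (_ +i* _); apply: eq_Rintegral => r _; rewrite ?Re_realM ?Im_realM mulrC.
Qed.

Lemma fourier_sinE f y a b : fourier_sin f y a b =
  (\int[leb]_(r in `[a, b]) (Re (f r) * sin (y * r))) +i*
  (\int[leb]_(r in `[a, b]) (Im (f r) * sin (y * r))).
Proof.
by congr (_ +i* _); apply: eq_Rintegral => r _; rewrite ?Re_realM ?Im_realM mulrC.
Qed.

(** The addition formulas for cos (w (t - r)) and sin (w (t - r)) take the time
    t out of the integral. *)
Lemma duhamel_formula f t : square_integrableC 0 t f ->
  let F r := wave_group lam (t - r) ((fun k => f r * (bt k)%:C), (fun=> 0)) in
  ((fun k => cintegral `[0, t] (fun r => (F r).1 k)),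
   (fun k => cintegral `[0, t] (fun r => (F r).2 k))) =
  wave_group lam t (input_state f 0 t).
Proof.
move=> [hr hi] F; have mD : measurable (`[0, t]%classic : set (measurableTypeR R)) by exact: measurable_itv.
congr pair; apply/funext => k; have w0 : om k != 0 by rewrite gt_eqF// sqrtr_gt0.
all: have rc := square_integrable_mul hr (@continuous_cosM (om k)).
all: have rs := square_integrable_mul hr (@continuous_sinM (om k)).
all: have ic := square_integrable_mul hi (@continuous_cosM (om k)).
all: have is_ := square_integrable_mul hi (@continuous_sinM (om k)).
all: rewrite /= fourier_cosE fourier_sinE; apply: complexP; rewrite !(ReD, ImD, ReM, ImM) /=.
all: set C := cos (om k * t); set S := sin (om k * t).
- transitivity (bt k * C * (\int[leb]_(r in `[0, t]) (Re (f r) * cos (om k * r)))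
    + bt k * S * (\int[leb]_(r in `[0, t]) (Re (f r) * sin (om k * r)))); last by field.
  apply: (Rintegral_lincomb mD rc rs) => r.
  by rewrite /F /= !(ReD, ImD, ReM, ImM) /= (mulrBr (om k) t r) cosB sinB -/C -/S; field.
- transitivity (bt k * C * (\int[leb]_(r in `[0, t]) (Im (f r) * cos (om k * r)))
    + bt k * S * (\int[leb]_(r in `[0, t]) (Im (f r) * sin (om k * r)))); last by field.
  apply: (Rintegral_lincomb mD ic is_) => r.
  by rewrite /F /= !(ReD, ImD, ReM, ImM) /= (mulrBr (om k) t r) cosB sinB -/C -/S; field.
- transitivity (- om k * bt k * S * (\int[leb]_(r in `[0, t]) (Re (f r) * cos (om k * r)))
    + om k * bt k * C * (\int[leb]_(r in `[0, t]) (Re (f r) * sin (om k * r)))); last by ring.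
  apply: (Rintegral_lincomb mD rc rs) => r.
  by rewrite /F /= !(ReD, ImD, ReM, ImM) /= (mulrBr (om k) t r) cosB sinB -/C -/S; ring.
- transitivity (- om k * bt k * S * (\int[leb]_(r in `[0, t]) (Im (f r) * cos (om k * r)))
    + om k * bt k * C * (\int[leb]_(r in `[0, t]) (Im (f r) * sin (om k * r)))); last by ring.
  apply: (Rintegral_lincomb mD ic is_) => r.
  by rewrite /F /= !(ReD, ImD, ReM, ImM) /= (mulrBr (om k) t r) cosB sinB -/C -/S; ring.
Qed.

Lemma integrable_energy f a b : square_integrableC a b f ->
  leb.-integrable `[a, b] (EFin \o (fun t => sqrmod (f t))).
Proof. by move=> [[_ ir] [_ ii]]; apply: integ_add. Qed.

Lemma square_integrableC_sub f a b c d : `[a, b] `<=` `[c, d] ->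
  square_integrableC c d f -> square_integrableC a b f.
Proof. by move=> h [? ?]; split; exact: square_integrable_sub h _. Qed.

Lemma Rintegral_itv_sub (f : R -> R) a b : 0 <= a -> a <= b ->
  leb.-integrable `[0, b] (EFin \o f) ->
  \int[leb]_(r in `[0, b]) f r - \int[leb]_(r in `[0, a]) f r = \int[leb]_(r in `[a, b]) f r.
Proof.
move=> a0 ab h; rewrite Rintegral_itvB ?bnd_simp//; apply: Rintegral_itv_obnd_cbnd.
apply: integrableS h => //.
by move=> x /=; rewrite !in_itv/= => /andP[/ltW xa ->]; rewrite (le_trans a0).
Qed.

Lemma input_stateB f a b : 0 <= a -> a <= b -> square_integrableC 0 b f ->
  input_state f 0 b - input_state f 0 a = input_state f a b.
Proof.
move=> a0 ab [hr hi].
have rc y := square_integrable_mul hr (@continuous_cosM y).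
have rs y := square_integrable_mul hr (@continuous_sinM y).
have ic y := square_integrable_mul hi (@continuous_cosM y).
have is_ y := square_integrable_mul hi (@continuous_sinM y).
congr pair; apply/funext => k; rewrite /= !fctE -mulrBr; congr (_ * _).
  rewrite !fourier_cosE -(Rintegral_itv_sub a0 ab (rc _)) -(Rintegral_itv_sub a0 ab (ic _)).
  by apply: complexP; rewrite ?ReB ?ImB.
rewrite !fourier_sinE -(Rintegral_itv_sub a0 ab (rs _)) -(Rintegral_itv_sub a0 ab (is_ _)).
by apply: complexP; rewrite ?ReB ?ImB.
Qed.

Context (r1 : R) (hr1 : forall k, lam k `^ s * lam k * bt k ^+ 2 <= r1).
Lemma input_state_energy f a b k : mode_energy lam s (input_state f a b) k <=
  r1 * (sqrmod (fourier_cos f (om k) a b) + sqrmod (fourier_sin f (om k) a b)).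
Proof.
rewrite /mode_energy /= !sqrmod_realM exprMn sqr_sqrtr ?(ltW (lam0 k))//.
rewrite [leLHS](_ : _ = lam k `^ s * lam k * bt k ^+ 2 * (sqrmod (fourier_cos f (om k) a b) + sqrmod (fourier_sin f (om k) a b))); last by ring.
by apply: ler_wpM2r => //; rewrite addr_ge0 ?sqrmod_ge0.
Qed.

(** Admissibility of the control operator: this is Bessel's inequality in the
    norm of the state space. *)
Lemma input_state_bound (T g : R) : 0 < T -> 0 < g -> well_spaced g (fun k => om k) ->
  exists2 K, 0 < K & forall f a b, 0 <= a -> b <= T -> square_integrableC a b f ->
  forall N, \sum_(0 <= k < N) mode_energy lam s (input_state f a b) k <=
    K * \int[leb]_(t in `[a, b]) sqrmod (f t).
Proof.
move=> T0 g0 hw; have [K K0 hK] := bessel_inequality T0 g0 hw.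
have r10 : 0 <= r1.
  by apply: le_trans (hr1 0); rewrite mulr_ge0 ?sqr_ge0// mulr_ge0 ?powR_ge0// ltW.
exists ((r1 + 1) * K) => [|f a b a0 bT [hr hi] N]; first by rewrite mulr_gt0//; lra.
have aT : - T <= a by lra.
have eI : \int[leb]_(t in `[a, b]) sqrmod (f t) =
    \int[leb]_(t in `[a, b]) (Re (f t)) ^+ 2 + \int[leb]_(t in `[a, b]) (Im (f t)) ^+ 2.
  apply: RintegralD => //; [exact: hr.2|exact: hi.2].
have h := lerD (hK a b _ aT bT hr N) (hK a b _ aT bT hi N).
rewrite -mulrDr -eI -big_split/= in h.
rewrite -mulrA; apply: le_trans (ler_wpM2l _ h); last by lra.
rewrite mulr_sumr; apply: ler_sum => k _.
apply: (le_trans (input_state_energy f a b k)).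
rewrite fourier_cosE fourier_sinE {1}/sqrmod {1}/sqrmod /=.
set A := \int[leb]_(_ in _) _; set B := \int[leb]_(_ in _) _.
set C := \int[leb]_(_ in _) _; set D := \int[leb]_(_ in _) _.
rewrite -subr_ge0 (_ : _ - _ = A ^+ 2 + B ^+ 2 + C ^+ 2 + D ^+ 2); last by ring.
by rewrite !addr_ge0 ?sqr_ge0.
Qed.

End Duhamel_formula.

(** * Continuity of the trajectories *)

Section Trajectory.
Context {R : realType} (lam : nat -> R) (lam0 : forall k, 0 < lam k).
Context (s : R) (bt : nat -> R).
Local Notation state := ((nat -> R[i]) * (nat -> R[i]))%type.
Local Notation om k := (Num.sqrt (lam k)).
Local Notation leb := (@lebesgue_measure R).
Context (r1 : R) (hr1 : forall k, lam k `^ s * lam k * bt k ^+ 2 <= r1).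
Context (T g : R) (T0 : 0 < T) (g0 : 0 < g) (hw : well_spaced g (fun k => om k)).
Context (f : R -> R[i]) (hf : square_integrableC 0 T f).
Context (Z : state) (hZ1 : Hspace lam (s + 1) Z.1) (hZ2 : Hspace lam s Z.2).

Definition trajectory t : state := wave_group lam t (Z + input_state lam bt f 0 t).

Let hf_sub a b : 0 <= a -> b <= T -> square_integrableC a b f.
Proof.
move=> a0 bT; apply: square_integrableC_sub hf => x /=; rewrite !in_itv/= => /andP[ax xb].
by rewrite (le_trans a0 ax) (le_trans xb bT).
Qed.

Lemma trajectory_bound : exists B, forall t, 0 <= t <= T -> forall N,
  \sum_(0 <= k < N) mode_energy lam s (trajectory t) k <= B.
Proof.
have [K K0 hK] := input_state_bound lam0 hr1 T0 g0 hw.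
have /(finite_energyP lam0)[B hB] := conj hZ1 hZ2.
exists (2 * B + 2 * (K * \int[leb]_(t in `[0, T]) sqrmod (f t))) => t /andP[t0 tT] N.
apply: (@le_trans _ _ (\sum_(0 <= k < N) (2 * mode_energy lam s Z k + 2 * mode_energy lam s (input_state lam bt f 0 t) k))).
  by apply: ler_sum => k _; rewrite /trajectory (mode_energy_group lam0) mode_energyD_le.
rewrite big_split -!mulr_sumr/=.
have h1 := hK f 0 t (lexx _) tT (hf_sub (lexx _) tT) N.
have h2 : \int[leb]_(t in `[0, t]) sqrmod (f t) <= \int[leb]_(t in `[0, T]) sqrmod (f t).
  apply: Rintegral_subset; [exact: measurable_itv|exact: measurable_itv| |exact: integrable_energy hf|].
    by move=> x /=; rewrite !in_itv/= => /andP[-> h]; exact: le_trans tT.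
  by move=> x _; exact: sqrmod_ge0.
have := hB N; have := ler_wpM2l (ltW K0) h2.
move: (\int[_]_(_ in _) _) (\int[_]_(_ in _) _) h1 => I1 I2; lra.
Qed.

Lemma trajectory_finite_energy t : 0 <= t <= T ->
  Hspace lam (s + 1) (trajectory t).1 /\ Hspace lam s (trajectory t).2.
Proof.
by move=> ht; apply/(finite_energyP lam0); have [B hB] := trajectory_bound; exists B; exact: hB.
Qed.

(** The increment splits into the input received between the two times, which
    is small by absolute continuity of the integral of |f|^2, and the increment
    of a free wave. *)
Lemma trajectory_continuous t : 0 <= t <= T ->
  (sqnormH lam (s + 1) (trajectory u - trajectory t).1%R + sqnormH lam s (trajectory u - trajectory t).2%R)%E
    @[u --> within `[0, T] (nbhs t)] --> 0%E.
Proof.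
move=> /andP[t0 tT].
have [K K0 hK] := input_state_bound lam0 hr1 T0 g0 hw.
pose F u := \int[leb]_(r in `[0, u]) sqrmod (f r).
have iE := integrable_energy hf.
have cF : F u @[u --> within `[0, T] (nbhs t)] --> F t.
  have := parameterized_integral_continuous (ltW T0) iE.
  by move=> /subspace_continuousP; apply; rewrite /= in_itv/= t0.
have hmod u : 0 <= u -> u <= T -> forall N,
  \sum_(0 <= k < N) mode_energy lam s (input_state lam bt f 0 u - input_state lam bt f 0 t) k <=
    K * `|F u - F t|.
  move=> u0 uT N; have iEs v : v <= T -> leb.-integrable `[0, v] (EFin \o (fun t => sqrmod (f t))).
    by move=> vT; apply: integrable_energy; exact: hf_sub.
  have key a b : 0 <= a -> a <= b -> b <= T ->
      \sum_(0 <= k < N) mode_energy lam s (input_state lam bt f a b) k <= K * `|F b - F a|.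
    move=> a0 ab bT; rewrite /F (Rintegral_itv_sub a0 ab (iEs _ bT)) ger0_norm.
      by apply: hK => //; exact: hf_sub.
    by apply: Rintegral_ge0 => x _; exact: sqrmod_ge0.
  have [tu|/ltW ut] := leP t u.
    by rewrite input_stateB//; [exact: key|exact: hf_sub].
  rewrite (eq_bigr (fun k => mode_energy lam s (input_state lam bt f u t) k)); last first.
    by move=> k _; rewrite -mode_energyN opprB input_stateB//; exact: hf_sub.
  by rewrite distrC; exact: key.
have [hY1 hY2] : Hspace lam (s + 1) (Z + input_state lam bt f 0 t).1 /\
    Hspace lam s (Z + input_state lam bt f 0 t).2.
  apply/(finite_energyP lam0); have [B hB] := trajectory_bound; exists B => N.
  have := hB t; rewrite t0 tT => /(_ isT N); rewrite (eq_bigr _ (fun k _ => mode_energy_group lam0 s t _ k)).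
  by [].
have hG := wave_group_continuous lam0 t hY1 hY2.
apply: cvg_e0 => [u|e e0]; first by rewrite adde_ge0// sqnormH_ge0.
have e4 : 0 < e / 4 by rewrite divr_gt0.
have e4K : 0 < e / 4 / K by rewrite divr_gt0.
have n1 : \forall u \near within `[0, T] (nbhs t), `|F u - F t| < e / 4 / K.
  by move/cvgrPdist_lt : cF => /(_ _ e4K); apply: filterS => u; rewrite distrC.
have n2 : \forall u \near within `[0, T] (nbhs t),
  (\sum_(0 <= k <oo) (mode_energy lam s (wave_group lam u (Z + input_state lam bt f 0 t)
    - wave_group lam t (Z + input_state lam bt f 0 t)) k)%:E < (e / 4)%:E)%E.
  apply: cvg_within; apply: (hG _ (open_ereal_lt' _)); rewrite lte_fin.
  exact: e4.
have n3 : \forall u \near within `[0, T] (nbhs t), 0 <= u <= T.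
  by rewrite near_withinE; apply: nearW => u /=; rewrite in_itv.
apply: filterS3 n1 n2 n3 => u h1 h2 /andP[u0 uT].
rewrite (energyE lam0); apply: nneseries_le_bound => [k|N]; first exact: mode_energy_ge0.
have e1 : trajectory u - trajectory t =
    wave_group lam u (input_state lam bt f 0 u - input_state lam bt f 0 t)
    + (wave_group lam u (Z + input_state lam bt f 0 t)
    - wave_group lam t (Z + input_state lam bt f 0 t)).
  rewrite /trajectory addrA; congr (_ - _); rewrite -wave_groupDr; congr wave_group.
  by rewrite [RHS]addrC -addrA; congr (_ + _); rewrite addrC subrK.
rewrite e1.
apply: (@le_trans _ _ (\sum_(0 <= k < N) (2 * mode_energy lam s (input_state lam bt f 0 u - input_state lam bt f 0 t) k
  + 2 * mode_energy lam s (wave_group lam u (Z + input_state lam bt f 0 t)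
    - wave_group lam t (Z + input_state lam bt f 0 t)) k))).
  by apply: ler_sum => k _; rewrite (le_trans (mode_energyD_le _ _ _ _ _))// (mode_energy_group lam0).
rewrite big_split -!mulr_sumr/=.
have b1 := hmod u u0 uT N.
have b1' : K * `|F u - F t| <= e / 4 by rewrite mulrC -ler_pdivlMr// ltW.
have := partial_sum_le (fun k => mode_energy_ge0 lam0 s _ k) (ltW h2) N.
have := le_trans b1 b1'; lra.
Qed.

End Trajectory.

(** * Integral equations of the trajectories *)

Section Mode_equation.
Context {R : realType}.
Local Notation leb := (@lebesgue_measure R).
Variables (w p q b T : R) (F : R -> R).
Hypotheses (w0 : w != 0) (T0 : 0 <= T) (hF : square_integrable 0 T F).
Let C t := \int[leb]_(r in `[0, t]) (F r * cos (w * r)).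
Let S t := \int[leb]_(r in `[0, t]) (F r * sin (w * r)).

Let iC : leb.-integrable `[0, T] (EFin \o (fun r => F r * cos (w * r))).
Proof. exact: square_integrable_mul hF (@continuous_cosM _ w). Qed.
Let iS : leb.-integrable `[0, T] (EFin \o (fun r => F r * sin (w * r))).
Proof. exact: square_integrable_mul hF (@continuous_sinM _ w). Qed.

Let integrable_memory (phi G : R -> R) : continuous phi ->
  leb.-integrable `[0, T] (EFin \o G) ->
  leb.-integrable `[0, T] (EFin \o (fun t => phi t * \int[leb]_(r in `[0, t]) G r)).
Proof.
move=> cphi iG; apply: continuous_compact_integrable; first exact: segment_compact.
move=> t; apply: cvgM; first exact: (continuous_subspaceT cphi).
exact: (parameterized_integral_continuous T0 iG).
Qed.

Let isd_cosw t : is_derive t (1 : R) (fun r => cos (w * r)) (- w * sin (w * t)).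
Proof.
have d : is_derive t (1 : R) (fun r => w * r) w.
  by apply: (is_derive_eq (isd_scale w (isd_id t))); rewrite mulr1.
by apply: (is_derive_eq (isd_comp (is_derive_cos _) d)); rewrite mulrC mulrN mulNr.
Qed.

Let isd_sinw t : is_derive t (1 : R) (fun r => sin (w * r)) (w * cos (w * t)).
Proof.
have d : is_derive t (1 : R) (fun r => w * r) w.
  by apply: (is_derive_eq (isd_scale w (isd_id t))); rewrite mulr1.
by apply: (is_derive_eq (isd_comp (is_derive_sin _) d)); rewrite mulrC.
Qed.

Let mD : measurable (`[0, T]%classic : set (measurableTypeR R)).
Proof. exact: measurable_itv. Qed.

Let cos_c := @continuous_cosM R w.
Let sin_c := @continuous_sinM R w.

Let integrable_product (phi psi : R -> R) : continuous phi -> continuous psi ->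
  leb.-integrable `[0, T] (EFin \o (fun t => phi t * (F t * psi t))).
Proof.
move=> cphi cpsi; rewrite (_ : (fun t => _) = fun t => F t * (phi t * psi t)).
  by apply: square_integrable_mul hF _ => t; apply: cvgM; [exact: cphi|exact: cpsi].
by apply/funext => t; ring.
Qed.

Let continuousZ (c : R) (phi : R -> R) : continuous phi -> continuous (fun t => c * phi t).
Proof. by move=> cphi t; apply: cvgM; [exact: cvg_cst|exact: cphi]. Qed.

Let dsin t : is_derive t (1 : R) (fun r => w^-1 * sin (w * r)) (cos (w * t)).
Proof. by apply: (is_derive_eq (isd_scale w^-1 (isd_sinw t))); rewrite mulKf. Qed.

Let dcos t : is_derive t (1 : R) (fun r => - w^-1 * cos (w * r)) (sin (w * t)).
Proof.
apply: (is_derive_eq (isd_scale (- w^-1) (isd_cosw t))).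
by rewrite !mulNr mulrN opprK mulKf.
Qed.

(** The two double integrals are each integrated by parts; the remaining single
    integrals cancel. *)
Let memory_diag : \int[leb]_(t in `[0, T]) (cos (w * t) * C t)
    + \int[leb]_(t in `[0, T]) (sin (w * t) * S t) =
  w^-1 * sin (w * T) * C T - w^-1 * cos (w * T) * S T.
Proof.
rewrite (Fubini_parts T0 cos_c dsin iC) (Fubini_parts T0 sin_c dcos iS).
have h : \int[leb]_(t in `[0, T]) 0 =
    1 * \int[leb]_(t in `[0, T]) (w^-1 * sin (w * t) * (F t * cos (w * t)))
    + 1 * \int[leb]_(t in `[0, T]) (- w^-1 * cos (w * t) * (F t * sin (w * t))).
  apply: (Rintegral_lincomb mD) => [||t]; last by ring.
    exact: integrable_product (@continuousZ _ _ sin_c) cos_c.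
  exact: integrable_product (@continuousZ _ _ cos_c) sin_c.
rewrite Rintegral_itv_cst// mul0r in h.
by rewrite -/(C T) -/(S T); lra.
Qed.

Let memory_cross : \int[leb]_(t in `[0, T]) (cos (w * t) * S t)
    - \int[leb]_(t in `[0, T]) (sin (w * t) * C t) =
  w^-1 * (sin (w * T) * S T + cos (w * T) * C T - \int[leb]_(t in `[0, T]) F t).
Proof.
rewrite (Fubini_parts T0 cos_c dsin iS) (Fubini_parts T0 sin_c dcos iC).
have h : \int[leb]_(t in `[0, T]) F t =
    w * \int[leb]_(t in `[0, T]) (w^-1 * sin (w * t) * (F t * sin (w * t)))
    + - w * \int[leb]_(t in `[0, T]) (- w^-1 * cos (w * t) * (F t * cos (w * t))).
  apply: (Rintegral_lincomb mD) => [||t].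
  - exact: integrable_product (@continuousZ _ _ sin_c) sin_c.
  - exact: integrable_product (@continuousZ _ _ cos_c) cos_c.
  rewrite -[LHS]mulr1 -(cos2Dsin2 (w * t)); by field.
by rewrite h -/(C T) -/(S T); field.
Qed.

Let x t := cos (w * t) * (p + b * C t) + sin (w * t) / w * (q + w * b * S t).
Let y t := - (w * sin (w * t)) * (p + b * C t) + cos (w * t) * (q + w * b * S t).

Let int_cos : \int[leb]_(t in `[0, T]) cos (w * t) = w^-1 * sin (w * T).
Proof.
by rewrite (Rintegral_antiderivative T0 dsin cos_c) mulr0 sin0 mulr0 subr0.
Qed.

Let int_sin : \int[leb]_(t in `[0, T]) sin (w * t) = w^-1 * (1 - cos (w * T)).
Proof.
rewrite (Rintegral_antiderivative T0 dcos sin_c) mulr0 cos0; ring.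
Qed.

(** The variation of constants formula solves the integrated equations of a
    forced oscillator. *)
Lemma forced_oscillator :
  x T - p = \int[leb]_(t in `[0, T]) y t + b * \int[leb]_(t in `[0, T]) F t /\
  y T - q = - w ^+ 2 * \int[leb]_(t in `[0, T]) x t.
Proof.
have icos := integ_continuous 0 T cos_c.
have isin := integ_continuous 0 T sin_c.
have icC : leb.-integrable `[0, T] (EFin \o (fun t => cos (w * t) * C t)) := integrable_memory cos_c iC.
have icS : leb.-integrable `[0, T] (EFin \o (fun t => cos (w * t) * S t)) := integrable_memory cos_c iS.
have isC : leb.-integrable `[0, T] (EFin \o (fun t => sin (w * t) * C t)) := integrable_memory sin_c iC.
have isS : leb.-integrable `[0, T] (EFin \o (fun t => sin (w * t) * S t)) := integrable_memory sin_c iS.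
have ih := integ_add mD (integ_scale mD p icos) (integ_scale mD (q / w) isin).
have eh : \int[leb]_(t in `[0, T]) (p * cos (w * t) + q / w * sin (w * t)) =
  p * (w^-1 * sin (w * T)) + q / w * (w^-1 * (1 - cos (w * T))).
  by rewrite -int_cos -int_sin; apply: (Rintegral_lincomb mD icos isin).
have im := integ_add mD icC isS.
have em : \int[leb]_(t in `[0, T]) (cos (w * t) * C t + sin (w * t) * S t) =
    1 * \int[leb]_(t in `[0, T]) (cos (w * t) * C t) + 1 * \int[leb]_(t in `[0, T]) (sin (w * t) * S t).
  by apply: (Rintegral_lincomb mD icC isS) => t; ring.
have ih' := integ_add mD (integ_scale mD q icos) (integ_scale mD (- w * p) isin).
have eh' : \int[leb]_(t in `[0, T]) (q * cos (w * t) + - w * p * sin (w * t)) =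
  q * (w^-1 * sin (w * T)) + - w * p * (w^-1 * (1 - cos (w * T))).
  by rewrite -int_cos -int_sin; apply: (Rintegral_lincomb mD icos isin).
have im' := integ_sub mD icS isC.
have em' : \int[leb]_(t in `[0, T]) (cos (w * t) * S t - sin (w * t) * C t) =
    1 * \int[leb]_(t in `[0, T]) (cos (w * t) * S t) + (-1) * \int[leb]_(t in `[0, T]) (sin (w * t) * C t).
  by apply: (Rintegral_lincomb mD icS isC) => t; ring.
have ex : \int[leb]_(t in `[0, T]) x t = 1 * (\int[leb]_(t in `[0, T]) (p * cos (w * t) + q / w * sin (w * t)))
    + b * \int[leb]_(t in `[0, T]) (cos (w * t) * C t + sin (w * t) * S t).
  by apply: (Rintegral_lincomb mD ih im) => t; rewrite /x; field.
have ey : \int[leb]_(t in `[0, T]) y t = 1 * (\int[leb]_(t in `[0, T]) (q * cos (w * t) + - w * p * sin (w * t)))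
    + w * b * \int[leb]_(t in `[0, T]) (cos (w * t) * S t - sin (w * t) * C t).
  by apply: (Rintegral_lincomb mD ih' im') => t; rewrite /y; ring.
rewrite {}ex {}ey {}eh {}eh' {}em {}em' /x /y.
have := memory_diag; have := memory_cross; move: (C T) (S T) (cos (w * T)) (sin (w * T)).
move: (\int[_]_(_ in _) F _) (\int[_]_(_ in _) (cos _ * C _)) (\int[_]_(_ in _) (cos _ * S _))
  (\int[_]_(_ in _) (sin _ * C _)) (\int[_]_(_ in _) (sin _ * S _)) => I cC cS sC sS Ct St c s h1 h2.
rewrite mulN1r !mul1r h1 h2.
by split; field.
Qed.

End Mode_equation.

Section Trajectory_equation.
Context {R : realType} (lam : nat -> R) (lam0 : forall k, 0 < lam k) (bt : nat -> R).
Local Notation state := ((nat -> R[i]) * (nat -> R[i]))%type.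
Local Notation om k := (Num.sqrt (lam k)).
Local Notation leb := (@lebesgue_measure R).
Context (T : R) (f : R -> R[i]) (hf : square_integrableC 0 T f) (Z : state).

Lemma trajectory_equation t k : 0 <= t <= T ->
  let U := trajectory lam bt f Z in
  (U t).1 k - Z.1 k = cintegral `[0, t] (fun r => (U r).2 k) + (bt k)%:C * cintegral `[0, t] f /\
  (U t).2 k - Z.2 k = - (lam k)%:C * cintegral `[0, t] (fun r => (U r).1 k).
Proof.
move=> /andP[t0 tT] U; have w0 : om k != 0 by rewrite gt_eqF// sqrtr_gt0.
have hft : square_integrableC 0 t f.
  by apply: square_integrableC_sub hf => x /=; rewrite !in_itv/= => /andP[-> h]; exact: le_trans tT.
have lw : lam k = om k ^+ 2 by rewrite sqr_sqrtr// ltW.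
have E (P : R[i] -> R) r : (P = @complex.Re R \/ P = @complex.Im R) ->
  P ((U r).1 k) = cos (om k * r) * (P (Z.1 k) + bt k * \int[leb]_(u in `[0, r]) (P (f u) * cos (om k * u)))
    + sin (om k * r) / om k * (P (Z.2 k) + om k * bt k * \int[leb]_(u in `[0, r]) (P (f u) * sin (om k * u))) /\
  P ((U r).2 k) = - (om k * sin (om k * r)) * (P (Z.1 k) + bt k * \int[leb]_(u in `[0, r]) (P (f u) * cos (om k * u)))
    + cos (om k * r) * (P (Z.2 k) + om k * bt k * \int[leb]_(u in `[0, r]) (P (f u) * sin (om k * u))).
  rewrite /U /trajectory /= !fctE /= fourier_cosE fourier_sinE.
  move: (Z.1 k) (Z.2 k) => [a b] [c d].
  by move=> [->|->]; rewrite !(ReD, ImD, ReM, ImM) /=; split; ring.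
have er r := E (@complex.Re R) r (or_introl erefl).
have ei r := E (@complex.Im R) r (or_intror erefl).
have [r1 r2] := forced_oscillator (Re (Z.1 k)) (Re (Z.2 k)) (bt k) w0 t0 hft.1.
have [i1 i2] := forced_oscillator (Im (Z.1 k)) (Im (Z.2 k)) (bt k) w0 t0 hft.2.
split; apply: complexP; rewrite ?ReB ?ImB.
- rewrite (er t).1 ReD Re_realM r1; congr (_ + _).
  by apply: eq_Rintegral => r _; rewrite (er r).2.
- rewrite (ei t).1 ImD Im_realM i1; congr (_ + _).
  by apply: eq_Rintegral => r _; rewrite (ei r).2.
- rewrite (er t).2 r2 -rmorphN Re_realM -lw; congr (_ * _).
  by apply: eq_Rintegral => r _; rewrite (er r).1.
- rewrite (ei t).2 i2 -rmorphN Im_realM -lw; congr (_ * _).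
  by apply: eq_Rintegral => r _; rewrite (ei r).1.
Qed.

End Trajectory_equation.

(** * Observation and control in coordinates *)

Section Observation.
Context {R : realType} (alpha beta mu : R).
Hypothesis alpha_lt2 : alpha < 2.
Local Notation kap := (kappa alpha).
Local Notation sig := (sigma alpha beta).
Local Notation v := (nu alpha beta mu).
Local Notation lam := (lambda alpha beta mu).
Local Notation j := (bessel_zero v).
Local Notation state := ((nat -> R[i]) * (nat -> R[i]))%type.

Lemma kappa_gt0 : 0 < kap.
Proof. by rewrite divr_gt0// subr_gt0. Qed.

Lemma nu_ge0 : 0 <= v.
Proof. by rewrite divr_ge0 ?sqrtr_ge0// mulr_ge0// ltW// kappa_gt0. Qed.

Lemma sqrt_Delta : Num.sqrt (Delta alpha beta mu) / 2 = kap * v.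
Proof.
rewrite /nu; have := kappa_gt0; move: (kappa alpha) => k k0; field.
by rewrite gt_eqF.
Qed.

Let j0 k : 0 < j k. Proof. exact: bessel_zero_gt0 nu_ge0 k. Qed.

Lemma lambdaE k : lam k = (kap * j k) ^+ 2. Proof. by rewrite exprMn. Qed.

Lemma lambda_gt0 k : 0 < lam k.
Proof. by rewrite lambdaE exprn_gt0// mulr_gt0// kappa_gt0. Qed.

Lemma sqrt_lambda k : Num.sqrt (lam k) = kap * j k.
Proof. by rewrite lambdaE sqrtr_sqr ger0_norm// mulr_ge0// ltW// kappa_gt0. Qed.

Lemma sum_inverse_squares (N : nat) : \sum_(0 <= k < N) (k.+1%:R ^+ 2)^-1 <= 2 :> R.
Proof.
suff h (n : nat) : \sum_(0 <= k < n.+1) (k.+1%:R ^+ 2)^-1 <= 2 - (n.+1%:R)^-1 :> R.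
  case: N => [|n]; first by rewrite big_geq.
  by apply: le_trans (h n) _; rewrite gerBl invr_ge0.
elim: n => [|n ih]; first by rewrite big_nat1 expr1n invr1; lra.
rewrite big_nat_recr//=; apply: le_trans (lerD ih (lexx _)) _.
rewrite -(natr1 n.+1); have : 0 < n.+1%:R :> R by [].
move: (n.+1%:R) => m m0; rewrite -subr_ge0.
rewrite (_ : _ - _ = (m * (m + 1) ^+ 2)^-1); last by field; rewrite ?gt_eqF//; lra.
by rewrite invr_ge0 mulr_ge0 ?sqr_ge0// ltW.
Qed.

(** The zeros grow at least linearly. *)
Lemma sum_inverse_lambda : exists B, forall N, \sum_(0 <= k < N) (lam k)^-1 <= B.
Proof.
have [g g0 hg] := bessel_zero_gap nu_ge0.
pose m := Num.min g (j 0); have m0 : 0 < m by rewrite lt_min g0 j0.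
have hj k : k.+1%:R * m <= j k.
  elim: k => [|k ih]; first by rewrite mul1r ge_min lexx orbT.
  rewrite -(natr1 k.+1) mulrDl mul1r; apply: le_trans (hg k); rewrite lerD//.
  by rewrite ge_min lexx.
have k0 := kappa_gt0.
exists ((kap * m) ^- 2 * 2) => N.
apply: le_trans (ler_wpM2l _ (sum_inverse_squares N)); last by rewrite invr_ge0 sqr_ge0.
have km0 : 0 < kap * m by rewrite mulr_gt0.
rewrite mulr_sumr; apply: ler_sum => k _; rewrite -invfM -exprMn lambdaE.
have kj0 : 0 < kap * j k by rewrite mulr_gt0.
have kk0 : 0 < kap * m * k.+1%:R by rewrite mulr_gt0.
rewrite lef_pV2 ?posrE ?exprn_gt0// lerXn2r ?nnegrE ?(ltW kk0) ?(ltW kj0)//.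
by rewrite -mulrA ler_wpM2l ?(ltW k0)// mulrC.
Qed.

(** The coefficient of the leading term x^(sigma + kappa nu) of Phi_k at 0,
    up to the factor P_nu(0). *)
Definition Phi_lead k : R :=
  Num.sqrt (2 * kap) / `| derive1 (besselJ v) (j k) | * (j k / 2) `^ v.

Lemma PhiE k x : 0 < x -> Phi alpha beta mu k x =
  x `^ (sig + kap * v) * (Phi_lead k * besselP v ((j k * x `^ kap) ^+ 2 / 4)).
Proof.
move=> x0; have xk : 0 < x `^ kap by rewrite powR_gt0.
rewrite /Phi besselJE ?nu_ge0 ?mulr_gt0//.
have -> : j k * x `^ kap / 2 = (j k / 2) * x `^ kap by ring.
rewrite powRM ?(powR_ge0, divr_ge0) ?(ltW (j0 k))// -powRrM /Phi_lead.
rewrite powRD; last by rewrite (gt_eqF x0) implybT.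
by move: (_ `^ _) (_ `^ _) (_ `^ _) (besselP _ _) (_ / _) => *; ring.
Qed.

Lemma Phi_lead_gt0 k : 0 < Phi_lead k.
Proof.
have k0 := kappa_gt0.
have [m [M [m0 M0 hm]]] := besselW'_zero_bounds nu_ge0.
have kap2 : 0 < 2 * kap by apply: mulr_gt0.
rewrite /Phi_lead; apply: mulr_gt0; last by rewrite powR_gt0// divr_gt0.
apply: divr_gt0; first by rewrite sqrtr_gt0.
rewrite (derive_besselJ_zero nu_ge0); apply: mulr_gt0.
  by rewrite mulr_gt0 ?powR_gt0.
by have /andP[h _] := hm k; exact: lt_le_trans h.
Qed.

(** The factor j_k^(2 nu + 1) in the square of the leading coefficient is
    cancelled by the weight, and w'^2 at the zeros is bounded above and below. *)
Lemma Phi_lead_sq k : Phi_lead k ^+ 2 * lam k `^ (- (v + 1 / 2)) =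
  2 * kap * kap `^ (- (2 * v + 1)) * (besselW' v (j k) ^+ 2)^-1.
Proof.
have k0 := kappa_gt0; have jk := j0 k.
have [m [M [m0 M0 hm]]] := besselW'_zero_bounds nu_ge0.
have w0 : 0 < `|besselW' v (j k)| by have /andP[h _] := hm k; exact: lt_le_trans h.
have p2 : 0 < 2 `^ v :> R by rewrite powR_gt0.
rewrite /Phi_lead (derive_besselJ_zero nu_ge0) lambdaE.
have -> : (j k / 2) `^ v = j k `^ v * (2 `^ v)^-1.
  by rewrite powRM ?invr_ge0 ?(ltW jk)// -(@powR_inv1 _ 2)// -powRrM mulN1r powRN.
rewrite !powRN.
have e1 : ((kap * j k) ^+ 2) `^ (v + 1 / 2) = kap `^ (2 * v + 1) * (j k `^ v) ^+ 2 * j k.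
  have sq (a : R) : 0 < a -> (a ^+ 2) `^ (v + 1 / 2) = a `^ (2 * v + 1).
    by move=> a0; rewrite -powR_mulrn ?(ltW a0)// -powRrM; congr powR; field.
  rewrite exprMn powRM ?sqr_ge0// (sq _ k0) (sq _ jk).
  rewrite [j k `^ (2 * v + 1)]powRD; last by rewrite (gt_eqF jk) implybT.
  by rewrite powRr1 ?(ltW jk)// mulrA [2 * v]mulrC powRrM powR_mulrn ?powR_ge0.
rewrite e1 div1r powR12_sqrt ?(ltW jk)//.
have sj : 0 < Num.sqrt (j k) by rewrite sqrtr_gt0.
have ej : j k = Num.sqrt (j k) ^+ 2 by rewrite sqr_sqrtr// ltW.
move: (Num.sqrt (j k)) sj ej e1 => sj sj0 ej _.
have kap2 : 0 <= 2 * kap by apply: mulr_ge0 => //; exact: ltW.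
have k2 : 0 < kap `^ (2 * v + 1) by rewrite powR_gt0.
have jv : 0 < j k `^ v by rewrite powR_gt0.
move: k2 jv w0 (real_normK (num_real (besselW' v (j k)))) (sqr_sqrtr kap2).
move: (kap `^ _) (j k `^ _) `|besselW' v (j k)| (besselW' v (j k)) (Num.sqrt _) (2 `^ v) p2.
move=> P p2 K J w w' S K0 J0 w0 <- <-; rewrite {}ej.
by field; rewrite !gt_eqF.
Qed.

Definition obs_factor : R := if v == 0 then 1 else Num.sqrt (Delta alpha beta mu).
(** The value of the observation operator at the state (Phi_k, 0). *)
Definition obs_coef k : R := obs_factor * (Phi_lead k * besselP v 0).
Definition ctrl_coef k : R := obs_coef k * lam k `^ (- (v + 1 / 2)).

Lemma obs_factor_gt0 : 0 < obs_factor.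
Proof.
rewrite /obs_factor; case: (eqVneq v 0) => [//|v0].
have h := sqrt_Delta; have : 0 < kap * v.
  by apply: mulr_gt0; [exact: kappa_gt0|rewrite lt_neqAle eq_sym v0 nu_ge0].
lra.
Qed.

Lemma lambda_ctrl_coef k : lam k `^ (v + 1 / 2) * ctrl_coef k = obs_coef k.
Proof.
rewrite /ctrl_coef powRN mulrCA mulfV ?mulr1// gt_eqF// powR_gt0//.
exact: lambda_gt0.
Qed.

Lemma ctrl_coef_bounds : exists r0 r1, 0 < r0 /\
  forall k, r0 <= lam k `^ (v - 1 / 2) * lam k * ctrl_coef k ^+ 2 <= r1.
Proof.
have [m [M [m0 M0 hm]]] := besselW'_zero_bounds nu_ge0.
pose A := (obs_factor * besselP v 0) ^+ 2 * (2 * kap * kap `^ (- (2 * v + 1))).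
have A0 : 0 < A.
  apply: mulr_gt0; first by rewrite exprn_gt0// mulr_gt0// ?obs_factor_gt0// besselP0_gt0 ?nu_ge0.
  apply: mulr_gt0; last by rewrite powR_gt0// kappa_gt0.
  by apply: mulr_gt0 => //; exact: kappa_gt0.
exists (A * (M ^+ 2)^-1), (A * (m ^+ 2)^-1); split.
  by rewrite mulr_gt0// invr_gt0 exprn_gt0.
move=> k; have l0 := lambda_gt0 k; have /andP[hm1 hm2] := hm k.
have w0 : 0 < `|besselW' v (j k)| by exact: lt_le_trans hm1.
rewrite (_ : _ * _ * _ = A * (besselW' v (j k) ^+ 2)^-1).
  rewrite -(real_normK (num_real (besselW' v (j k)))).
  by apply/andP; split; apply: ler_wpM2l; rewrite ?(ltW A0)// lef_pV2 ?posrE ?exprn_gt0//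
    lerXn2r ?nnegrE ?(ltW m0) ?(ltW M0) ?(ltW w0).
have L0 : 0 < lam k `^ (v + 1 / 2) by rewrite powR_gt0.
have -> : lam k `^ (v - 1 / 2) * lam k = lam k `^ (v + 1 / 2).
  by rewrite -powR_succ; [congr powR; field|exact: lambda_gt0].
rewrite /A -mulrA -mulrA [X in _ = _ * X]mulrA -Phi_lead_sq /ctrl_coef /obs_coef powRN.
by move: (lam k `^ _) L0 => L L0; field; rewrite gt_eqF.
Qed.

Lemma Phi_lead_le : exists2 D, 0 < D & forall k,
  Phi_lead k ^+ 2 * lam k `^ (- (v + 3 / 2)) <= D * (lam k)^-1.
Proof.
have [m [M [m0 M0 hm]]] := besselW'_zero_bounds nu_ge0.
have A0 : 0 < 2 * kap * kap `^ (- (2 * v + 1)).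
  apply: mulr_gt0; last by rewrite powR_gt0// kappa_gt0.
  by apply: mulr_gt0 => //; exact: kappa_gt0.
exists (2 * kap * kap `^ (- (2 * v + 1)) * (m ^+ 2)^-1) => [|k].
  by rewrite mulr_gt0// invr_gt0 exprn_gt0.
have /andP[hm1 _] := hm k; have l0 := lambda_gt0 k.
rewrite (_ : - (v + 3 / 2) = - (v + 1 / 2) + - 1); last by field.
rewrite powRD; last by rewrite (gt_eqF l0) implybT.
rewrite powR_inv1 ?(ltW l0)// mulrA Phi_lead_sq ler_wpM2r ?invr_ge0 ?(ltW l0)//.
apply: ler_wpM2l; first exact: ltW.
rewrite -(real_normK (num_real (besselW' v (j k)))).
rewrite lef_pV2 ?posrE ?exprn_gt0//; last exact: lt_le_trans hm1.
by rewrite lerXn2r ?nnegrE ?(ltW m0) ?normr_ge0.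
Qed.

Section Series.
Variables (a : nat -> R[i]) (ha : Hspace lam (v + 3 / 2) a).

(** Completing the squares bounds |a_k| Phi_lead k by
    lambda^(nu + 3/2) |a_k|^2 plus a multiple of 1 / lambda_k. *)
Lemma lead_summable : exists B, forall N,
  \sum_(0 <= k < N) (`|Re (a k)| + `|Im (a k)|) * Phi_lead k <= B.
Proof.
have /HspaceP[A hA] := ha; have [D D0 hD] := Phi_lead_le.
have [B hB] := sum_inverse_lambda; exists (A + D * B) => N.
apply: (@le_trans _ _ (\sum_(0 <= k < N) (lam k `^ (v + 3 / 2) * sqrmod (a k) + D * (lam k)^-1))).
  apply: ler_sum => k _; have l0 := lambda_gt0 k.
  have L0 : 0 < lam k `^ (v + 3 / 2) by rewrite powR_gt0.
  have := hD k; rewrite powRN => h; apply: le_trans (lerD (lexx _) h).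
  rewrite /sqrmod -(real_normK (num_real (Re (a k)))) -(real_normK (num_real (Im (a k)))).
  move: (lam k `^ _) L0 `|Re (a k)| `|Im (a k)| (Phi_lead k) => L L0 x y d.
  rewrite -subr_ge0 (_ : _ - _ = L * (x - d / (2 * L)) ^+ 2 + L * (y - d / (2 * L)) ^+ 2 + d ^+ 2 / (2 * L)).
    have iL : 0 <= d ^+ 2 / (2 * L) by rewrite divr_ge0 ?sqr_ge0// mulr_ge0// ltW.
    by apply: addr_ge0 => //; apply: addr_ge0; apply: mulr_ge0; rewrite ?sqr_ge0// ltW.
  by field; rewrite gt_eqF.
by rewrite big_split -mulr_sumr/=; apply: lerD; rewrite // ler_wpM2l// ltW.
Qed.

Let prof k x : R := Phi_lead k * besselP v ((j k * x `^ kap) ^+ 2 / 4).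

Let cvg_prof k : prof k x @[x --> 0^'+] --> Phi_lead k * besselP v 0.
Proof.
apply: cvgM; first exact: cvg_cst.
have h : j k * x `^ kap @[x --> 0^'+] --> 0.
  rewrite -[X in _ --> X](mulr0 (j k)); apply: cvgM; first exact: cvg_cst.
  exact: powR_cvg0 kappa_gt0.
rewrite (_ : besselP v 0 = besselP v (0 ^+ 2 / 4)); last by rewrite expr0n mul0r.
apply: (@continuous_cvg _ _ _ _ _ (fun x => j k * x `^ kap) (fun z : R => besselP v (z ^+ 2 / 4)) 0) => //.
exact: besselP_sq_continuous nu_ge0 0.
Qed.

Let prof_le : exists2 K, 0 < K & forall k x, `|prof k x| <= Phi_lead k * K.
Proof.
have [K K0 hK] := besselP_sq_bounded nu_ge0; exists K => // k x.
rewrite normrM gtr0_norm ?Phi_lead_gt0// ler_wpM2l ?(ltW (Phi_lead_gt0 k))//.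
by apply: hK; rewrite mulr_ge0 ?powR_ge0 ?(ltW (j0 k)).
Qed.

Lemma prof_summable x : csummable (fun k => a k * (prof k x)%:C).
Proof.
have [K K0 hK] := prof_le; have [B hB] := lead_summable.
apply: (@csummable_bounded _ _ (fun k => (`|Re (a k)| + `|Im (a k)|) * Phi_lead k * K) (B * K)).
  by move=> N; rewrite -mulr_suml ler_wpM2r// ltW.
have P0 k := Phi_lead_gt0 k.
move=> k; rewrite (mulrC (a k)) Re_realM Im_realM !(normrM (prof k x)).
rewrite -[X in _ <= X /\ _]mulrA -[X in _ /\ _ <= X]mulrA.
by rewrite !(mulrC (`|Re (a k)| + _)); split; apply: ler_pM; rewrite // ?lerDl ?lerDr.
Qed.

Lemma prof_limit :
  csummable (fun k => a k * (Phi_lead k * besselP v 0)%:C) /\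
  clim0 (fun x => csum (fun k => a k * (prof k x)%:C)) =
    csum (fun k => a k * (Phi_lead k * besselP v 0)%:C).
Proof.
have [K K0 hK] := prof_le; have [B hB] := lead_summable.
have hBK N : \sum_(0 <= k < N) (`|Re (a k)| + `|Im (a k)|) * Phi_lead k * K <= B * K.
  by rewrite -mulr_suml ler_wpM2r// ltW.
have bd (P : R[i] -> R) k x : `|P (a k)| <= `|Re (a k)| + `|Im (a k)| ->
    `|P (a k) * prof k x| <= (`|Re (a k)| + `|Im (a k)|) * Phi_lead k * K.
  by move=> h; rewrite (normrM _ (prof k x)) -mulrA; apply: ler_pM.
have hr k : `|Re (a k)| <= `|Re (a k)| + `|Im (a k)| by rewrite lerDl.
have hi k : `|Im (a k)| <= `|Re (a k)| + `|Im (a k)| by rewrite lerDr.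
have hlim (P : R[i] -> R) k : P (a k) * prof k x @[x --> 0^'+] --> P (a k) * (Phi_lead k * besselP v 0).
  by apply: cvgM; [exact: cvg_cst|exact: cvg_prof].
have tr : limn (series (fun k => Re (a k) * prof k x)) @[x --> 0^'+] -->
    limn (series (fun k => Re (a k) * (Phi_lead k * besselP v 0))).
  by apply: (tannery hBK) (hlim (@complex.Re R)) => k x; exact: bd (hr k).
have ti : limn (series (fun k => Im (a k) * prof k x)) @[x --> 0^'+] -->
    limn (series (fun k => Im (a k) * (Phi_lead k * besselP v 0))).
  by apply: (tannery hBK) (hlim (@complex.Im R)) => k x; exact: bd (hi k).
have er (q : nat -> R) : Re \o (fun k => a k * (q k)%:C) = fun k => Re (a k) * q k.
  by apply/funext => k /=; rewrite mulrC Re_realM mulrC.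
have ei (q : nat -> R) : Im \o (fun k => a k * (q k)%:C) = fun k => Im (a k) * q k.
  by apply/funext => k /=; rewrite mulrC Im_realM mulrC.
split; last first.
  rewrite /clim0 /csum; congr (_ +i* _).
    rewrite er -(cvg_lim _ tr)//; apply: (congr1 (fun F : R -> R => lim (F x @[x --> 0^'+]))); apply/funext => x /=.
    by rewrite er.
  rewrite ei -(cvg_lim _ ti)//; apply: (congr1 (fun F : R -> R => lim (F x @[x --> 0^'+]))); apply/funext => x /=.
  by rewrite ei.
rewrite (_ : (fun k => _) = fun k => a k * (prof k 0)%:C); first exact: prof_summable.
have k0 : 0 `^ kap = 0 :> R by rewrite powR0// gt_eqF// kappa_gt0.
by apply/funext => k; rewrite /prof k0 mulr0 expr0n /= mul0r.
Qed.

End Series.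

(** The limit x -> 0 is taken under the sum: the rescaled eigenfunctions are
    dominated by a multiple of their leading coefficients, uniformly in x. *)
Lemma observe_series W : X1 alpha beta mu W ->
  csummable (fun k => W.1 k * (obs_coef k)%:C) /\
  observe alpha beta mu W = csum (fun k => W.1 k * (obs_coef k)%:C).
Proof.
move=> [hW _]; have [cs hlim] := prof_limit hW.
have [s2 e2] := csumZ obs_factor%:C cs.
have eo : (fun k => W.1 k * (obs_coef k)%:C) = (fun k => obs_factor%:C * (W.1 k * (Phi_lead k * besselP v 0)%:C)).
  by apply/funext => k; rewrite /obs_coef rmorphM mulrCA.
rewrite eo; split => //; rewrite e2 -hlim.
have val x : 0 < x -> (x `^ (- (sig + kap * v)))%:C * value alpha beta mu W.1 x =
    csum (fun k => W.1 k * (Phi_lead k * besselP v ((j k * x `^ kap) ^+ 2 / 4))%:C).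
  move=> x0; have [s3 e3] := csumZ (x `^ (sig + kap * v))%:C (prof_summable hW x).
  have -> : value alpha beta mu W.1 x = (x `^ (sig + kap * v))%:C *
      csum (fun k => W.1 k * (Phi_lead k * besselP v ((j k * x `^ kap) ^+ 2 / 4))%:C).
    rewrite -e3; congr csum; apply/funext => k.
    by rewrite PhiE// rmorphM mulrCA.
  rewrite mulrA -rmorphM powRN mulVf ?mul1r//.
  by rewrite gt_eqF// powR_gt0.
have clim_eq (F G : R -> R[i]) : (forall x, 0 < x -> F x = G x) -> clim0 F = clim0 G.
  move=> FG; rewrite /clim0; congr (_ +i* _);
    apply: (congr1 (fun F : set_system R => lim F)); apply/seteqP; split;
    apply: near_eq_cvg; near=> x; rewrite /= FG//.
rewrite /observe /obs_factor; case: (eqVneq v 0) => [v0|v0].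
  rewrite mul1r; apply: clim_eq => x x0; rewrite -val//.
  by rewrite v0 mulr0 addr0.
congr (_ * _); apply: clim_eq => x x0; rewrite -val//.
by rewrite sqrt_Delta opprD.
Unshelve. all: end_near. Qed.

End Observation.

(** * Integrals of complex series *)

Section Complex_integrals.
Context {R : realType}.
Local Notation leb := (@lebesgue_measure R).
Local Notation integ D f := (leb.-integrable D (EFin \o f)).

Definition integrableC (D : set R) (F : R -> R[i]) :=
  integ D (Re \o F) /\ integ D (Im \o F).

Lemma cintegral_eq (D : set R) (F G : R -> R[i]) : (forall t, D t -> F t = G t) ->
  cintegral D F = cintegral D G.
Proof. by move=> FG; congr (_ +i* _); apply: eq_Rintegral => t /set_mem ht; rewrite FG. Qed.

Variables (t : R) (t0 : 0 <= t).
Let mD : measurable (`[0, t]%classic : set (measurableTypeR R)).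
Proof. exact: measurable_itv. Qed.

Lemma cintegral_lincomb (c d : R[i]) F G H : integrableC `[0, t] F ->
  integrableC `[0, t] G -> (forall r, H r = c * F r + d * G r) ->
  integrableC `[0, t] H /\
  cintegral `[0, t] H = c * cintegral `[0, t] F + d * cintegral `[0, t] G.
Proof.
move=> [fr fi] [gr gi] HE.
have F1 := integ_add mD (integ_scale mD (Re c) fr) (integ_scale mD (- Im c) fi).
have F2 := integ_add mD (integ_scale mD (Re c) fi) (integ_scale mD (Im c) fr).
have G1 := integ_add mD (integ_scale mD (Re d) gr) (integ_scale mD (- Im d) gi).
have G2 := integ_add mD (integ_scale mD (Re d) gi) (integ_scale mD (Im d) gr).
have er : Re \o H = fun r => (Re c * (Re \o F) r + - Im c * (Im \o F) r) + (Re d * (Re \o G) r + - Im d * (Im \o G) r).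
  by apply/funext => r /=; rewrite HE ReD !ReM !mulNr.
have ei : Im \o H = fun r => (Re c * (Im \o F) r + Im c * (Re \o F) r) + (Re d * (Im \o G) r + Im d * (Re \o G) r).
  by apply/funext => r /=; rewrite HE ImD !ImM.
split; first by split; rewrite ?er ?ei; apply: integ_add.
apply: complexP.
  transitivity (\int[leb]_(r in `[0, t]) (Re \o H) r); first by [].
  rewrite er RintegralD// (Rintegral_lincomb mD fr fi (fun r => erefl)).
  by rewrite (Rintegral_lincomb mD gr gi (fun r => erefl)) ReD !ReM !mulNr.
transitivity (\int[leb]_(r in `[0, t]) (Im \o H) r); first by [].
rewrite ei RintegralD// (Rintegral_lincomb mD fi fr (fun r => erefl)).
by rewrite (Rintegral_lincomb mD gi gr (fun r => erefl)) ImD !ImM.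
Qed.

Lemma cintegralZ (c : R[i]) F : integrableC `[0, t] F ->
  cintegral `[0, t] (fun r => F r * c) = cintegral `[0, t] F * c.
Proof.
move=> iF; have [|_ ->] := cintegral_lincomb (c := c) (d := 0) (H := fun r => F r * c) iF iF.
  by move=> r; rewrite mul0r addr0 mulrC.
by rewrite mul0r addr0 mulrC.
Qed.

Lemma Rintegral_series (h : nat -> R -> R) (M : R) :
  (forall k, integ `[0, t] (h k)) ->
  (forall r, 0 <= r <= t -> forall N, \sum_(0 <= k < N) `|h k r| <= M) ->
  cvgn (series (fun k => \int[leb]_(r in `[0, t]) h k r)) /\
  \int[leb]_(r in `[0, t]) limn (series (h ^~ r)) =
    limn (series (fun k => \int[leb]_(r in `[0, t]) h k r)).
Proof.
move=> ih hM; have iM : integ `[0, t] (fun=> M) by apply: integ_continuous => r; exact: cvg_cst.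
have inh k : integ `[0, t] (fun r => `|h k r|) by exact: (integrable_norm (ih k)).
have cs : cvgn (series (fun k => \int[leb]_(r in `[0, t]) h k r)).
  apply: (@abs_cvg_series _ _ (\int[leb]_(r in `[0, t]) M)) => N.
  apply: (@le_trans _ _ (\sum_(0 <= k < N) \int[leb]_(r in `[0, t]) `|h k r|)).
    by apply: ler_sum => k _; apply: le_normr_Rintegral.
  rewrite -(Rintegral_sum mD)//; apply: le_Rintegral => //.
    exact: integ_sum.
  by move=> r /=; rewrite in_itv/= => hr; exact: hM.
split => //.
pose S N r := \sum_(0 <= k < N) h k r.
have iS N : integ `[0, t] (S N) by apply: integ_sum.
have := @dominated_cvg _ _ _ leb _ mD (fun N r => (S N r)%:E)
  (fun r => (limn (series (h ^~ r)))%:E) (cst M%:E).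
move=> /(_ _ _ _ _ _)/wrap[].
- by move=> N; exact: measurable_int (iS N).
- move=> r /=; rewrite in_itv/= => hr; apply: cvg_EFin; first exact: nearW.
  have := hM r hr; move=> /abs_cvg_series; exact.
- by [].
- exact: iM.
- move=> N r /=; rewrite in_itv/= => hr; rewrite lee_fin.
  by apply: le_trans (ler_norm_sum _ _ _) (hM r hr N).
move=> hc; have e N : (\int[leb]_(r in `[0%R, t]) (S N r)%:E)%E =
    (series (fun k => \int[leb]_(r in `[0, t]) h k r) N)%:E.
  rewrite /series/= -(Rintegral_sum mD (index_iota 0 N) ih) /Rintegral fineK//.
  exact: (integrable_fin_num mD (iS N)).
have hc2 : (\int[leb]_(r in `[0%R, t]) (S N r)%:E)%E @[N --> \oo] -->
    (limn (series (fun k => \int[leb]_(r in `[0, t]) h k r)))%:E.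
  under eq_fun do rewrite e; apply: cvg_EFin; first exact: nearW.
  exact: cs.
by rewrite /Rintegral (cvg_unique _ hc hc2).
Qed.

Lemma csum_cintegral (h : nat -> R -> R[i]) (c : R -> nat -> R) (M : R) :
  (forall k, integrableC `[0, t] (h k)) ->
  (forall r, 0 <= r <= t -> forall N, \sum_(0 <= k < N) c r k <= M) ->
  (forall r, 0 <= r <= t -> forall k, `|Re (h k r)| <= c r k /\ `|Im (h k r)| <= c r k) ->
  csummable (fun k => cintegral `[0, t] (h k)) /\
  cintegral `[0, t] (fun r => csum (h ^~ r)) = csum (fun k => cintegral `[0, t] (h k)).
Proof.
move=> ih hM hc.
have [|c1 e1] := @Rintegral_series (fun k => Re \o h k) M (fun k => (ih k).1).
  move=> r hr N; apply: le_trans (hM r hr N); apply: ler_sum => k _.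
  by have [] := hc r hr k.
have [|c2 e2] := @Rintegral_series (fun k => Im \o h k) M (fun k => (ih k).2).
  move=> r hr N; apply: le_trans (hM r hr N); apply: ler_sum => k _.
  by have [] := hc r hr k.
by split => //; congr (_ +i* _).
Qed.

End Complex_integrals.

Section Control_problem.
Context {R : realType} (alpha beta mu : R).
Hypothesis alpha_lt2 : alpha < 2.
Local Notation v := (nu alpha beta mu).
Local Notation lam := (lambda alpha beta mu).
Local Notation coefs := (nat -> R[i]).
Local Notation state := ((nat -> R[i]) * (nat -> R[i]))%type.
Local Notation leb := (@lebesgue_measure R).
Local Notation ctrl := (ctrl_coef alpha beta mu).
Local Notation obs := (obs_coef alpha beta mu).
Local Notation single k := (fun i : nat => if i == k then (1 : R[i]) else 0).
Local Notation null := (fun=> 0 : R[i]).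

Let lam0 k : 0 < lam k. Proof. exact: lambda_gt0. Qed.

Let v12 : v + 1 / 2 = v - 1 / 2 + 1. Proof. by field. Qed.
Let v32 : v + 3 / 2 = v + 1 / 2 + 1. Proof. by field. Qed.

Lemma Hspace0 s : Hspace lam s null.
Proof. by apply/HspaceP; exists 0 => N; rewrite big1// => k _; rewrite sqrmod0 mulr0. Qed.

Lemma innerH0l s a : innerH lam s null a = 0.
Proof.
by apply: csum0 => k; rewrite mulr0 mul0r.
Qed.

Lemma innerH0r s a : innerH lam s a null = 0.
Proof.
by apply: csum0 => k; rewrite conjc0 mulr0.
Qed.

Lemma X1_single1 k : X1 alpha beta mu (single k, null).
Proof. by split; [exact: Hspace_single|exact: Hspace0]. Qed.

Lemma X1_single2 k : X1 alpha beta mu (null, single k).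
Proof. by split; [exact: Hspace0|exact: Hspace_single]. Qed.

Lemma innerX_single1 V k :
  innerX alpha beta mu V (single k, null) = (lam k `^ (v + 1 / 2))%:C * V.1 k.
Proof. by rewrite /innerX /= innerH0r addr0 innerH_single conjc1 mulr1. Qed.

Lemma innerX_single2 V k :
  innerX alpha beta mu V (null, single k) = (lam k `^ (v - 1 / 2))%:C * V.2 k.
Proof. by rewrite /innerX /= innerH0r add0r innerH_single conjc1 mulr1. Qed.

Lemma observe_single1 k : observe alpha beta mu (single k, null) = (obs k)%:C.
Proof.
have [_ ->] := observe_series alpha_lt2 (X1_single1 k).
rewrite -(csum_single k (obs k)%:C); congr csum; apply/funext => i /=.
by case: eqP => [->|_]; rewrite ?mul1r ?mul0r.
Qed.

Lemma observe_single2 k : observe alpha beta mu (null, single k) = 0.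
Proof.
have [_ ->] := observe_series alpha_lt2 (X1_single2 k).
by apply: csum0 => i /=; rewrite mul0r.
Qed.

Let weight_neq0 s k : (lam k `^ s)%:C != 0 :> R[i].
Proof. by rewrite fmorph_eq0 gt_eqF// powR_gt0. Qed.

(** This sequence has the defining property of the control operator, and pairing
    with single modes leaves no other choice. *)
Lemma controlE c : control alpha beta mu c = ((fun k => c * (ctrl k)%:C), null).
Proof.
apply: xget_unique.
  split.
    split; last exact: Hspace0.
    have [r0 [r1 [r00 hr]]] := ctrl_coef_bounds beta mu alpha_lt2.
    have [B hB] := sum_inverse_lambda beta mu alpha_lt2.
    apply: (@Hspace_le _ _ _ _ (fun k => sqrmod c * r1 * (lam k)^-1) (sqrmod c * r1 * B)).
      move=> N; rewrite -mulr_sumr ler_wpM2l// mulr_ge0 ?sqrmod_ge0//.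
      by have /andP[h1 h2] := hr 0%N; apply: le_trans (le_trans h1 h2); exact: ltW.
    move=> k /=; rewrite (mulrC c) sqrmod_realM ler_pdivlMr//.
    have /andP[_ h] := hr k.
    rewrite [leLHS](_ : _ = sqrmod c * (lam k `^ (v - 1 / 2) * lam k * ctrl k ^+ 2)); last by ring.
    by rewrite ler_wpM2l ?sqrmod_ge0.
  move=> W hW; have [s1 e1] := observe_series alpha_lt2 hW.
  have [s2 e2] := csum_conj s1; have [_ e3] := csumZ c s2.
  rewrite /innerX /= innerH0l addr0 e1 -e2 -e3; congr csum; apply/funext => k.
  rewrite conjc_mul_real -(lambda_ctrl_coef beta mu alpha_lt2).
  by rewrite (rmorphM _ (lam k `^ _) (ctrl k)) /=; move: (_%:C) (_%:C) => x y; ring.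
move=> V [_ hV].
have h1 k := hV _ (X1_single1 k); have h2 k := hV _ (X1_single2 k).
case: V hV h1 h2 => V1 V2 _ h1 h2; congr pair; apply/funext => k.
  apply: (mulfI (weight_neq0 (v + 1 / 2) k)); have := h1 k.
  rewrite innerX_single1 observe_single1 conjc_real => ->.
  by rewrite mulrCA -(rmorphM _ (lam k `^ _) (ctrl k)) lambda_ctrl_coef.
apply: (mulfI (weight_neq0 (v - 1 / 2) k)); have := h2 k.
by rewrite innerX_single2 observe_single2 conjc0 !mulr0.
Qed.

End Control_problem.

(** * Weak solutions *)

Section Weak_solutions.
Context {R : realType} (alpha beta mu : R).
Hypothesis alpha_lt2 : alpha < 2.
Local Notation v := (nu alpha beta mu).
Local Notation lam := (lambda alpha beta mu).
Local Notation om k := (Num.sqrt (lam k)).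
Local Notation state := ((nat -> R[i]) * (nat -> R[i]))%type.
Local Notation leb := (@lebesgue_measure R).
Local Notation ctrl := (ctrl_coef alpha beta mu).
Local Notation obs := (obs_coef alpha beta mu).
Local Notation single k := (fun i : nat => if i == k then (1 : R[i]) else 0).
Local Notation null := (fun=> 0 : R[i]).
Variables (T : R) (T0 : 0 < T).

Let lam0 k : 0 < lam k. Proof. exact: lambda_gt0. Qed.
Let v12 : v + 1 / 2 = v - 1 / 2 + 1. Proof. by field. Qed.

Lemma input_mapE t f : square_integrableC 0 t f ->
  input_map alpha beta mu t f = wave_group lam t (input_state lam ctrl f 0 t).
Proof.
move=> hf; rewrite -(duhamel_formula lam0 ctrl hf) /input_map.
by congr pair; apply/funext => k; congr cintegral; apply/funext => r; rewrite controlE.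
Qed.

Lemma mild_solutionE U0 f t : square_integrableC 0 t f ->
  mild_solution alpha beta mu U0 f t = trajectory lam ctrl f U0 t.
Proof. by move=> hf; rewrite /mild_solution input_mapE// /trajectory wave_groupDr. Qed.

Lemma L2P f : L2 T f <-> square_integrableC 0 T f.
Proof.
have mD : measurable (`]0, T[%classic : set (measurableTypeR R)) by exact: measurable_itv.
have mE : measurable (`[0, T]%classic : set (measurableTypeR R)) by exact: measurable_itv.
have sub : `]0, T[ `<=` `[0, T] by move=> x /=; rewrite !in_itv/= => /andP[/ltW-> /ltW->].
have mcl (g : R -> R) : measurable_fun `]0, T[ g -> measurable_fun `[0, T] g.
  by move=> mg; apply/measurable_fun_itv_obnd_cbndP; apply/measurable_fun_itv_bndo_bndcP.
split=> [[mr mi hlt]|[[mr ir] [mi ii]]]; last first.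
  split; [exact: measurable_funS mr|exact: measurable_funS mi|].
  have /integrableP[_ h] := integrableS mE mD sub (integ_add mE ir ii).
  apply: le_lt_trans h; rewrite le_eqVlt; apply/orP; left; apply/eqP.
  by apply: eq_integral => x _; rewrite /= ger0_norm// addr_ge0 ?sqr_ge0.
have ms : measurable_fun `]0, T[ (fun t => sqrmod (f t)).
  by apply: measurable_funD; apply: measurable_funX.
have io : leb.-integrable `]0, T[ (EFin \o (fun t => sqrmod (f t))).
  apply/integrableP; split; first exact/measurable_EFinP.
  apply: le_lt_trans hlt; rewrite le_eqVlt; apply/orP; left; apply/eqP.
  by apply: eq_integral => x _; rewrite /= ger0_norm// sqrmod_ge0.
have ic : leb.-integrable `[0, T] (EFin \o (fun t => sqrmod (f t))).
  apply/integrableP; split; first by apply/measurable_EFinP; exact: mcl.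
  have /integrableP[mo h] := io; apply: le_lt_trans h.
  by rewrite (@integral_itv_bndoo _ 0 T _ true false)//; exact: measurableT_comp.
split; split; [exact: mcl| |exact: mcl|].
  apply: (integ_dominated mE _ ic) => [|x _]; first by apply: measurable_funX; exact: mcl.
  by rewrite ger0_norm ?sqr_ge0// lerDl sqr_ge0.
apply: (integ_dominated mE _ ic) => [|x _]; first by apply: measurable_funX; exact: mcl.
by rewrite ger0_norm ?sqr_ge0// lerDr sqr_ge0.
Qed.

Definition X_continuous (V : R -> state) := forall t, t \in `[0, T] ->
  sqnormX alpha beta mu (V s - V t) @[s --> within `[0, T] (nbhs t)] --> 0%E.

Lemma coordinate_continuous (V : R -> state) k : X_continuous V ->
  [/\ {within `[0, T], continuous (fun t => Re ((V t).1 k))},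
      {within `[0, T], continuous (fun t => Im ((V t).1 k))},
      {within `[0, T], continuous (fun t => Re ((V t).2 k))} &
      {within `[0, T], continuous (fun t => Im ((V t).2 k))}].
Proof.
move=> cV.
have key (P : state -> R) (w : R) : 0 < w ->
    (forall U, w * P U ^+ 2 <= mode_energy lam (v - 1 / 2) U k) ->
    (forall U W, P (U - W) = P U - P W) ->
    {within `[0, T], continuous (fun t => P (V t))}.
  move=> w0 hP PB; apply/subspace_continuousP => t ht.
  have ht' : t \in `[0, T] by exact: ht.
  have := cV t ht'; rewrite /sqnormX v12 => hc.
  apply/cvgrPdist_lt => e e0.
  have we : (0 < (w * e ^+ 2)%:E)%E by rewrite lte_fin mulr_gt0// exprn_gt0.
  have hn : \forall s \near within `[0, T] (nbhs t), (sqnormH lam (v - 1 / 2 + 1) (V s - V t).1%R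
      + sqnormH lam (v - 1 / 2) (V s - V t).2%R < (w * e ^+ 2)%:E)%E by exact: (hc _ (open_ereal_lt' we)).
  apply: filterS hn => s /= hs.
  have h2 : w * P (V s - V t) ^+ 2 < w * e ^+ 2.
    rewrite -lte_fin; apply: le_lt_trans hs.
    apply: le_trans (mode_energy_le lam0 (v - 1 / 2) (V s - V t) k).
    by rewrite lee_fin; exact: hP.
  rewrite distrC -PB -ltr_sqr ?nnegrE ?normr_ge0 ?(ltW e0)// real_normK ?num_real//.
  by rewrite -(ltr_pM2l w0).
have l0 := lam0 k; have L0 : 0 < lam k `^ (v - 1 / 2) by rewrite powR_gt0.
have lq z : 0 <= lam k * sqrmod z by apply: mulr_ge0; [exact: ltW|exact: sqrmod_ge0].
split.
- apply: (key (fun U => Re (U.1 k)) (lam k `^ (v - 1 / 2) * lam k)) => [|U|U W].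
  + by rewrite mulr_gt0.
  + rewrite /mode_energy -mulrA ler_wpM2l ?(ltW L0)// -[leLHS]addr0 lerD ?sqrmod_ge0//.
    by rewrite ler_wpM2l ?(ltW l0)// lerDl sqr_ge0.
  + exact: ReB.
- apply: (key (fun U => Im (U.1 k)) (lam k `^ (v - 1 / 2) * lam k)) => [|U|U W].
  + by rewrite mulr_gt0.
  + rewrite /mode_energy -mulrA ler_wpM2l ?(ltW L0)// -[leLHS]addr0 lerD ?sqrmod_ge0//.
    by rewrite ler_wpM2l ?(ltW l0)// lerDr sqr_ge0.
  + exact: ImB.
- apply: (key (fun U => Re (U.2 k)) (lam k `^ (v - 1 / 2))) => [|U|U W] //.
  + rewrite /mode_energy ler_wpM2l ?(ltW L0)// -[leLHS]add0r lerD ?lq//.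
    by rewrite lerDl sqr_ge0.
  + exact: ReB.
- apply: (key (fun U => Im (U.2 k)) (lam k `^ (v - 1 / 2))) => [|U|U W] //.
  + rewrite /mode_energy ler_wpM2l ?(ltW L0)// -[leLHS]add0r lerD ?lq//.
    by rewrite lerDr sqr_ge0.
  + exact: ImB.
Qed.

Lemma coordinate_integrable (V : R -> state) k t : X_continuous V -> t <= T ->
  integrableC `[0, t] (fun s => (V s).1 k) /\ integrableC `[0, t] (fun s => (V s).2 k).
Proof.
move=> cV tT; have [c1 c2 c3 c4] := coordinate_continuous k cV.
have sub : `[0, t] `<=` `[0, T] by move=> x /=; rewrite !in_itv/= => /andP[-> h]; exact: le_trans tT.
have i (g : R -> R) : {within `[0, T], continuous g} -> leb.-integrable `[0, t] (EFin \o g).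
  move=> cg; apply: continuous_compact_integrable; first exact: segment_compact.
  exact: continuous_subspaceW sub cg.
by split; split; exact: i.
Qed.

End Weak_solutions.

Section Weak_identity.
Context {R : realType} (alpha beta mu : R).
Hypothesis alpha_lt2 : alpha < 2.
Local Notation v := (nu alpha beta mu).
Local Notation lam := (lambda alpha beta mu).
Local Notation om k := (Num.sqrt (lam k)).
Local Notation state := ((nat -> R[i]) * (nat -> R[i]))%type.
Local Notation leb := (@lebesgue_measure R).
Local Notation ctrl := (ctrl_coef alpha beta mu).
Local Notation obs := (obs_coef alpha beta mu).
Local Notation single k := (fun i : nat => if i == k then (1 : R[i]) else 0).
Local Notation null := (fun=> 0 : R[i]).
Variables (T : R) (T0 : 0 < T).

Let lam0 k : 0 < lam k. Proof. exact: lambda_gt0. Qed.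
Let v12 : v + 1 / 2 = v - 1 / 2 + 1. Proof. by field. Qed.
Let v32 : v + 3 / 2 = v + 1 / 2 + 1. Proof. by field. Qed.

Lemma weak_solution_ext U0 f (U V : R -> state) :
  (forall t, 0 <= t <= T -> V t = U t) ->
  weak_solution alpha beta mu T U0 f U -> weak_solution alpha beta mu T U0 f V.
Proof.
move=> VU [hX hc hw]; split.
- by move=> t ht; rewrite VU//; exact: hX.
- move=> t ht; apply: cvg_trans (hc t ht); apply: near_eq_cvg.
  rewrite near_withinE; apply: nearW => s hs; rewrite !VU//.
- move=> W hW t ht; have ht' : 0 <= t <= T by [].
  rewrite (VU t ht') (hw W hW t ht); apply: (congr1 (fun z => z + _)); apply: cintegral_eq => s hs.
  suff -> : V s = U s by [].
  apply: VU; move: hs ht'; rewrite /= in_itv/= => /andP[-> h] /andP[_ h'].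
  exact: le_trans h h'.
Qed.

Lemma omega_well_spaced : exists2 g, 0 < g & well_spaced g (fun k => om k).
Proof.
have k0 := kappa_gt0 alpha_lt2.
have j0 := bessel_zero_gt0 (nu_ge0 beta mu alpha_lt2) 0.
have [g g0 hg] := bessel_zero_gap (nu_ge0 beta mu alpha_lt2).
have kj : 0 < kappa alpha * bessel_zero v 0 by rewrite mulr_gt0.
have kg : 0 < kappa alpha * g by rewrite mulr_gt0.
exists (Num.min (kappa alpha * g) (kappa alpha * bessel_zero v 0)).
  by rewrite lt_min kg.
split=> [|k]; rewrite !sqrt_lambda//.
  have : Num.min (kappa alpha * g) (kappa alpha * bessel_zero v 0) <= kappa alpha * bessel_zero v 0.
    by rewrite ge_min lexx orbT.
  lra.
apply: (@le_trans _ _ (kappa alpha * (bessel_zero v k + g))); last by rewrite ler_wpM2l// ltW.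
by rewrite mulrDr lerD2l ge_min lexx.
Qed.

Lemma XP U : X alpha beta mu U <-> Hspace lam (v - 1 / 2 + 1) U.1 /\ Hspace lam (v - 1 / 2) U.2.
Proof. by rewrite /X -v12. Qed.

Lemma Hspace_succ s a : Hspace lam (s + 1) a -> Hspace lam s a.
Proof.
have [C hC] := sum_inverse_lambda beta mu alpha_lt2.
move=> /HspaceP[B hB]; apply: (@Hspace_le _ _ _ _ (fun k => C * (lam k `^ (s + 1) * sqrmod (a k))) (C * B)).
  move=> N; rewrite -mulr_sumr ler_wpM2l//.
  by have := hC 0%N; rewrite big_geq.
move=> k; have l0 := lam0 k; rewrite (powR_succ lam0).
have hk : (lam k)^-1 <= C.
  apply: le_trans (hC k.+1); rewrite big_nat_recr//= lerDr sumr_ge0// => i _.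
  by rewrite invr_ge0 ltW.
move: (lam k) l0 (powR_ge0 (lam k) s) (sqrmod_ge0 (a k)) hk => l l0 L0 q0 hk.
have h1 : 1 <= C * l by rewrite -ler_pdivrMr// div1r.
rewrite [leRHS](_ : _ = C * l * (l `^ s * sqrmod (a k))); last by ring.
by rewrite ler_peMl// mulr_ge0.
Qed.

Section Trajectory_weak.
Variables (U0 : state) (f : R -> R[i]).
Hypotheses (hU0 : X alpha beta mu U0) (hf : square_integrableC 0 T f).
Let U := trajectory lam ctrl f U0.

Lemma trajectory_X t : 0 <= t <= T -> X alpha beta mu (U t).
Proof.
move=> ht; have [g g0 hg] := omega_well_spaced.
have [r0 [r1 [r00 hr]]] := ctrl_coef_bounds beta mu alpha_lt2.
have hr1 k : lam k `^ (v - 1 / 2) * lam k * ctrl k ^+ 2 <= r1 by have /andP[] := hr k.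
have [h1 h2] := (XP _).1 hU0.
by apply/XP; exact: (trajectory_finite_energy lam0 hr1 T0 g0 hg hf h1 h2 ht).
Qed.

Lemma trajectory_X_continuous : X_continuous alpha beta mu T U.
Proof.
move=> t ht; have [g g0 hg] := omega_well_spaced.
have [r0 [r1 [r00 hr]]] := ctrl_coef_bounds beta mu alpha_lt2.
have hr1 k : lam k `^ (v - 1 / 2) * lam k * ctrl k ^+ 2 <= r1 by have /andP[] := hr k.
have [h1 h2] := (XP _).1 hU0.
have := trajectory_continuous lam0 hr1 T0 g0 hg hf h1 h2 (t := t) ht.
by rewrite /sqnormX v12.
Qed.

Lemma trajectory_energy_bound : exists B, forall t, 0 <= t <= T -> forall N,
  \sum_(0 <= k < N) mode_energy lam (v - 1 / 2) (U t) k <= B.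
Proof.
have [g g0 hg] := omega_well_spaced.
have [r0 [r1 [r00 hr]]] := ctrl_coef_bounds beta mu alpha_lt2.
have hr1 k : lam k `^ (v - 1 / 2) * lam k * ctrl k ^+ 2 <= r1 by have /andP[] := hr k.
have [h1 h2] := (XP _).1 hU0.
exact: (trajectory_bound lam0 hr1 T0 g0 hg hf h1 h2).
Qed.

(** The pairing with a fixed state is integrated term by term.  The terms are
    dominated by the half sum of the two mode energies, whose sums over the
    modes are bounded uniformly in time. *)
Lemma trajectory_pairing W' t : X alpha beta mu W' -> 0 <= t <= T ->
  let h k := (lam k `^ (v + 1 / 2))%:C * cintegral `[0, t] (fun r => (U r).1 k) * conjc (W'.1 k)
    + (lam k `^ (v - 1 / 2))%:C * cintegral `[0, t] (fun r => (U r).2 k) * conjc (W'.2 k) in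
  csummable h /\ cintegral `[0, t] (fun r => innerX alpha beta mu (U r) W') = csum h.
Proof.
move=> hW /andP[t0 tT] h; have [B hB] := trajectory_energy_bound.
have /(finite_energyP lam0)[C hC] := (XP W').1 hW.
have iU k := coordinate_integrable alpha_lt2 k trajectory_X_continuous tT.
pose H k r := (lam k `^ (v + 1 / 2))%:C * (U r).1 k * conjc (W'.1 k)
    + (lam k `^ (v - 1 / 2))%:C * (U r).2 k * conjc (W'.2 k).
have lc k : integrableC `[0, t] (H k) /\ cintegral `[0, t] (H k) = h k.
  have HE r : H k r = ((lam k `^ (v + 1 / 2))%:C * conjc (W'.1 k)) * (U r).1 k
      + ((lam k `^ (v - 1 / 2))%:C * conjc (W'.2 k)) * (U r).2 k.
    by rewrite /H; congr (_ + _); rewrite mulrAC.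
  have [i1 ->] := cintegral_lincomb (iU k).1 (iU k).2 HE.
  by split => //; rewrite /h; congr (_ + _); rewrite mulrAC.
have bd r : 0 <= r <= t -> forall k, `|Re (H k r)| <= (mode_energy lam (v - 1 / 2) (U r) k + mode_energy lam (v - 1 / 2) W' k) / 2
    /\ `|Im (H k r)| <= (mode_energy lam (v - 1 / 2) (U r) k + mode_energy lam (v - 1 / 2) W' k) / 2.
  by move=> hr k; rewrite /H v12; exact: mode_pairing_le.
have [|c1 e1] := csum_cintegral (h := H) (fun k => (lc k).1) (M := (B + C) / 2) _ bd.
  move=> r /andP[r0 rt] N; rewrite -mulr_suml big_split/= ler_wpM2r// lerD//.
  by apply: hB; rewrite r0 (le_trans rt).
have hE : (fun k => cintegral `[0, t] (H k)) = h by apply/funext => k; exact: (lc k).2.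
rewrite hE in c1 e1; split => //; rewrite -e1; apply: cintegral_eq => r /= hr.
have hr' : 0 <= r <= T by move: hr; rewrite in_itv/= => /andP[-> h']; exact: le_trans tT.
have [hU1 hU2] := trajectory_X hr'; have [hW1 hW2] := hW.
have [_ e] := csumD (innerH_summable hU1 hW1) (innerH_summable hU2 hW2).
exact: esym e.
Qed.

(** Summing the integral equations of the modes, weighted by the coordinates of
    the test state. *)
Lemma trajectory_weak : weak_solution alpha beta mu T U0 f U.
Proof.
split; [by move=> t ht; exact: trajectory_X|exact: trajectory_X_continuous|].
move=> W [hW1 hW2] t ht; have ht' : 0 <= t <= T by [].
have /andP[t0 tT] := ht'.
have [so eo] := observe_series alpha_lt2 (conj hW1 hW2 : X1 alpha beta mu W).
have [sc ec] := csum_conj so.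
have hf' : integrableC `[0, t] f.
  have sub : `[0, t] `<=` `[0, T] by move=> x /=; rewrite !in_itv/= => /andP[-> h]; exact: le_trans tT.
  have [h1 h2] := square_integrableC_sub sub hf.
  by split; exact: square_integrable_integ.
have -> : cintegral `[0, t] (fun s => f s * conjc (observe alpha beta mu W)) =
    csum (fun k => cintegral `[0, t] f * conjc (W.1 k * (obs k)%:C)).
  by rewrite (cintegralZ _ hf') eo -ec; have [_ ->] := csumZ (cintegral `[0, t] f) sc.
have hW' : X alpha beta mu (- wave_op lam W).
  split; first by exact: HspaceN hW2.
  have /HspaceP[B hB] := hW1.
  apply: (Hspace_le (p := fun k => lam k `^ (v + 3 / 2) * sqrmod (W.1 k))).
    exact: hB.
  move=> k; rewrite /opA /= !fctE opprK sqrmod_realM v32 (powR_succ lam0) v12 (powR_succ lam0).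
  by move: (lam k) (lam k `^ _) (sqrmod _) => x y z; rewrite (_ : y * x * x * z = y * (x ^+ 2 * z)) //; ring.
have [sp ->] := trajectory_pairing hW' ht'.
have [_ <-] := csumD sp (csumZ (cintegral `[0, t] f) sc).1.
have hD : X alpha beta mu (U t - U0).
  have [u1 u2] := trajectory_X ht'; have [z1 z2] := hU0.
  by split; [exact: HspaceD u1 (HspaceN z1)|exact: HspaceD u2 (HspaceN z2)].
have hWX : X alpha beta mu W.
  by split; apply: Hspace_succ; rewrite -?v32 -?v12.
have [_ e] := csumD (innerH_summable hD.1 hWX.1) (innerH_summable hD.2 hWX.2).
apply: (etrans (esym e)) => {e}.
congr csum; apply/funext => k; have [e1 e2] := trajectory_equation lam0 ctrl hf U0 k ht'.
have -> : (U t - U0).1 k = (U t).1 k - U0.1 k by [].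
have -> : (U t - U0).2 k = (U t).2 k - U0.2 k by [].
have -> : (- wave_op lam W).1 k = - W.2 k by [].
have -> : (- wave_op lam W).2 k = (lam k)%:C * W.1 k by rewrite -[RHS]opprK.
rewrite e1 e2 conjc_mul_real -(lambda_ctrl_coef beta mu alpha_lt2) v12 (powR_succ lam0).
rewrite [(lam k)%:C * W.1 k]mulrC conjc_mul_real.
have -> : conjc (- W.2 k) = - conjc (W.2 k) by case: (W.2 k) => x y.
rewrite -/U !(rmorphM _ (lam k `^ _ * _)) !(rmorphM _ (lam k `^ _)) /=.
move: (_%:C) (_%:C) (_%:C) (cintegral _ _) (cintegral _ _) (cintegral _ _) (conjc _) (conjc _).
by move=> *; ring.
Qed.

End Trajectory_weak.
End Weak_identity.

(** * Uniqueness of weak solutions *)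

Section Homogeneous_mode.
Context {R : realType}.
Local Notation leb := (@lebesgue_measure R).
Variables (w T : R) (p q : R -> R).
Hypotheses (w0 : w != 0) (cp : {within `[0, T], continuous p})
  (cq : {within `[0, T], continuous q})
  (hp : forall t, 0 <= t <= T -> p t = \int[leb]_(r in `[0, t]) q r)
  (hq : forall t, 0 <= t <= T -> q t = - w ^+ 2 * \int[leb]_(r in `[0, t]) p r).

Let dlin (t : R) : is_derive t (1 : R) (fun r => w * r) w.
Proof. by apply: (is_derive_eq (isd_scale w (isd_id t))); rewrite mulr1. Qed.
Let dsin t : is_derive t (1 : R) (fun r => w^-1 * sin (w * r)) (cos (w * t)).
Proof.
apply: (is_derive_eq (isd_scale w^-1 (isd_comp (is_derive_sin _) (dlin t)))).
by field.
Qed.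
Let dcos t : is_derive t (1 : R) (fun r => - w^-1 * cos (w * r)) (sin (w * t)).
Proof.
apply: (is_derive_eq (isd_scale (- w^-1) (isd_comp (is_derive_cos _) (dlin t)))).
by field.
Qed.

(** Integrating by parts against cos and sin shows that the two functions
    solve the integrated equations only if they vanish. *)
Lemma homogeneous_mode t : 0 <= t <= T -> p t = 0 /\ q t = 0.
Proof.
move=> ht; have /andP[t0 tT] := ht.
have mD : measurable (`[0, t]%classic : set (measurableTypeR R)) by exact: measurable_itv.
have sub : `[0, t] `<=` `[0, T] by move=> x /=; rewrite !in_itv/= => /andP[-> h]; exact: le_trans tT.
have ci (g : R -> R) : {within `[0, T], continuous g} -> leb.-integrable `[0, t] (EFin \o g).
  move=> cg; apply: continuous_compact_integrable; first exact: segment_compact.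
  exact: continuous_subspaceW sub cg.
have ip := ci _ cp; have iq := ci _ cq.
have cc := @continuous_cosM R w; have sc := @continuous_sinM R w.
have mul (phi g : R -> R) : continuous phi -> {within `[0, T], continuous g} ->
    leb.-integrable `[0, t] (EFin \o (fun r => phi r * g r)).
  by move=> cphi cg; apply: ci => r; apply: cvgM; [exact: (continuous_subspaceT cphi)|exact: cg].
have dom r : `[0, t]%classic r -> 0 <= r <= T.
  by move=> /sub; rewrite /= in_itv.
have ep (phi : R -> R) : \int[leb]_(r in `[0, t]) (phi r * p r) =
    \int[leb]_(r in `[0, t]) (phi r * \int[leb]_(u in `[0, r]) q u).
  by apply: eq_Rintegral => r /set_mem/dom hr; rewrite -hp.
have eq (phi : R -> R) : continuous phi -> \int[leb]_(r in `[0, t]) (phi r * q r) =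
    - w ^+ 2 * \int[leb]_(r in `[0, t]) (phi r * \int[leb]_(u in `[0, r]) p u).
  move=> cphi; rewrite -RintegralZl//.
    by apply: eq_Rintegral => r /set_mem/dom hr; rewrite {1}hq//; ring.
  apply: continuous_compact_integrable; first exact: segment_compact.
  move=> r; apply: cvgM; first exact: (continuous_subspaceT cphi).
  exact: (parameterized_integral_continuous t0 ip).
have lin (c : R) (phi g : R -> R) : continuous phi -> {within `[0, T], continuous g} ->
    \int[leb]_(r in `[0, t]) (c * phi r * g r) = c * \int[leb]_(r in `[0, t]) (phi r * g r).
  move=> cphi cg; rewrite -RintegralZl//; last exact: mul.
  by apply: eq_Rintegral => r _; rewrite mulrA.
have e1 := Fubini_parts t0 cc dsin iq; have e2 := Fubini_parts t0 sc dcos iq.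
have e3 := Fubini_parts t0 cc dsin ip; have e4 := Fubini_parts t0 sc dcos ip.
rewrite -ep -hp// lin// in e1; rewrite -ep -hp// lin// in e2.
rewrite lin// in e3; rewrite lin// in e4.
have e5 := eq _ cc; have e6 := eq _ sc; rewrite e3 in e5; rewrite e4 in e6.
have e7 := hq ht.
move: e1 e2 e5 e6 e7 (cos2Dsin2 (w * t)) w0; clear.
move: (\int[_]_(_ in _) p _) (\int[_]_(_ in _) (cos _ * p _)) (\int[_]_(_ in _) (sin _ * p _))
  (\int[_]_(_ in _) (cos _ * q _)) (\int[_]_(_ in _) (sin _ * q _)).
move: (p t) (q t) (cos (w * t)) (sin (w * t)) => x y c s X cP sP cQ sQ e1 e2 e3 e4 ey cs w0.
have e2' : w * sP = - c * x + cQ by rewrite e2; field.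
have e1' : w * cP = s * x - sQ by rewrite e1; field.
have e3' : w * cQ = s * y + w * (w * sP) by rewrite ey e3; field.
have e4' : w * sQ = - c * y - w * (w * cP) by rewrite ey e4; field.
have h1 : s * y = w * c * x by rewrite e2' in e3'; lra.
have h2 : c * y = - w * s * x by rewrite e1' in e4'; lra.
have hy : y = 0.
  transitivity (c * (c * y) + s * (s * y)); last by rewrite h1 h2; ring.
  by rewrite -[LHS]mul1r -cs; ring.
split => //; apply: (mulfI w0); rewrite mulr0.
transitivity (c * (w * c * x) - s * (- w * s * x)); last by rewrite -h1 -h2 hy; ring.
by rewrite -[LHS]mulr1 -cs; ring.
Qed.

End Homogeneous_mode.

Section Uniqueness.
Context {R : realType} (alpha beta mu : R).
Hypothesis alpha_lt2 : alpha < 2.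
Local Notation v := (nu alpha beta mu).
Local Notation lam := (lambda alpha beta mu).
Local Notation state := ((nat -> R[i]) * (nat -> R[i]))%type.
Local Notation leb := (@lebesgue_measure R).
Local Notation single k := (fun i : nat => if i == k then (1 : R[i]) else 0).
Local Notation null := (fun=> 0 : R[i]).
Variables (T : R) (T0 : 0 < T) (U0 : state) (f : R -> R[i]).

Let lam0 k : 0 < lam k. Proof. exact: lambda_gt0. Qed.
Let v12 : v + 1 / 2 = v - 1 / 2 + 1. Proof. by field. Qed.

(** The weak formulation tested with a single mode.  The last terms only depend
    on the control, so that they cancel in the difference of two solutions. *)
Lemma weak_solution_mode (V : R -> state) k t : weak_solution alpha beta mu T U0 f V ->
  0 <= t <= T ->
  (V t).1 k = U0.1 k + cintegral `[0, t] (fun r => (V r).2 k)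
    + ((lam k `^ (v + 1 / 2))%:C)^-1 * cintegral `[0, t] (fun s => f s * conjc (observe alpha beta mu (single k, null))) /\
  (V t).2 k = U0.2 k - (lam k)%:C * cintegral `[0, t] (fun r => (V r).1 k)
    + ((lam k `^ (v - 1 / 2))%:C)^-1 * cintegral `[0, t] (fun s => f s * conjc (observe alpha beta mu (null, single k))).
Proof.
move=> [hX cV hw] ht; have /andP[t0 tT] := ht.
have [i1 i2] := coordinate_integrable alpha_lt2 k cV tT.
have w0 (s : R) : (lam k `^ s)%:C != 0 :> R[i] by rewrite fmorph_eq0 gt_eqF// powR_gt0.
have eW1 : - wave_op lam (single k, null) = (null, fun i => if i == k then (lam k)%:C else 0).
  congr pair; apply/funext => i; rewrite /= !fctE; first by rewrite oppr0.
  by rewrite opprK /opA; case: eqP => [->|_]; rewrite ?mulr1 ?mulr0.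
have eW2 : - wave_op lam (null, single k) = (fun i => if i == k then -1 else 0, null).
  congr pair; apply/funext => i; rewrite /= !fctE; first by case: eqP => _; rewrite ?oppr0.
  by rewrite opprK /opA mulr0.
have c1 (z : R[i]) F : integrableC `[0, t] F ->
    cintegral `[0, t] (fun r => z * F r) = z * cintegral `[0, t] F.
  by move=> iF; rewrite mulrC -cintegralZ//; apply: cintegral_eq => r _; rewrite mulrC.
split.
  have := hw _ (X1_single1 alpha beta mu k) t ht; rewrite innerX_single1 eW1 => e.
  apply: (mulfI (w0 (v + 1 / 2))); rewrite mulrDr mulVKf// mulrDr.
  have -> : (V t).1 k = (V t - U0).1 k + U0.1 k by rewrite -[X in _ = X + _]/((V t).1 k - U0.1 k) subrK.
  rewrite mulrDr e addrAC; congr (_ + _); rewrite addrC; congr (_ + _).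
  rewrite v12 (powR_succ lam0) -c1//; apply: cintegral_eq => r _.
  rewrite /innerX /= innerH0r add0r innerH_single conjc_real (rmorphM _ (lam k `^ _) (lam k)).
  by rewrite /= mulrAC.
have := hw _ (X1_single2 alpha beta mu k) t ht; rewrite innerX_single2 eW2 => e.
apply: (mulfI (w0 (v - 1 / 2))); rewrite mulrDr mulVKf// mulrBr.
have -> : (V t).2 k = (V t - U0).2 k + U0.2 k by rewrite -[X in _ = X + _]/((V t).2 k - U0.2 k) subrK.
rewrite mulrDr e addrAC; congr (_ + _); rewrite addrC; congr (_ + _).
rewrite mulrA -mulNr -c1//; apply: cintegral_eq => r _.
rewrite /innerX /= innerH0r addr0 innerH_single v12 (powR_succ lam0).
have -> : conjc (-1 : R[i]) = -1 by rewrite /conjc/= oppr0.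
by rewrite (rmorphM _ (lam k `^ _) (lam k)) /=; move: (_%:C) (_%:C) => x y; ring.
Qed.

Lemma weak_solution_unique (U V : R -> state) :
  weak_solution alpha beta mu T U0 f U -> weak_solution alpha beta mu T U0 f V ->
  forall t, t \in `[0, T] -> V t = U t.
Proof.
move=> hU hV; have [_ cU _] := hU; have [_ cV _] := hV.
have mode k t : 0 <= t <= T -> (V t).1 k = (U t).1 k /\ (V t).2 k = (U t).2 k.
  move=> ht.
  have iU s : s <= T -> _ := fun sT => coordinate_integrable alpha_lt2 k cU sT.
  have iV s : s <= T -> _ := fun sT => coordinate_integrable alpha_lt2 k cV sT.
  have [u1 u2 u3 u4] := coordinate_continuous alpha_lt2 k cU.
  have [v1 v2 v3 v4] := coordinate_continuous alpha_lt2 k cV.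
  have w0 : Num.sqrt (lam k) != 0 by rewrite gt_eqF// sqrtr_gt0.
  have lw : lam k = Num.sqrt (lam k) ^+ 2 by rewrite sqr_sqrtr// ltW.
  have cont (g h : R -> R) : {within `[0, T], continuous g} -> {within `[0, T], continuous h} ->
      {within `[0, T], continuous (fun t => g t - h t)}.
    by move=> cg ch r; apply: cvgB; [exact: cg|exact: ch].
  have mD s : measurable (`[0, s]%classic : set (measurableTypeR R)) by exact: measurable_itv.
  have dRe s : 0 <= s <= T -> Re ((V s).1 k) - Re ((U s).1 k) =
      \int[leb]_(r in `[0, s]) (Re ((V r).2 k) - Re ((U r).2 k)).
    move=> hs; have /andP[_ sT] := hs; have [_ [a2 _]] := iV s sT; have [_ [b2 _]] := iU s sT.
    have -> := (weak_solution_mode k hV hs).1; have -> := (weak_solution_mode k hU hs).1.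
    rewrite !ReD; transitivity (Re (cintegral `[0, s] (fun r => (V r).2 k)) - Re (cintegral `[0, s] (fun r => (U r).2 k))); first by ring.
    by rewrite RintegralB.
  have dIm s : 0 <= s <= T -> Im ((V s).1 k) - Im ((U s).1 k) =
      \int[leb]_(r in `[0, s]) (Im ((V r).2 k) - Im ((U r).2 k)).
    move=> hs; have /andP[_ sT] := hs; have [_ [_ a2]] := iV s sT; have [_ [_ b2]] := iU s sT.
    have -> := (weak_solution_mode k hV hs).1; have -> := (weak_solution_mode k hU hs).1.
    rewrite !ImD; transitivity (Im (cintegral `[0, s] (fun r => (V r).2 k)) - Im (cintegral `[0, s] (fun r => (U r).2 k))); first by ring.
    by rewrite RintegralB.
  have eRe s : 0 <= s <= T -> Re ((V s).2 k) - Re ((U s).2 k) =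
      - Num.sqrt (lam k) ^+ 2 * \int[leb]_(r in `[0, s]) (Re ((V r).1 k) - Re ((U r).1 k)).
    move=> hs; have /andP[_ sT] := hs; have [[a2 _] _] := iV s sT; have [[b2 _] _] := iU s sT.
    have -> := (weak_solution_mode k hV hs).2; have -> := (weak_solution_mode k hU hs).2.
    rewrite -lw !ReD !ReN !Re_realM; transitivity (- lam k * (Re (cintegral `[0, s] (fun r => (V r).1 k)) - Re (cintegral `[0, s] (fun r => (U r).1 k)))); first by ring.
    by rewrite RintegralB.
  have eIm s : 0 <= s <= T -> Im ((V s).2 k) - Im ((U s).2 k) =
      - Num.sqrt (lam k) ^+ 2 * \int[leb]_(r in `[0, s]) (Im ((V r).1 k) - Im ((U r).1 k)).
    move=> hs; have /andP[_ sT] := hs; have [[_ a2] _] := iV s sT; have [[_ b2] _] := iU s sT.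
    have -> := (weak_solution_mode k hV hs).2; have -> := (weak_solution_mode k hU hs).2.
    rewrite -lw !ImD !ImN !Im_realM; transitivity (- lam k * (Im (cintegral `[0, s] (fun r => (V r).1 k)) - Im (cintegral `[0, s] (fun r => (U r).1 k)))); first by ring.
    by rewrite RintegralB.
  have [r1 r2] := homogeneous_mode w0 (cont _ _ v1 u1) (cont _ _ v3 u3) dRe eRe ht.
  have [i1 i2] := homogeneous_mode w0 (cont _ _ v2 u2) (cont _ _ v4 u4) dIm eIm ht.
  by split; apply: complexP; apply/eqP; rewrite -subr_eq0; apply/eqP.
move=> t ht; case: (V t) (U t) (fun k => mode k t ht) => [a b] [c d] h.
by congr pair; apply/funext => k; have [] := h k.
Qed.

End Uniqueness.

(** * Controllability *)

Section Moment_control.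
Context {R : realType}.
Local Notation leb := (@lebesgue_measure R).

Lemma extension_by_zero (a b T : R) (g : R -> R) : 0 <= a -> b <= T ->
  square_integrable a b g -> let f := g \_ `[a, b] in
  square_integrable 0 T f /\
  forall phi : R -> R, \int[leb]_(t in `[0, T]) (f t * phi t) = \int[leb]_(t in `[a, b]) (g t * phi t).
Proof.
move=> a0 bT [mg ig] f.
have mD : measurable (`[a, b]%classic : set (measurableTypeR R)) by exact: measurable_itv.
have mE : measurable (`[0, T]%classic : set (measurableTypeR R)) by exact: measurable_itv.
have sub : `[a, b] `<=` `[0, T].
  by move=> x /=; rewrite !in_itv/= => /andP[h1 h2]; rewrite (le_trans a0) ?(le_trans h2).
have setE : `[0, T]%classic `&` `[a, b]%classic = `[a, b]%classic.
  by apply/seteqP; split=> x /=; rewrite !in_itv/=; [case|move=> /andP[h1 h2]; rewrite h1 h2 (le_trans a0)// (le_trans h2)].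
split; last first.
  move=> phi; rewrite -[in RHS]setE Rintegral_mkcondr.
  apply: eq_Rintegral => t _; rewrite /f /patch; case: ifP => // _; by rewrite mul0r.
have ff : measurable_fun `[0, T] f.
  by apply/(measurable_restrict _ mD mE); rewrite setE.
split => //.
rewrite (_ : EFin \o _ = (EFin \o (fun t => g t ^+ 2)) \_ `[a, b]).
  by apply/integrable_restrict => //; rewrite setE.
by apply/funext => t; rewrite /f /patch /=; case: ifP => // _; rewrite expr0n.
Qed.

Lemma rotation_inverse (c s C S C' S' : R) : c ^+ 2 + s ^+ 2 = 1 ->
  c * C + s * S = c * C' + s * S' -> c * S + - s * C = c * S' + - s * C' ->
  C = C' /\ S = S'.
Proof.
move=> cs h1 h2; split.
  rewrite -[C]mul1r -[C']mul1r -cs.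
  transitivity (c * (c * C + s * S) - s * (c * S + - s * C)); first by ring.
  by rewrite h1 h2; ring.
rewrite -[S]mul1r -[S']mul1r -cs.
transitivity (s * (c * C + s * S) + c * (c * S + - s * C)); first by ring.
by rewrite h1 h2; ring.
Qed.

Lemma moment_energy_le (w c p q sp sq L l : R) : c != 0 -> w != 0 -> 0 <= L ->
  l = w ^+ 2 -> p ^+ 2 <= sp -> q ^+ 2 <= sq ->
  ((p / c) ^+ 2 + (q / (w * c)) ^+ 2) * (L * l * c ^+ 2) <= L * (l * sp + sq).
Proof.
move=> c0 w0 L0 -> hp hq.
rewrite [leLHS](_ : _ = L * (w ^+ 2 * p ^+ 2 + q ^+ 2)); last by field; rewrite ?c0 ?w0.
by rewrite ler_wpM2l// lerD// ler_wpM2l// sqr_ge0.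
Qed.

(** Rotating the data passes between moments centred at 0 and at the middle of
    [a, b]; extension by 0 passes from [a, b] to [0, T]. *)
Lemma moments_onto (a b T : R) (om C S : nat -> R) (B : R) : 0 <= a -> b <= T ->
  interpolating a b om -> l2_bound B C S ->
  exists f, [/\ square_integrable 0 T f, forall t, t < a \/ b < t -> f t = 0 &
    forall k, \int[leb]_(t in `[0, T]) (f t * cos (om k * t)) = C k /\
              \int[leb]_(t in `[0, T]) (f t * sin (om k * t)) = S k].
Proof.
move=> a0 bT hi hB; pose m := (a + b) / 2.
pose u k := cos (om k * m) * C k + sin (om k * m) * S k.
pose w k := cos (om k * m) * S k + - sin (om k * m) * C k.
have hB' : l2_bound B u w.
  move=> N; rewrite (eq_bigr (fun k => C k ^+ 2 + S k ^+ 2)); first exact: hB.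
  move=> k _; rewrite /u /w -[RHS]mul1r -(cos2Dsin2 (om k * m)); ring.
have [g hg hm] := hi u w B hB'.
have [sf mf] := extension_by_zero a0 bT hg.
exists (g \_ `[a, b]); split => // [t ht|k].
  rewrite /patch; case: ifP => // /set_mem; rewrite /= in_itv/= => /andP[h1 h2].
  by case: ht => h; move: (lt_le_trans h h1) || move: (lt_le_trans h h2); rewrite ltxx.
rewrite !mf; have [e1 e2] := moment_rotation (om k) hg; have [e3 e4] := hm k.
rewrite e3 in e1; rewrite e4 in e2.
by have [-> ->] := rotation_inverse (cos2Dsin2 (om k * m)) e1 e2.
Qed.

End Moment_control.

Section Controllability.
Context {R : realType} (alpha beta mu : R).
Hypothesis alpha_lt2 : alpha < 2.
Local Notation v := (nu alpha beta mu).
Local Notation lam := (lambda alpha beta mu).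
Local Notation om k := (Num.sqrt (lam k)).
Local Notation kap := (kappa alpha).
Local Notation state := ((nat -> R[i]) * (nat -> R[i]))%type.
Local Notation leb := (@lebesgue_measure R).
Local Notation ctrl := (ctrl_coef alpha beta mu).
Variable T : R.
Hypothesis T_gt : 2 / kap < T.

Let lam0 k : 0 < lam k. Proof. exact: lambda_gt0. Qed.
Let k0 : 0 < kap. Proof. exact: kappa_gt0. Qed.

(** The gap of the frequencies tends to kappa pi, so that every interval longer
    than 2 / kappa is long enough. *)
Lemma frequencies_interpolating : exists2 d, 0 < d & d < T - d /\
  interpolating d (T - d) (fun k => om k).
Proof.
have T0 : 0 < T by apply: lt_trans T_gt; rewrite divr_gt0.
pose x := kap * T; have x2 : 2 < x by rewrite /x mulrC -ltr_pdivrMr.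
(* The loss of a factor 1 - e in the gap and again in the length of the
   interval is affordable when (1 - e)^2 kappa T > 2. *)
pose e := (x - 2) / (4 * x).
have e0 : 0 < e by rewrite divr_gt0//; lra.
have ex : e * (4 * x) = x - 2 by rewrite divfK// gt_eqF//; lra.
have e1 : e < 1 by rewrite -(ltr_pM2r (_ : 0 < 4 * x)) ?ex; lra.
have hx : 2 < x * (1 - e) ^+ 2 by have := sqr_ge0 e; nra.
have d0 : 0 < T * e / 2 by rewrite divr_gt0// mulr_gt0.
have dlt : T * e / 2 < T - T * e / 2 by have := mulr_gt0 T0 (_ : 0 < 1 - e); rewrite subr_gt0 => /(_ e1); lra.
exists (T * e / 2) => //; split => //.
have [N hN] := bessel_zero_gap_pi (nu_ge0 beta mu alpha_lt2) e0 e1.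
have [g0 g00 hg0] := bessel_zero_gap (nu_ge0 beta mu alpha_lt2).
apply: (interpolating_asymptotic_gap (g0 := kap * g0) (g := kap * (pi * (1 - e)))) => //.
- by rewrite sqrtr_gt0.
- by rewrite mulr_gt0.
- by move=> k; rewrite !sqrt_lambda// -mulrDr ler_wpM2l// ltW.
- exists N => k hk; rewrite !sqrt_lambda// -mulrDr ler_wpM2l ?(ltW k0)//.
  by rewrite addrC -lerBrDr; exact: hN.
have -> : T - T * e / 2 - T * e / 2 = T * (1 - e) by field.
have p0 : 0 < pi :> R by exact: pi_gt0.
have Te : 0 < T * (1 - e) by rewrite mulr_gt0// subr_gt0.
rewrite mulrA ltr_pdivrMr//.
rewrite [ltRHS](_ : _ = pi * (x * (1 - e) ^+ 2)); last by rewrite /x; ring.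
by rewrite [ltLHS]mulrC ltr_pM2l.
Qed.

Lemma input_state_onto : exists2 d, 0 < d & d < T - d /\ forall Y, X alpha beta mu Y ->
  exists f, [/\ square_integrableC 0 T f, forall t, t < d \/ T - d < t -> f t = 0 &
    input_state lam ctrl f 0 T = Y].
Proof.
have [d d0 [dT hi]] := frequencies_interpolating; exists d => //; split => // Y hY.
have [r0 [r1 [r00 hr]]] := ctrl_coef_bounds beta mu alpha_lt2.
have /(finite_energyP lam0)[B hB] := (XP alpha beta mu Y).1 hY.
have cz k : ctrl k != 0.
  apply/eqP => e; have /andP[h _] := hr k.
  by move: h; rewrite e expr0n /= mulr0 leNgt r00.
have oz k : om k != 0 by rewrite gt_eqF// sqrtr_gt0.
have bd (P : R[i] -> R) : (forall z, P z ^+ 2 <= sqrmod z) ->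
    l2_bound (B / r0) (fun k => P (Y.1 k) / ctrl k) (fun k => P (Y.2 k) / (om k * ctrl k)).
  move=> hP N; apply: (@le_trans _ _ (\sum_(0 <= k < N) mode_energy lam (v - 1 / 2) Y k / r0)); last first.
    by rewrite -mulr_suml ler_wpM2r// invr_ge0 ltW.
  apply: ler_sum => k _; rewrite ler_pdivlMr//.
  have /andP[h _] := hr k; have L0 : 0 < lam k `^ (v - 1 / 2) by rewrite powR_gt0.
  have q0 : 0 <= (P (Y.1 k) / ctrl k) ^+ 2 + (P (Y.2 k) / (om k * ctrl k)) ^+ 2.
    by rewrite addr_ge0 ?sqr_ge0.
  apply: le_trans (ler_wpM2l q0 h) _; rewrite /mode_energy.
  apply: moment_energy_le => //; [exact: ltW|].
  by rewrite sqr_sqrtr// ltW.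
have Td : T - d <= T by rewrite gerBl ltW.
have [|fr [sr zr mr]] := moments_onto (ltW d0) Td hi (bd (@complex.Re R) _).
  by move=> z; rewrite lerDl sqr_ge0.
have [|fi [si zi mi]] := moments_onto (ltW d0) Td hi (bd (@complex.Im R) _).
  by move=> z; rewrite lerDr sqr_ge0.
exists (fun t => fr t +i* fi t); split => // [t ht|]; first by rewrite zr// zi.
case: Y {hY hB bd} mr mi => Y1 Y2 mr mi; congr pair; apply/funext => k.
  rewrite fourier_cosE /= (mr k).1 (mi k).1 /=.
  by case: (Y1 k) => p q; apply: complexP; rewrite ?Re_realM ?Im_realM /=; field.
rewrite fourier_sinE /= (mr k).2 (mi k).2 /=.
by case: (Y2 k) => p q; apply: complexP; rewrite ?Re_realM ?Im_realM /=; field; rewrite ?cz ?oz.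
Qed.

End Controllability.

Section Endpoints.
Context {R : realType} (lam : nat -> R) (lam0 : forall k, 0 < lam k) (bt : nat -> R).
Local Notation state := ((nat -> R[i]) * (nat -> R[i]))%type.
Local Notation leb := (@lebesgue_measure R).

Lemma input_state_null f (a b : R) : (forall t, a <= t <= b -> f t = 0) ->
  input_state lam bt f a b = 0.
Proof.
move=> f0; have z (phi : R -> R) : cintegral `[a, b] (fun r => (phi r)%:C * f r) = 0.
  rewrite (cintegral_eq (G := fun=> 0)).
    by rewrite /cintegral /Rintegral !integral0.
  by move=> r /=; rewrite in_itv/= => hr; rewrite f0// mulr0.
by congr pair; apply/funext => k; rewrite /= ?/fourier_cos ?/fourier_sin z mulr0.
Qed.

End Endpoints.

Section Main.
Context {R : realType} (alpha beta mu : R).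
Hypothesis alpha_lt2 : alpha < 2.
Local Notation v := (nu alpha beta mu).
Local Notation lam := (lambda alpha beta mu).
Local Notation kap := (kappa alpha).
Local Notation state := ((nat -> R[i]) * (nat -> R[i]))%type.
Local Notation ctrl := (ctrl_coef alpha beta mu).
Variable T : R.
Hypothesis T_gt : 2 / kap < T.

Let lam0 k : 0 < lam k. Proof. exact: lambda_gt0. Qed.
Let v12 : v + 1 / 2 = v - 1 / 2 + 1. Proof. by field. Qed.
Let T0 : 0 < T.
Proof. by apply: lt_trans T_gt; rewrite divr_gt0// kappa_gt0. Qed.

Lemma X0 : X alpha beta mu 0.
Proof. by split; exact: Hspace0. Qed.

Lemma X_group t U : X alpha beta mu U -> X alpha beta mu (wave_group lam t U).
Proof.
move=> /XP/(finite_energyP lam0)[B hB]; apply/XP/(finite_energyP lam0); exists B => N.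
by rewrite (eq_bigr _ (fun k _ => mode_energy_group lam0 (v - 1 / 2) t U k)).
Qed.

Lemma X_sub U V : X alpha beta mu U -> X alpha beta mu V -> X alpha beta mu (U - V).
Proof. by move=> [u1 u2] [v1 v2]; split; [exact: HspaceD u1 (HspaceN v1)|exact: HspaceD u2 (HspaceN v2)]. Qed.

Lemma exactly_controllable_in : exactly_controllable alpha beta mu T.
Proof.
apply/seteqP; split=> [_ [f /(L2P T _) hf <-]|U hU].
  rewrite input_mapE// -[input_state _ _ _ _ _]add0r.
  by apply: (trajectory_X alpha_lt2 T0 X0 hf); rewrite (ltW T0) lexx.
have [d d0 [dT onto]] := input_state_onto beta mu alpha_lt2 T_gt.
have [f [hf _ fE]] := onto _ (X_group (- T) hU).
exists f; first exact/(L2P T _).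
by rewrite input_mapE// fE -(wave_groupD lam0) subrr wave_group0.
Qed.

Lemma sub_square_integrable f t : t <= T -> square_integrableC 0 T f -> square_integrableC 0 t f.
Proof.
move=> tT; apply: square_integrableC_sub => x /=; rewrite !in_itv/= => /andP[-> h].
exact: le_trans tT.
Qed.

(** Since the control vanishes near the endpoints of [0, T], the solution is a
    free wave there. *)
Lemma free_time_derivative U0 f (Z : state) t d : X alpha beta mu Z -> 0 < d ->
  square_integrableC 0 T f -> 0 <= t <= T ->
  (forall s, 0 <= s <= T -> `|t - s| < d -> U0 + input_state lam ctrl f 0 s = Z) ->
  has_time_derivative alpha beta mu T (fun s => (mild_solution alpha beta mu U0 f s).1) t
    (wave_group lam t Z).2.
Proof.
move=> hZ d0 hf ht hs; have /andP[_ tT] := ht.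
have e s : 0 <= s <= T -> `|t - s| < d -> mild_solution alpha beta mu U0 f s = wave_group lam s Z.
  move=> hs' hd; have /andP[_ sT] := hs'.
  rewrite mild_solutionE//; last exact: sub_square_integrable sT hf.
  by rewrite /trajectory hs.
have /XP[z1 z2] := hZ.
have hd := wave_group_time_derivative lam0 t z1 z2.
have hd2 : sqnormH lam (v - 1 / 2) (fun k => ((wave_group lam r Z).1 k - (wave_group lam t Z).1 k) / (r - t)%:C
    - (wave_group lam t Z).2 k) @[r --> within `[0, T] t^'] --> 0%E.
  exact: cvg_within_filter hd.
rewrite /has_time_derivative; apply: cvg_trans hd2.
apply: near_eq_cvg; rewrite near_withinE near_withinE.
apply/nbhs_ballP; exists d => // s hsd _ hs'.
by rewrite !e ?subrr ?normr0.
Qed.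

(** The input has to be the difference between the target and the initial state,
    both transported back to time 0. *)
Lemma controllability U0 UT : X alpha beta mu U0 -> X alpha beta mu UT ->
  exists2 f : R -> R[i], L2 T f &
    let U := mild_solution alpha beta mu U0 f in
    [/\ weak_solution alpha beta mu T U0 f U,
        forall V : R -> state, weak_solution alpha beta mu T U0 f V ->
          forall t : R, t \in `[0, T] -> V t = U t,
        U 0 = U0 /\ has_time_derivative alpha beta mu T (fun t => (U t).1) 0 U0.2 &
        U T = UT /\ has_time_derivative alpha beta mu T (fun t => (U t).1) T UT.2].
Proof.
move=> hU0 hUT; have [d d0 [dT onto]] := input_state_onto beta mu alpha_lt2 T_gt.
have [f [hf fz fE]] := onto _ (X_sub (X_group (- T) hUT) hU0).
exists f; first exact/(L2P T _).
move=> U; have hw : weak_solution alpha beta mu T U0 f U.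
  apply: weak_solution_ext (trajectory_weak alpha_lt2 T0 hU0 hf) => t /andP[_ tT].
  by rewrite /U mild_solutionE//; exact: sub_square_integrable tT hf.
have T00 : 0 <= (0 : R) <= T by rewrite lexx ltW.
have TT : 0 <= T <= T by rewrite lexx ltW.
have start s : 0 <= s <= T -> `|0 - s| < d -> U0 + input_state lam ctrl f 0 s = U0.
  move=> /andP[s0 _]; rewrite sub0r normrN ger0_norm// => sd.
  rewrite input_state_null ?addr0// => t /andP[_ ts]; apply: fz; left.
  exact: le_lt_trans sd.
have finish s : 0 <= s <= T -> `|T - s| < d ->
    U0 + input_state lam ctrl f 0 s = wave_group lam (- T) UT.
  move=> /andP[s0 sT]; rewrite ger0_norm ?subr_ge0// => sd.
  have := input_stateB lam ctrl s0 sT hf; have -> : input_state lam ctrl f s T = 0.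
    by apply: input_state_null => t /andP[st _]; apply: fz; right; lra.
  by move/eqP; rewrite subr_eq0 => /eqP <-; rewrite fE addrC subrK.
have n0 (x : R) : `|x - x| < d by rewrite subrr normr0.
split => //.
- by move=> V hV; exact: weak_solution_unique hw hV.
- split.
    rewrite /U mild_solutionE//; last exact: sub_square_integrable (ltW T0) hf.
    by rewrite /trajectory start// wave_group0.
  by have := free_time_derivative hU0 d0 hf T00 start; rewrite wave_group0.
split.
  by rewrite /U mild_solutionE// /trajectory finish// -(wave_groupD lam0) subrr wave_group0.
have := free_time_derivative (X_group (- T) hUT) d0 hf TT finish.
by rewrite -(wave_groupD lam0) subrr wave_group0.
Qed.

End Main.

Theorem theorem1 (R : realType) (alpha beta mu T : R)
    (alpha_ge0 : 0 <= alpha) (alpha_lt2 : alpha < 2)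
    (Delta_ge0 : 4 * mu <= (1 - alpha - beta) ^+ 2)
    (T_gt : 4 / (2 - alpha) < T) :
  exactly_controllable alpha beta mu T /\
  forall U0 UT : (nat -> R[i]) * (nat -> R[i]),
    X alpha beta mu U0 -> X alpha beta mu UT ->
    exists2 f : R -> R[i], L2 T f &
      let U := mild_solution alpha beta mu U0 f in
      [/\ weak_solution alpha beta mu T U0 f U,
          forall V : R -> (nat -> R[i]) * (nat -> R[i]),
            weak_solution alpha beta mu T U0 f V ->
            forall t : R, t \in `[0, T] -> V t = U t,
          U 0 = U0 /\
            has_time_derivative alpha beta mu T (fun t => (U t).1) 0 U0.2 &
          U T = UT /\
            has_time_derivative alpha beta mu T (fun t => (U t).1) T UT.2].
Proof.
have hT : 2 / kappa alpha < T.
  apply: le_lt_trans T_gt; rewrite le_eqVlt; apply/orP; left; apply/eqP.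
  by rewrite /kappa; field; rewrite subr_eq0 gt_eqF.
by split; [exact: exactly_controllable_in|move=> U0 UT; exact: controllability].
Qed.
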